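(* Let $(\mathbf u,p,C)$ and $(\mathbf u_h^{i+1},p_h^{i+1},C_h^{i+1})$ be the respective solutions of problems $(V_a)$ and $(V_{ahi})$. Then for each element $\kappa\in\mathcal T_h$, $$\eta_{\kappa,i}^{(L_1)}\le\|\mathbf u-\mathbf u_h^i\|_{L^2(\kappa)}+\|\mathbf u-\mathbf u_h^{i+1}\|_{L^2(\kappa)}$$ and $$\eta_{\kappa,i}^{(D_3)}\le c\,\|\mathbf v_r\|_{L^3(w_\kappa)},$$ where $c$ is a positive constant independent of $h$.
   Context: Setting. $d\in\{2,3\}$ and $\Omega\subset\mathbb R^d$ is a bounded, simply connected open polygon ($d=2$) or polyhedron ($d=3$) with Lipschitz boundary and outer unit normal $\mathbf n$. $|\cdot|$ is the Euclidean norm. $\mu,\rho,\beta,\alpha,r_0,\gamma$ are strictly positive constants. $K$ is a uniformly positive definite, bounded tensor field with $0<K_m\le\|K^{-1}\|_{L^\infty(\Omega)^{d\times d}}\le K_M$, where $K_m$ is not larger than the smallest eigenvalue of $K^{-1}$ over $\Omega$. The data satisfy $\mathbf f(\mathbf x,C)=\mathbf f_0(\mathbf x)+\mathbf f_1(C)$ with $\mathbf f_0\in L^{3/2}(\Omega)^d$, $\mathbf f_1:\mathbb R\to\mathbb R^d$ Lipschitz with constant $c_{\mathbf f_1}>0$ and $\mathbf f_1(0)=0$, and $g\in L^2(\Omega)$. $\mathbf f(\cdot,C)$ denotes $\mathbf x\mapsto\mathbf f(\mathbf x,C(\mathbf x))$. Spaces: $X=L^3(\Omega)^d$, $M=W^{1,3/2}(\Omega)\cap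 L^2_0(\Omega)$ ($L^2_0$: zero-mean functions of $L^2$), $Y=H^1_0(\Omega)$. Problem $(V_a)$: find $(\mathbf u,p,C)\in X\times M\times Y$ such that for all $\mathbf v\in X$, $q\in M$, $S\in Y$: $\frac\mu\rho\int_\Omega K^{-1}\mathbf u\cdot\mathbf v+\frac\beta\rho\int_\Omega|\mathbf u|\mathbf u\cdot\mathbf v+\int_\Omega\nabla p\cdot\mathbf v=\int_\Omega\mathbf f(\cdot,C)\cdot\mathbf v$; $\int_\Omega\nabla q\cdot\mathbf u=0$; $\alpha\int_\Omega\nabla C\cdot\nabla S+\int_\Omega(\mathbf u\cdot\nabla C)S+r_0\int_\Omega CS=\int_\Omega gS$. Meshes: $(\mathcal T_h)_h$ is a family of conforming triangulations of $\overline\Omega$ by closed nondegenerate triangles/tetrahedra $\kappa$, of maximal diameter $h$; $h_\kappa$ is the diameter of $\kappa$, $\rho_\kappa$ that of its inscribed ball, $h_e$ the diameter of an edge ($d=2$) or face ($d=3$) $e$. It is regular ($\max_\kappa h_\kappa/\rho_\kappa\le\sigma$, $\sigma$ independent of $h$) and uniformly regular ($h_\kappa\ge\beta_0h$, $\beta_0>0$ independent of $h$). $w_\kappa$ is the union of the elements of $\mathcal T_h$ meeting $\kappa$, $w_e$ the union of the elements adjacent to $e$. Discrete spaces: with $b_\kappa=\lambda_1\cdots\lambda_{d+1}$ the product of the barycentric coordinates of $\kappa$ and $\mathcal P(\kappa)=\mathbb P_1(\kappa)\oplus\mathrm{Vect}\{b_\kappa\}$, $X_h=\{\mathbf v_h\in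 C^0(\overline\Omega)^d:\mathbf v_h|_\kappa\in\mathcal P(\kappa)^d\ \forall\kappa\}$, $M_h=\{q_h\in C^0(\overline\Omega):q_h|_\kappa\in\mathbb P_1(\kappa)\ \forall\kappa\}\cap L_0^2(\Omega)$, $Y_h=\{q_h\in C^0(\overline\Omega):q_h|_\kappa\in\mathbb P_1(\kappa)\ \forall\kappa\}\cap H_0^1(\Omega)$. Iterative problem $(V_{ahi})$: given $(\mathbf u_h^i,C_h^i)\in X_h\times Y_h$, find $(\mathbf u_h^{i+1},p_h^{i+1},C_h^{i+1})\in X_h\times M_h\times Y_h$ such that for all $\mathbf v_h\in X_h$, $q_h\in M_h$, $S_h\in Y_h$: $\gamma\int_\Omega(\mathbf u_h^{i+1}-\mathbf u_h^i)\cdot\mathbf v_h+\frac\mu\rho\int_\Omega K^{-1}\mathbf u_h^{i+1}\cdot\mathbf v_h+\frac\beta\rho\int_\Omega|\mathbf u_h^i|\mathbf u_h^{i+1}\cdot\mathbf v_h+\int_\Omega\nabla p_h^{i+1}\cdot\mathbf v_h=\int_\Omega\mathbf f(\cdot,C_h^i)\cdot\mathbf v_h$; $\int_\Omega\nabla q_h\cdot\mathbf u_h^{i+1}=0$; $\alpha\int_\Omega\nabla C_h^{i+1}\cdot\nabla S_h+\int_\Omega(\mathbf u_h^{i+1}\cdot\nabla C_h^{i+1})S_h+\frac12\int_\Omega\operatorname{div}(\mathbf u_h^{i+1})C_h^{i+1}S_h+r_0\int_\Omega C_h^{i+1}S_h=\int_\Omega gS_h$. $\phi_{h,1}^e=\frac12[\mathbf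 u_h^{i+1}\cdot\mathbf n]_e$ (jump across $e$) if the edge/face $e$ is not contained in $\partial\Omega$, and $\phi_{h,1}^e=\mathbf u_h^{i+1}\cdot\mathbf n$ if $e\subset\partial\Omega$. Indicators for $\kappa\in\mathcal T_h$: $\eta_{\kappa,i}^{(L_1)}=\|\mathbf u_h^{i+1}-\mathbf u_h^i\|_{L^2(\kappa)}$; $\eta_{\kappa,i}^{(D_3)}=h_\kappa\|\operatorname{div}\mathbf u_h^{i+1}\|_{L^3(\kappa)}+\sum_{e\in\partial\kappa}h_e^{1/3}\|\phi_{h,1}^e\|_{L^3(e)}$. $r_h$ is a Clément-type interpolation operator onto continuous piecewise $\mathbb P_1$ functions with $\|q-r_hq\|_{L^{3/2}(\kappa)}\le c_\kappa h_\kappa|q|_{W^{1,3/2}(w_\kappa)}$ and $\|q-r_hq\|_{L^{3/2}(e)}\le c_eh_e^{1/3}|q|_{W^{1,3/2}(w_e)}$ for $q\in W^{1,3/2}(\Omega)$, $c_\kappa,c_e$ independent of $h$. $\mathbf v_r\in L^3(\Omega)^d$ (depending on $h$ and $i$) denotes a velocity such that for all $q\in M$, $\int_\Omega\nabla q\cdot\mathbf v_r=\sum_{\kappa}\big(\int_\kappa(q-r_hq)\operatorname{div}\mathbf u_h^{i+1}-\sum_{e\in\partial\kappa}\int_e\phi_{h,1}^e(q-r_hq)\,ds\big)$ and $\|\mathbf v_r\|_{L^3(\Omega)^d}\le c_2'\sum_\kappa\eta_{\kappa,i}^{(D_3)}$ with $c_2'$ independent of $h$ (such a velocity exists). One has $\int_\Omega\nabla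 q\cdot(\mathbf u-\mathbf u_h^{i+1}-\mathbf v_r)=0$ for all $q\in M$. *)

(* Defs.v *)
From HB Require Import structures.
From mathcomp Require Import all_boot all_order all_algebra.
From mathcomp Require Import all_classical all_reals all_analysis.
Set Implicit Arguments.
Unset Strict Implicit.
Unset Printing Implicit Defensive.
Import Order.TTheory GRing.Theory Num.Theory.
Import numFieldNormedType.Exports.
Local Open Scope classical_set_scope.
Local Open Scope ring_scope.

(* The Borel sigma-algebra of R^n, generated by the coordinate maps; the library
   only has the analogous construction for tuples. *)
Section rV_measurable.
Context {R : realType}.
Variable n : nat.
Let coord (i : 'I_n) (v : 'rV[R]_n) : R := v ord0 i.

Let rV_set0 : g_sigma_preimage coord set0.
Proof. exact: sigma_algebra0. Qed.

Let rV_setC A : g_sigma_preimage coord A -> g_sigma_preimage coord (~` A).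
Proof. exact: sigma_algebraC. Qed.

Let rV_bigcup (F : _^nat) : (forall i, g_sigma_preimage coord (F i)) ->
  g_sigma_preimage coord (\bigcup_i (F i)).
Proof. exact: sigma_algebra_bigcup. Qed.

HB.instance Definition _ := @isMeasurable.Build default_measure_display
  'rV[R]_n (g_sigma_preimage coord) rV_set0 rV_setC rV_bigcup.

End rV_measurable.

Section lebesgue_measure_rV.
Context {R : realType}.

Lemma measurable_coord n (i : 'I_n) :
  measurable_fun [set: 'rV[R]_n] (fun v : 'rV[R]_n => v ord0 i).
Proof.
move=> _ Y mY; rewrite setTI; apply: sub_sigma_algebra => /=.
rewrite -bigcup_seq/=; exists i => /=; first by rewrite mem_index_enum.
by exists Y => //; rewrite setTI.
Qed.

Lemma measurable_fun_rV d (T : measurableType d) n (f : T -> 'rV[R]_n) :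
  (forall i, measurable_fun [set: T] (fun x => f x ord0 i)) ->
  measurable_fun [set: T] f.
Proof.
move=> mf _ Y mY; rewrite setTI.
suff : preimage_set_system [set: T] f measurable (f @^-1` Y).
  rewrite /measurable/= -g_sigma_preimage_comp => H.
  apply: (smallest_sub _ _ H); first exact: sigma_algebra_measurable.
  rewrite -bigcup_seq => A [i _ [B mB <-]].
  exact: mf.
by exists Y => //; rewrite setTI.
Qed.

Definition cons_rV n (p : measurableTypeR R * 'rV[R]_n) : 'rV[R]_n.+1 :=
  \row_i (if unlift ord0 i is Some j then p.2 ord0 j else p.1).

Definition uncons_rV n (v : 'rV[R]_n.+1) : measurableTypeR R * 'rV[R]_n :=
  (v ord0 ord0, \row_j v ord0 (lift ord0 j)).

Lemma cons_rV0 n (p : measurableTypeR R * 'rV[R]_n) :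
  cons_rV p ord0 ord0 = p.1.
Proof. by rewrite mxE unlift_none. Qed.

Lemma cons_rV_lift n (p : measurableTypeR R * 'rV[R]_n) j :
  cons_rV p ord0 (lift ord0 j) = p.2 ord0 j.
Proof. by rewrite mxE liftK. Qed.

Lemma cons_rVK n : cancel (@cons_rV n) (@uncons_rV n).
Proof.
move=> [x v]; rewrite /uncons_rV cons_rV0/=; congr pair.
by apply/rowP => j; rewrite mxE cons_rV_lift.
Qed.

Lemma uncons_rVK n : cancel (@uncons_rV n) (@cons_rV n).
Proof.
move=> v; apply/rowP => i.
have [j ->|->] := unliftP ord0 i; last by rewrite cons_rV0.
by rewrite cons_rV_lift mxE.
Qed.

Lemma measurable_cons_rV n : measurable_fun setT (@cons_rV n).
Proof.
apply: measurable_fun_rV => i; have [j ->|->] := unliftP ord0 i.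
  under eq_fun do rewrite cons_rV_lift.
  exact: (measurableT_comp (measurable_coord j) measurable_snd).
by under eq_fun do rewrite cons_rV0; exact: measurable_fst.
Qed.

Lemma measurable_uncons_rV n : measurable_fun setT (@uncons_rV n).
Proof.
apply/measurable_fun_pair => /=; first exact: measurable_coord.
apply: measurable_fun_rV => i; under eq_fun do rewrite mxE.
exact: measurable_coord.
Qed.

Section step.
Variables (n : nat) (m : {sigma_finite_measure set 'rV[R]_n -> \bar R}).

Definition lebesgue_cons : set 'rV[R]_n.+1 -> \bar R :=
  pushforward (@lebesgue_measure R \x m)%E (@cons_rV n).

Let lebesgue_cons0 : lebesgue_cons set0 = 0%E.
Proof. by rewrite /lebesgue_cons /pushforward preimage_set0 measure0. Qed.

Let lebesgue_cons_ge0 A : (0 <= lebesgue_cons A)%E.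
Proof. exact: (measure_ge0 (@lebesgue_measure R \x m)%E). Qed.

Let lebesgue_cons_sigma_additive : semi_sigma_additive lebesgue_cons.
Proof.
exact: (@measure_semi_sigma_additive _ _ _
  (measure_function_pushforward__canonical__measure_function_Measure
     _ (@measurable_cons_rV n))).
Qed.

HB.instance Definition _ := isMeasure.Build _ _ _ lebesgue_cons
  lebesgue_cons0 lebesgue_cons_ge0 lebesgue_cons_sigma_additive.

Let lebesgue_cons_sigma_finite : sigma_finite setT lebesgue_cons.
Proof.
have /sigma_finiteP[F [TF ndF Foo]] := sigma_finiteT (@lebesgue_measure R).
have /sigma_finiteP[G [TG ndG Goo]] := sigma_finiteT m.
exists (fun k => @uncons_rV n @^-1` (F k `*` G k)).
  apply/seteqP; split=> // v _.
  have [i _ Fi] : (\bigcup_i F i) (v ord0 ord0) by rewrite -TF.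
  have [j _ Gj] : (\bigcup_i G i) (\row_j v ord0 (lift ord0 j)) by rewrite -TG.
  exists (maxn i j) => //; split.
  - by move: Fi; exact/subsetPset/ndF/leq_maxl.
  - by move: Gj; exact/subsetPset/ndG/leq_maxr.
move=> k; have [mF Fk] := Foo k; have [mG Gk] := Goo k; split.
  rewrite -[X in measurable X]setTI; apply: measurable_uncons_rV => //.
  exact: measurableX.
rewrite /lebesgue_cons /pushforward -comp_preimage.
rewrite (_ : _ \o _ = id); last by apply/funext => p /=; rewrite cons_rVK.
by rewrite preimage_id product_measure1E// lte_mul_pinfty// ge0_fin_numE.
Qed.

HB.instance Definition _ := Measure_isSigmaFinite.Build _ _ _ lebesgue_cons
  lebesgue_cons_sigma_finite.

End step.

Fixpoint lebesgue_rV n : {sigma_finite_measure set 'rV[R]_n -> \bar R} :=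
  match n with
  | 0 => dirac (0 : 'rV[R]_0)
  | n'.+1 => lebesgue_cons (lebesgue_rV n')
  end.

End lebesgue_measure_rV.

Section euclidean.
Context {R : realType}.

Definition dot n (x y : 'rV[R]_n) : R := \sum_i x ord0 i * y ord0 i.

(* The library norm on 'rV[R]_n is the sup norm. *)
Definition enorm n (x : 'rV[R]_n) : R := Num.sqrt (dot x x).

(* The product A x of a matrix with a vector stored as a row. *)
Definition mxapp n (A : 'M[R]_n) (x : 'rV[R]_n) : 'rV[R]_n := x *m A^T.

Definition opnorm n (A : 'M[R]_n) : R :=
  sup [set enorm (mxapp A x) | x in [set x | enorm x <= 1]].

Definition diam n (A : set 'rV[R]_n) : R :=
  sup [set enorm (z.1 - z.2) | z in A `*` A].

(* Diameter of the largest ball contained in A. *)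
Definition indiam n (A : set 'rV[R]_n) : R :=
  sup [set 2 * r | r in [set r | 0 <= r /\
    exists x, forall y, enorm (y - x) <= r -> A y]].

Definition boundary n (A : set 'rV[R]_n) : set 'rV[R]_n := closure A `\` A°.

End euclidean.

(* The space dimension is n.+1 throughout. *)
Section calculus.
Context {R : realType} {n : nat}.
Implicit Types (f q : 'rV[R]_n.+1 -> R) (v G : 'rV[R]_n.+1 -> 'rV[R]_n.+1).
Implicit Types (D : set 'rV[R]_n.+1).

(* Classical derivatives.  For continuous piecewise polynomial functions they
   exist off the element boundaries, a Lebesgue-null set. *)
Definition partial (i : 'I_n.+1) f (x : 'rV[R]_n.+1) : R :=
  'D_(delta_mx ord0 i : 'rV[R]_n.+1) f x.

Definition grad f (x : 'rV[R]_n.+1) : 'rV[R]_n.+1 := \row_i partial i f x.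

Definition divergence v (x : 'rV[R]_n.+1) : R :=
  \sum_i partial i (fun y => v y ord0 i) x.

Fixpoint Ck (k : nat) f : Prop :=
  continuous f /\
  if k is k'.+1 then
    (forall i x, derivable f x (delta_mx ord0 i : 'rV[R]_n.+1)) /\
    (forall i, Ck k' (partial i f))
  else True.

Definition smooth f : Prop := forall k, Ck k f.

Definition test_function D f : Prop :=
  [/\ smooth f, compact (closure [set x | f x != 0])
    & closure [set x | f x != 0] `<=` D].

Definition Lp_norm (p : \bar R) D f : \bar R :=
  Lnorm (lebesgue_rV n.+1) p (EFin \o (f \_ D)).

Definition in_Lp (p : \bar R) D f : Prop :=
  measurable_fun D f /\ (Lp_norm p D f < +oo)%E.

Definition vLp_norm (p : \bar R) D v : \bar R :=
  Lp_norm p D (fun x => enorm (v x)).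

Definition in_vLp (p : \bar R) D v : Prop :=
  measurable_fun D v /\ (vLp_norm p D v < +oo)%E.

Definition integ D f : R := (\int[lebesgue_rV n.+1]_(x in D) f x)%R.

Definition weak_grad D q G : Prop :=
  forall phi, test_function D phi -> forall i,
    integ D (fun x => q x * partial i phi x) =
    - integ D (fun x => G x ord0 i * phi x).

(* Membership in a Sobolev space is a relation between a function and a weak
   gradient of it, the latter being determined only almost everywhere. *)
Definition in_W1p (p : \bar R) D q G : Prop :=
  [/\ in_Lp p D q, in_vLp p D G & weak_grad D q G].

Definition in_H10 D q G : Prop :=
  in_W1p 2%:E D q G /\
  exists phi : nat -> 'rV[R]_n.+1 -> R,
    [/\ forall m, test_function D (phi m),
        Lp_norm 2%:E D (fun x => phi m x - q x) @[m --> \oo] --> 0%E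
      & vLp_norm 2%:E D (fun x => grad (phi m) x - G x) @[m --> \oo] --> 0%E].

Definition in_L20 D q : Prop := in_Lp 2%:E D q /\ integ D q = 0.

(* The pressure space. *)
Definition in_M D q G : Prop := in_W1p (3 / 2)%:E D q G /\ in_L20 D q.

End calculus.

Section domains.
Context {R : realType} {n : nat}.
Implicit Types (D : set 'rV[R]_n.+1).

Let I01 : set R := `[0, 1]%classic.

Definition simply_connected D : Prop :=
  [/\ D !=set0,
    (forall x y, D x -> D y -> exists c : R -> 'rV[R]_n.+1,
      [/\ {within I01, continuous c}, c @` I01 `<=` D, c 0 = x & c 1 = y])
  & (forall c : R -> 'rV[R]_n.+1,
      {within I01, continuous c} -> c @` I01 `<=` D -> c 0 = c 1 ->
      exists H : R * R -> 'rV[R]_n.+1,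
        [/\ {within I01 `*` I01, continuous H}, H @` (I01 `*` I01) `<=` D,
            forall s, I01 s -> H (0, s) = c s /\ H (1, s) = c 0
          & forall t, I01 t -> H (t, 0) = c 0 /\ H (t, 1) = c 0])].

(* Near each boundary point D is, in suitable orthonormal coordinates, the
   strict epigraph of a Lipschitz function. *)
Definition lipschitz_boundary D : Prop :=
  forall x, boundary D x ->
  exists (Q : 'M[R]_n.+1) (phi : 'rV[R]_n -> R) (L r : R),
    [/\ Q *m Q^T = 1%:M, 0 < r,
        forall a b, `|phi a - phi b| <= L * enorm (a - b)
      & forall y, enorm (y - x) < r ->
          (D y <-> phi (\row_j (y *m Q) ord0 (lift ord0 j))
                     < (y *m Q) ord0 ord0)].

(* A simplex is given by its n.+2 vertices, the rows of a matrix. *)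
Definition simplex := 'M[R]_(n.+2, n.+1).
Implicit Types (V : simplex).

Definition bary_mx V : 'M[R]_n.+2 := row_mx (const_mx 1 : 'cV_(n.+2)) V.

Definition nondegenerate_simplex V : bool := bary_mx V \in unitmx.

(* Barycentric coordinates: the solution l of (sum_j l_j = 1, l V = x). *)
Definition bary V (x : 'rV[R]_n.+1) : 'rV[R]_n.+2 :=
  (row_mx (const_mx 1 : 'rV_1) x : 'rV_n.+2) *m invmx (bary_mx V).

Definition face V (A : pred 'I_n.+2) : set 'rV[R]_n.+1 :=
  [set x | exists l : 'rV[R]_n.+2,
    [/\ forall j, 0 <= l ord0 j, forall j, ~~ A j -> l ord0 j = 0,
        \sum_j l ord0 j = 1 & x = l *m V]].

Definition hull V : set 'rV[R]_n.+1 := face V predT.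

(* The edge (n.+1 = 2) or face (n.+1 = 3) opposite to vertex j. *)
Definition facet V (j : 'I_n.+2) : set 'rV[R]_n.+1 := face V (predC1 j).

Definition polyhedral D : Prop :=
  exists (N : nat) (V : 'I_N -> simplex),
    (forall k, nondegenerate_simplex (V k)) /\
    closure D = \bigcup_(k in [set: 'I_N]) hull (V k).

Definition polyhedral_domain D : Prop :=
  [/\ bounded_set D, open D, simply_connected D, polyhedral D
    & lipschitz_boundary D].

(* The gradient of the (affine) j-th barycentric coordinate, read off the
   coefficients of bary; it points from the facet opposite j into V. *)
Definition bary_grad V (j : 'I_n.+2) : 'rV[R]_n.+1 :=
  \row_i invmx (bary_mx V) (lift ord0 i) j.

Definition outer_normal V (j : 'I_n.+2) : 'rV[R]_n.+1 :=
  - (enorm (bary_grad V j))^-1 *: bary_grad V j.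

(* Integration over a facet for the surface measure, through the affine
   parametrization s |-> a + s E of the facet by the reference simplex of R^n,
   of Jacobian sqrt (det (E E^T)). *)
Definition ref_simplex : set 'rV[R]_n :=
  [set s | (forall i, 0 <= s ord0 i) /\ \sum_i s ord0 i <= 1].

Definition facet_edges V (j : 'I_n.+2) : 'M[R]_(n, n.+1) :=
  \matrix_(m < n, i < n.+1)
    (V (lift j (lift ord0 m)) i - V (lift j ord0) i).

Definition facet_param V (j : 'I_n.+2) (s : 'rV[R]_n) : 'rV[R]_n.+1 :=
  row (lift j ord0) V + s *m facet_edges V j.

Definition facet_jac V (j : 'I_n.+2) : R :=
  Num.sqrt (\det (facet_edges V j *m (facet_edges V j)^T)).

Definition facet_int V (j : 'I_n.+2) (f : 'rV[R]_n.+1 -> R) : R :=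
  facet_jac V j *
  (\int[lebesgue_rV n]_(s in ref_simplex) f (facet_param V j s))%R.

Definition facet_norm (p : R) V (j : 'I_n.+2) (f : 'rV[R]_n.+1 -> R) : \bar R :=
  (((facet_jac V j)%:E *
    \int[lebesgue_rV n]_(s in ref_simplex)
      (`|f (facet_param V j s)| `^ p)%:E) `^ p^-1)%E.

(* t is the trace on the facet opposite j of q, a function of W^{1,p}(V) with
   weak gradient G, by density of smooth functions. *)
Definition is_trace (p : R) V (j : 'I_n.+2) (q : 'rV[R]_n.+1 -> R)
    (G : 'rV[R]_n.+1 -> 'rV[R]_n.+1) (t : 'rV[R]_n.+1 -> R) : Prop :=
  [/\ measurable_fun ref_simplex (t \o facet_param V j),
      (facet_norm p V j t < +oo)%E
    & exists phi : nat -> 'rV[R]_n.+1 -> R,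
      [/\ forall m, smooth (phi m),
          Lp_norm p%:E (hull V) (fun x => phi m x - q x) @[m --> \oo] --> 0%E,
          vLp_norm p%:E (hull V) (fun x => grad (phi m) x - G x)
            @[m --> \oo] --> 0%E
        & facet_norm p V j (fun x => phi m x - t x) @[m --> \oo] --> 0%E]].

End domains.
Arguments simplex : clear implicits.

Record mesh (R : realType) (n : nat) :=
  Mesh { nelt : nat; elt :> 'I_nelt -> simplex R n }.

Section discrete.
Context {R : realType} {n : nat}.
Variable D : set 'rV[R]_n.+1.
Variable T : mesh R n.
Implicit Types (q S C p : 'rV[R]_n.+1 -> R) (u v : 'rV[R]_n.+1 -> 'rV[R]_n.+1).
Implicit Types (k l : 'I_(nelt T)) (j : 'I_n.+2).

(* Distinct elements meet in a common proper face, possibly empty. *)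
Definition conforming_triangulation : Prop :=
  [/\ forall k, nondegenerate_simplex (T k),
      \bigcup_(k in [set: 'I_(nelt T)]) hull (T k) = closure D
    & forall k l, k <> l -> exists A B : pred 'I_n.+2,
        [/\ exists j, ~~ A j, hull (T k) `&` hull (T l) = face (T k) A
          & face (T k) A = face (T l) B]].

Definition meshsize : R := \big[Num.max/0]_k diam (hull (T k)).

Definition shape_regular (sigma : R) : Prop :=
  forall k, diam (hull (T k)) / indiam (hull (T k)) <= sigma.

Definition uniformly_regular (beta0 : R) : Prop :=
  forall k, beta0 * meshsize <= diam (hull (T k)).

Definition elt_patch k : set 'rV[R]_n.+1 :=
  \bigcup_(l in [set l | hull (T l) `&` hull (T k) !=set0]) hull (T l).

(* All the elements touching the facet: Clement-type operators cannot satisfy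
   the facet estimate with only the one or two elements sharing it. *)
Definition facet_patch k j : set 'rV[R]_n.+1 :=
  \bigcup_(l in [set l | hull (T l) `&` facet (T k) j !=set0]) hull (T l).

Definition is_P1 (V : simplex R n) q : Prop :=
  exists (a : 'rV[R]_n.+1) (b : R), forall x, hull V x -> q x = dot a x + b.

Definition is_P1_bubble (V : simplex R n) q : Prop :=
  exists (a : 'rV[R]_n.+1) (b c : R), forall x, hull V x ->
    q x = dot a x + b + c * \prod_j bary V x ord0 j.

Definition in_P1c q : Prop :=
  {within closure D, continuous q} /\ forall k, is_P1 (T k) q.

Definition in_Xh v : Prop :=
  {within closure D, continuous v} /\
  forall k i, is_P1_bubble (T k) (fun x => v x ord0 i).

Definition in_Mh q : Prop := in_P1c q /\ in_L20 D q.

Definition in_Yh q : Prop := in_P1c q /\ exists G, in_H10 D q G.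

(* One-sided value on the element k of w . n_k at a point of its boundary,
   n_k being the outer normal to the facet j of k. *)
Definition normal_trace v k j (x : 'rV[R]_n.+1) : R :=
  lim ((fun y => dot (v y) (outer_normal (T k) j)) @ within (hull (T k))° (nbhs x)).

(* The jump [v . n]_e is the sum over the two elements sharing e of the normal
   component of v with respect to their own outer normals. *)
Definition jump v k j (x : 'rV[R]_n.+1) : R :=
  \sum_(z : 'I_(nelt T) * 'I_n.+2 |
        `[< facet (T z.1) z.2 = facet (T k) j >]) normal_trace v z.1 z.2 x.

Definition phi1 v k j (x : 'rV[R]_n.+1) : R :=
  if `[< facet (T k) j `<=` boundary D >] then dot (v x) (outer_normal (T k) j)
  else 2^-1 * jump v k j x.

Definition eta_L1 (ui u1 : 'rV[R]_n.+1 -> 'rV[R]_n.+1) k : \bar R :=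
  vLp_norm 2%:E (hull (T k)) (fun x => u1 x - ui x).

Definition eta_D3 u k : \bar R :=
  ((diam (hull (T k)))%:E * Lp_norm 3%:E (hull (T k)) (divergence u) +
   \sum_(j < n.+2)
     ((diam (facet (T k) j)) `^ (1 / 3))%:E *
     facet_norm 3 (T k) j (phi1 u k j))%E.

Definition clement (ck ce : R)
    (r : ('rV[R]_n.+1 -> R) -> 'rV[R]_n.+1 -> R) : Prop :=
  forall q G, in_W1p (3 / 2)%:E D q G ->
  [/\ in_P1c (r q),
      forall k, (Lp_norm (3 / 2)%:E (hull (T k)) (fun x => (q x - r q x)%R) <=
        (ck * diam (hull (T k)))%:E * vLp_norm (3 / 2)%:E (elt_patch k) G)%E
    & forall k j t, is_trace (3 / 2) (T k) j q G t ->
        (facet_norm (3 / 2) (T k) j (fun x => (t x - r q x)%R) <=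
         (ce * (diam (facet (T k) j)) `^ (1 / 3))%:E *
         vLp_norm (3 / 2)%:E (facet_patch k j) G)%E].

(* t k j is the trace of q on the facet j of the element k. *)
Definition correction_velocity (c2 : R)
    (r : ('rV[R]_n.+1 -> R) -> 'rV[R]_n.+1 -> R)
    (u1 vr : 'rV[R]_n.+1 -> 'rV[R]_n.+1) : Prop :=
  [/\ in_vLp 3%:E D vr,
      forall q G, in_M D q G ->
      forall t : 'I_(nelt T) -> 'I_n.+2 -> 'rV[R]_n.+1 -> R,
        (forall k j, is_trace (3 / 2) (T k) j q G (t k j)) ->
        integ D (fun x => dot (G x) (vr x)) =
        \sum_k (integ (hull (T k)) (fun x => (q x - r q x) * divergence u1 x) -
          \sum_j facet_int (T k) j
            (fun x => phi1 u1 k j x * (t k j x - r q x)))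
    & (vLp_norm 3%:E D vr <= c2%:E * \sum_k eta_D3 u1 k)%E].

End discrete.
Arguments elt_patch {R n} T k.
Arguments eta_L1 {R n} T ui u1 k.
Arguments eta_D3 {R n} D T u k.

Section problems.
Context {R : realType} {n : nat}.
Variable D : set 'rV[R]_n.+1.
Variables (mu rho beta alpha r0 gamma : R).
Variable K : 'rV[R]_n.+1 -> 'M[R]_n.+1.
Variables (f0 : 'rV[R]_n.+1 -> 'rV[R]_n.+1) (f1 : R -> 'rV[R]_n.+1).
Variable g : 'rV[R]_n.+1 -> R.
Implicit Types (p C : 'rV[R]_n.+1 -> R) (u : 'rV[R]_n.+1 -> 'rV[R]_n.+1).

Definition permeability (Km KM : R) : Prop :=
  [/\ forall i j, measurable_fun D (fun x => K x i j),
      (Lp_norm +oo%E D (fun x => opnorm (K x)) < +oo)%E,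
      exists2 k0, 0 < k0 & {ae lebesgue_rV n.+1, forall x, D x ->
        forall xi, k0 * dot xi xi <= dot (mxapp (K x) xi) xi},
      0 < Km /\ (Km%:E <= Lp_norm +oo%E D (fun x => opnorm (invmx (K x)))
                  <= KM%:E)%E
    & {ae lebesgue_rV n.+1, forall x, D x ->
        forall a, eigenvalue (invmx (K x)) a -> Km <= a}].

Definition force C (x : 'rV[R]_n.+1) : 'rV[R]_n.+1 := f0 x + f1 (C x).

Definition Va u p C : Prop :=
  exists Gp GC : 'rV[R]_n.+1 -> 'rV[R]_n.+1,
  [/\ [/\ in_vLp 3%:E D u, in_M D p Gp & in_H10 D C GC],
      forall v, in_vLp 3%:E D v ->
        mu / rho * integ D (fun x => dot (mxapp (invmx (K x)) (u x)) (v x))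
        + beta / rho * integ D (fun x => enorm (u x) * dot (u x) (v x))
        + integ D (fun x => dot (Gp x) (v x))
        = integ D (fun x => dot (force C x) (v x)),
      forall q G, in_M D q G -> integ D (fun x => dot (G x) (u x)) = 0
    & forall S GS, in_H10 D S GS ->
        alpha * integ D (fun x => dot (GC x) (GS x))
        + integ D (fun x => dot (u x) (GC x) * S x)
        + r0 * integ D (fun x => C x * S x)
        = integ D (fun x => g x * S x)].

Definition Vahi (T : mesh R n) ui Ci u1 p1 C1 : Prop :=
  [/\ [/\ in_Xh D T u1, in_Mh D T p1 & in_Yh D T C1],
      forall v, in_Xh D T v ->
        gamma * integ D (fun x => dot (u1 x - ui x) (v x))
        + mu / rho * integ D (fun x => dot (mxapp (invmx (K x)) (u1 x)) (v x))
        + beta / rho * integ D (fun x => enorm (ui x) * dot (u1 x) (v x))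
        + integ D (fun x => dot (grad p1 x) (v x))
        = integ D (fun x => dot (force Ci x) (v x)),
      forall q, in_Mh D T q -> integ D (fun x => dot (grad q x) (u1 x)) = 0
    & forall S, in_Yh D T S ->
        alpha * integ D (fun x => dot (grad C1 x) (grad S x))
        + integ D (fun x => dot (u1 x) (grad C1 x) * S x)
        + 2^-1 * integ D (fun x => divergence u1 x * C1 x * S x)
        + r0 * integ D (fun x => C1 x * S x)
        = integ D (fun x => g x * S x)].

End problems.

(* Main.v *)
Require Import Defs.
From HB Require Import structures.
From mathcomp Require Import all_boot all_order all_algebra fingroup perm.
From mathcomp Require Import all_classical all_reals all_analysis.
From mathcomp Require Import measurable_realfun ring lra.
Set Implicit Arguments.
Unset Strict Implicit.
Unset Printing Implicit Defensive.
Import Order.TTheory GRing.Theory Num.Theory.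
Import numFieldNormedType.Exports.
Local Open Scope classical_set_scope.
Local Open Scope ring_scope.

(** The bound on the first indicator is Minkowski's inequality.  For the second,
    [u1] is continuous, so its normal jumps vanish and only the boundary facets
    contribute; by elementwise Green formulas and the discrete incompressibility,
    the functional defining [vr] vanishes on continuous P1 functions, which removes
    the Clement interpolant.  Hence a polynomial [Q] on one element [kappa], zero on
    its interior facets and extended by zero, satisfies
      int_kappa grad Q . vr = int_kappa Q div u1 - sum_e int_e (u1 . n) Q
    over the facets [e] of [kappa] on the boundary.  Taking for [Q] first the bubble
    times [div u1], then the bubble of a facet times an extension of [u1 . n], bounds
    both terms: on the reference simplex these weighted squares are positive definite
    quadratic forms on finite-dimensional spaces, and shape regularity makes the
    gradients of the barycentric coordinates comparable to 1 / h_kappa. *)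

(** * Lebesgue measure on row vectors *)

(** A pressure test function must have zero mean, so [Q] extended by zero is admissible only after
    its mean is subtracted; that constant is itself P1 and is removed together with the interpolant.
    The extension has the elementwise gradient of [Q] as weak gradient because its facet terms
    vanish: on interior facets through [Q], on boundary facets through the smooth functions
    supported in the domain. Hölder's inequality puts vol^(2/3) on the right, and the weighted
    squares put vol on the left; the remaining vol^(1/3) is exactly the scaling of an L^3 norm on
    the element. The divergence comes first because a facet bubble does not vanish inside the
    element: its volume term is controlled by the divergence bound already obtained. Every constant
    is attached to polynomials in barycentric coordinates on the reference simplex, never to a given
    element, and is fixed before the mesh; only the dimension and [sigma] enter. *)

Section null_sets.
Context d (T : measurableType d) (R : realType).
Variable mu : {measure set T -> \bar R}.
Local Open Scope ereal_scope.
Import HBNNSimple.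

(* No measurability: the integral of a nonnegative function is a supremum over
   the simple functions below it. *)
Lemma le_integralT (f g : T -> \bar R) :
  (forall x, 0 <= f x) -> (forall x, f x <= g x) ->
  \int[mu]_x f x <= \int[mu]_x g x.
Proof.
move=> f0 fg.
have g0 x : 0 <= g x by apply: le_trans (fg x).
rewrite !ge0_integralTE//.
apply: ereal_sup_le => _ [h hf <-]; exists h => // x.
exact: le_trans (hf x) (fg x).
Qed.

(** Measurability of [f] and [g] is avoided by working with simple functions: one lying below [f]
    keeps its integral when cut off on [N], and what remains lies below [g]. *)
Lemma ge0_eq_integral_null (N : set T) (f g : T -> \bar R) :
  measurable N -> mu N = 0 -> (forall x, 0 <= f x) -> (forall x, 0 <= g x) ->
  (forall x, ~ N x -> f x = g x) -> \int[mu]_x f x = \int[mu]_x g x.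
Proof.
move=> mN N0.
suff H f' g' : (forall x, 0 <= f' x) -> (forall x, 0 <= g' x) ->
    (forall x, ~ N x -> f' x = g' x) -> \int[mu]_x f' x <= \int[mu]_x g' x.
  move=> f0 g0 fg; apply/eqP; rewrite eq_le !H// => x Nx.
  by rewrite fg.
move=> {}f0 {}g0 fg; rewrite [leLHS]ge0_integralTE//.
apply: ge_ereal_sup => _ [h /= hf <-].
have -> : sintegral mu h = \int[mu]_x (h x)%:E.
  rewrite (integral_nnsfun mu measurableT h).
  by congr sintegral; apply/funext => x; rewrite patch_setT.
rewrite (ge0_negligible_integral mN)//; last 2 first.
  exact/measurable_EFinP/measurable_funTS.
  by move=> x _; rewrite lee_fin.
rewrite integral_mkcond; apply: le_integralT => x; rewrite /patch.
  by case: ifPn; rewrite ?lee_fin.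
case: ifPn => // /[!inE] -[_ Nx].
by rewrite -fg//; exact: hf.
Qed.

(** The two domains are compared through extension by zero, so that a closed element can be traded
    for its interior, or the domain for the union of its elements. *)
Lemma eq_integral_null (N D D' : set T) (f g : T -> \bar R) :
  measurable N -> mu N = 0 -> (forall x, ~ N x -> (f \_ D) x = (g \_ D') x) ->
  \int[mu]_(x in D) f x = \int[mu]_(x in D') g x.
Proof.
move=> mN N0 fg; rewrite (integral_mkcond D) (integral_mkcond D') [LHS]integralE [RHS]integralE.
congr (_ - _); apply: (ge0_eq_integral_null mN N0) => // x /fg.
  by rewrite !funeposE => ->.
by rewrite !funenegE => ->.
Qed.

Lemma eq_Rintegral_null (N D D' : set T) (f g : T -> R) :
  measurable N -> mu N = 0 ->
  (forall x, ~ N x -> (f \_ D) x = (g \_ D') x) ->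
  (\int[mu]_(x in D) f x)%R = (\int[mu]_(x in D') g x)%R.
Proof.
move=> mN N0 fg; congr fine; apply: (eq_integral_null mN N0) => x Nx.
have : (EFin \o f \_ D) x = (EFin \o g \_ D') x by rewrite /= fg.
by rewrite !restrict_EFin.
Qed.

Lemma bounded_integrable (D : set T) (f : T -> R) (M : R) :
  measurable D -> mu D < +oo -> measurable_fun D f ->
  (forall x, D x -> `|f x| <= M)%R -> mu.-integrable D (EFin \o f).
Proof.
move=> mD Doo mf fM; apply: measurable_bounded_integrable => //.
exists M; split; first exact: num_real.
by move=> y My x Dx /=; rewrite (le_trans (fM x Dx))// ltW.
Qed.

End null_sets.

Section rV_topology.
Context {R : realType} {n : nat}.
Local Notation E := 'rV[R]_n.

Lemma continuous_coord (i : 'I_n) : continuous (fun v : E => v ord0 i).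
Proof. by move=> v; exact: coord_continuous. Qed.

Lemma continuous_rV (T : topologicalType) (f : T -> E) :
  (forall i, continuous (fun x => f x ord0 i)) -> continuous f.
Proof.
move=> cf x.
apply/cvg_ballP => e e0.
have : \forall y \near x, forall i, `|f x ord0 i - f y ord0 i| < e.
  apply: filter_forall => i.
  have /cvgrPdist_lt/(_ _ e0) := cf i x.
  exact.
apply: filterS => y H.
rewrite -ball_normE /ball_/= .
rewrite /Num.norm/= mx_normrE.
apply: bigmax_lt => // -[i j] _; rewrite !mxE ord1; exact: H.
Qed.

Lemma ball_rV (a : E) (r : R) : 0 < r ->
  ball a r = \bigcap_(i in [set: 'I_n]) [set x | `|a ord0 i - x ord0 i| < r].
Proof.
move=> r0; apply/seteqP; split => x.
  rewrite -ball_normE /ball_/= => axr i _ /=; apply: le_lt_trans axr.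
  rewrite [leRHS]/Num.norm/= mx_normrE.
  have := le_bigmax 0 (fun ij : 'I_1 * 'I_n => `|(a - x) ij.1 ij.2|) (ord0, i).
  by rewrite !mxE.
move=> H; rewrite -ball_normE /ball_/= /Num.norm/= mx_normrE.
apply: bigmax_lt => // -[i j] _; rewrite !mxE ord1; exact: H.
Qed.

Lemma measurable_ball_rV (a : E) (r : R) : 0 < r -> measurable (ball a r).
Proof.
move=> r0; rewrite ball_rV//.
apply: fin_bigcap_measurable; first exact: finite_finset.
move=> i _.
rewrite -[X in measurable X]setTI.
have mf : measurable_fun [set: E] (fun x : E => `|a ord0 i - x ord0 i|).
  apply: measurableT_comp => //; apply: measurable_funB => //.
  exact: measurable_coord.
exact: (mf measurableT `]-oo, r[%classic).
Qed.

(** Balls of the sup norm are finite intersections of coordinate strips, and [U] is the countable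
    union of the balls it contains that have a rational center and radius 1 / (k + 1). *)
Lemma open_measurable_rV (U : set E) : open U -> measurable U.
Proof.
move=> oU.
pose B (qk : 'rV[rat]_n * nat) : set E :=
  ball (\row_i ratr (qk.1 ord0 i) : E) (qk.2.+1%:R^-1).
have -> : U = \bigcup_(qk in [set qk | B qk `<=` U]) B qk.
  apply/seteqP; split => [x Ux|x [qk /= + Bx]]; last exact.
  have /nbhs_ballP[e /= e0 xeU] : nbhs x U by exact: open_nbhs_nbhs.
  have [k ke] : exists k, (k.+1%:R^-1 : R) < e / 2.
    have := near_infty_natSinv_lt (PosNum (divr_gt0 e0 (ltr0n R 2))).
    by case=> k _ /(_ k (leqnn k)) /= kP; exists k.
  have k0 : 0 < k.+1%:R^-1 :> R by rewrite invr_gt0.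
  have /choice[q qP] : forall i : 'I_n, exists q : rat,
      `|x ord0 i - ratr q| < k.+1%:R^-1.
    move=> i; have [q] : exists q : rat, ratr q \in `]x ord0 i - k.+1%:R^-1, x ord0 i + k.+1%:R^-1[.
      by apply: rat_in_itvoo; rewrite ltrBlDr -addrA ltrDl addr_gt0.
    by rewrite in_itv/= -ltr_distlC => qx; exists q; rewrite distrC distrC.
  have xq : ball x (k.+1%:R^-1) (\row_i ratr ((\row_i q i) ord0 i) : E).
    by rewrite ball_rV// => i _ /=; rewrite !mxE.
  exists (\row_i q i, k); last exact: ball_sym.
  move=> y /= qy; apply: xeU.
  rewrite (splitr e); apply: (@ball_triangle _ _ (\row_i ratr ((\row_i q i) ord0 i) : E)).
    by apply: le_ball xq; exact: ltW.
  by apply: le_ball qy; exact: ltW.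
rewrite bigcup_mkcond; apply: countable_bigcupT_measurable => // -[q k].
case: ifPn => // _; exact: measurable_ball_rV.
Qed.

Lemma closed_measurable_rV (U : set E) : closed U -> measurable U.
Proof.
by move=> cU; rewrite -(setCK U); apply: measurableC; apply: open_measurable_rV;
  exact: closed_openC.
Qed.

Lemma continuous_measurable_rV (f : E -> R) :
  continuous f -> measurable_fun [set: E] f.
Proof.
move=> cf; apply: (measurability _ (RGenOInfty.measurableE R)).
move=> /= _ [_ [x ->] <-]; rewrite setTI.
apply: open_measurable_rV; apply: open_comp; last exact: interval_open.
by move=> y _; exact: cf.
Qed.

End rV_topology.

(** * Integration by slices along the first coordinate *)

Section fubini_rV.
Context {R : realType} {n : nat}.
Local Open Scope ereal_scope.
Local Notation lam := (@lebesgue_rV R).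

Lemma ge0_integral_cons (f : 'rV[R]_n.+1 -> \bar R) :
  measurable_fun [set: 'rV[R]_n.+1] f -> (forall x, 0 <= f x) ->
  \int[lam n.+1]_x f x =
  \int[lam n]_y \int[@lebesgue_measure R]_x f (cons_rV (x, y)).
Proof.
move=> mf f0.
rewrite (@ge0_integral_pushforward _ _ _ _ _ (@cons_rV R n)
  (@measurable_cons_rV R n) (lebesgue_measure \x lam n))//.
rewrite preimage_setT.
have mfc : measurable_fun [set: measurableTypeR R * 'rV[R]_n] (f \o @cons_rV R n).
  by apply: measurableT_comp => //; exact: measurable_cons_rV.
by rewrite (fubini_tonelli2 (f \o @cons_rV R n))// => x; exact: f0.
Qed.

Lemma ge0_integral_cons' (f : 'rV[R]_n.+1 -> \bar R) :
  measurable_fun [set: 'rV[R]_n.+1] f -> (forall x, 0 <= f x) ->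
  \int[lam n.+1]_x f x =
  \int[@lebesgue_measure R]_x \int[lam n]_y f (cons_rV (x, y)).
Proof.
move=> mf f0; rewrite ge0_integral_cons//.
have mfc : measurable_fun [set: measurableTypeR R * 'rV[R]_n] (f \o @cons_rV R n).
  by apply: measurableT_comp => //; exact: measurable_cons_rV.
exact: (esym (fubini_tonelli (f \o @cons_rV R n) mfc (fun x => f0 _))).
Qed.

Lemma integral_cons (f : 'rV[R]_n.+1 -> \bar R) :
  (lam n.+1).-integrable [set: 'rV[R]_n.+1] f ->
  \int[lam n.+1]_x f x =
  \int[lam n]_y \int[@lebesgue_measure R]_x f (cons_rV (x, y)).
Proof.
move=> fi; have /integrableP[mf foo] := fi.
have fci : (lebesgue_measure \x lam n).-integrable setT (f \o @cons_rV R n).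
  apply/integrableP; split.
    by apply: measurableT_comp => //; exact: measurable_cons_rV.
  apply: le_lt_trans foo.
  rewrite (@ge0_integral_pushforward _ _ _ _ _ (@cons_rV R n)
    (@measurable_cons_rV R n) (lebesgue_measure \x lam n))//.
  exact: measurableT_comp.
rewrite (@integral_pushforward _ _ _ _ _ (@cons_rV R n)
  (@measurable_cons_rV R n) (lebesgue_measure \x lam n))//.
by rewrite preimage_setT -integral21_prod_meas1.
Qed.

End fubini_rV.

Section slices.
Context {R : realType} {n : nat}.
Local Open Scope ereal_scope.
Variable f : 'rV[R]_n.+1 -> \bar R.
Hypothesis mf : measurable_fun setT f.

Lemma measurable_slice1 (y : 'rV[R]_n) :
  measurable_fun [set: measurableTypeR R] (fun x => f (cons_rV (x, y))).
Proof.
apply: measurableT_comp => //; apply: measurableT_comp; first exact: measurable_cons_rV.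
exact: pair2_measurable.
Qed.

Lemma measurable_slice2 (x : measurableTypeR R) :
  measurable_fun [set: 'rV[R]_n] (fun y => f (cons_rV (x, y))).
Proof.
apply: measurableT_comp => //; apply: measurableT_comp; first exact: measurable_cons_rV.
exact: pair1_measurable.
Qed.

Hypothesis f0 : forall x, 0 <= f x.

Lemma measurable_int1 :
  measurable_fun [set: 'rV[R]_n] (fun y => \int[@lebesgue_measure R]_x f (cons_rV (x, y))).
Proof.
have mfc : measurable_fun [set: measurableTypeR R * 'rV[R]_n] (f \o @cons_rV R n).
  by apply: measurableT_comp => //; exact: measurable_cons_rV.
exact: (@measurable_fun_fubini_tonelli_G _ _ _ _ _ lebesgue_measure (f \o @cons_rV R n) mfc (fun x => f0 _)).
Qed.

End slices.

Section line.
Context {R : realType}.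
Local Notation mu := (@lebesgue_measure R).
Local Open Scope ereal_scope.

Let mshift (a : R) :
  measurable_fun [set: measurableTypeR R] (fun x : R => (x + a)%R : measurableTypeR R).
Proof. by apply: measurable_funD. Qed.

Let mscal (a : R) :
  measurable_fun [set: measurableTypeR R] (fun x : R => (a * x)%R : measurableTypeR R).
Proof. by apply: measurable_funM. Qed.

Lemma lebesgue_measure_shift (a : R) (A : set (measurableTypeR R)) : measurable A ->
  pushforward mu (fun x : R => (x + a)%R : measurableTypeR R) A = mu A.
Proof.
move=> mA; apply/esym.
apply: (@lebesgue_measure_unique R
  (measure_function_pushforward__canonical__measure_function_Measure mu (mshift a))) => //=.
move=> _ [[b c]] _ <-.
rewrite /pushforward/= (_ : _ @^-1` _ = `]b - a, c - a]%classic)%R.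
  rewrite !lebesgue_measure_itv/= !lte_fin ltrD2r; case: ifPn => // _.
  by rewrite -!EFinD; congr EFin; ring.
by apply/seteqP; split => x /=; rewrite !in_itv/= ltrBlDr lerBrDr.
Qed.

(** The image measure multiplied by |a| gives half-open intervals their length, and this
    characterizes Lebesgue measure. *)
Lemma lebesgue_measure_scale (a : R) (A : set (measurableTypeR R)) : (a != 0)%R ->
  measurable A ->
  pushforward mu (fun x : R => (a * x)%R : measurableTypeR R) A = (`|a|^-1)%:E * mu A.
Proof.
move=> a0 mA.
have na0 : (0 < `|a|)%R by rewrite normr_gt0.
pose m := measure_function_pushforward__canonical__measure_function_Measure mu (mscal a).
have -> : mu A = mscale (NngNum (normr_ge0 a)) m A.
  apply: lebesgue_measure_unique => //= _ [[b c]] _ <-.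
  rewrite /mscale/= /pushforward/=.
  have [{}a0|a0'] := ltP 0%R a.
    rewrite (_ : _ @^-1` _ = `]b / a, c / a]%classic)%R.
      rewrite !lebesgue_measure_itv/= !lte_fin ltr_pM2r ?invr_gt0//.
      case: ifPn => // _; last by rewrite mule0.
      rewrite gtr0_norm// -!EFinD -EFinM; congr EFin; field; exact: lt0r_neq0.
    by apply/seteqP; split => x /=; rewrite !in_itv/= ltr_pdivrMr// ler_pdivlMr// (mulrC x).
  have {a0'}a0 : (a < 0)%R by rewrite lt_neqAle a0.
  (* For negative [a] the preimage is half-open on the other side, which does not change its
     length. *)
  rewrite (_ : _ @^-1` _ = `[c / a, b / a[%classic)%R.
    rewrite !lebesgue_measure_itv/= !lte_fin ltr_nM2r ?invr_lt0//.
    case: ifPn => // _; last by rewrite mule0.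
    rewrite ltr0_norm// -!EFinD -EFinM; congr EFin; field; exact: ltr0_neq0.
  by apply/seteqP; split => x /=; rewrite !in_itv/= ltr_ndivlMr// ler_ndivrMr// (mulrC x) andbC.
rewrite /mscale/= muleA -EFinM mulVf ?mul1e//; exact: lt0r_neq0.
Qed.

Lemma ge0_integral_shift (a : R) (f : measurableTypeR R -> \bar R) :
  measurable_fun setT f -> (forall x, 0 <= f x) ->
  \int[mu]_x f (x + a)%R = \int[mu]_x f x.
Proof.
move=> mf f0.
have := @ge0_integral_pushforward _ _ _ _ R _ (mshift a) mu setT f measurableT mf (fun x _ => f0 x).
rewrite preimage_setT => /= <-.
by apply: eq_measure_integral => A mA _; exact: lebesgue_measure_shift.
Qed.

Lemma ge0_integral_scale (a : R) (f : measurableTypeR R -> \bar R) : (a != 0)%R ->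
  measurable_fun setT f -> (forall x, 0 <= f x) ->
  \int[mu]_x f (a * x)%R = (`|a|^-1)%:E * \int[mu]_x f x.
Proof.
move=> a0 mf f0.
have := @ge0_integral_pushforward _ _ _ _ R _ (mscal a) mu setT f measurableT mf (fun x _ => f0 x).
rewrite preimage_setT => /= <-.
have n0 : (0 <= `|a|^-1)%R by rewrite invr_ge0.
rewrite -(ge0_integral_mscale mu measurableT (NngNum n0))//.
by apply: eq_measure_integral => A mA _; exact: lebesgue_measure_scale.
Qed.

End line.

(** * Linear and affine changes of variables *)

Section affine_change.
Context {R : realType}.
Local Notation lam := (@lebesgue_rV R).
Local Open Scope ereal_scope.

Lemma measurable_mulmx m n (A : 'M[R]_(m, n)) :
  measurable_fun [set: 'rV[R]_m] (fun x : 'rV[R]_m => x *m A).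
Proof.
apply: measurable_fun_rV => i.
under eq_fun do rewrite mxE.
apply: measurable_sum => j; apply: measurable_funM => //.
exact: measurable_coord.
Qed.

Lemma measurable_rVD d (T : measurableType d) n (f g : T -> 'rV[R]_n) :
  measurable_fun setT f -> measurable_fun setT g ->
  measurable_fun setT (fun x => (f x + g x)%R).
Proof.
move=> mf mg; apply: measurable_fun_rV => i.
under eq_fun do rewrite mxE.
by apply: measurable_funD; apply: (measurableT_comp (measurable_coord i)).
Qed.

Lemma cons_rVE n (x : R) (y : 'rV[R]_n) :
  cons_rV (x, y) = row_mx (x%:M : 'rV_1) y :> 'rV[R]_(1 + n).
Proof.
apply/rowP => i; have [j ->|->] := unliftP ord0 i.
  rewrite cons_rV_lift (_ : lift ord0 j = rshift 1 j) ?row_mxEr//.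
  exact/val_inj.
rewrite cons_rV0/=; transitivity ((row_mx (x%:M : 'rV_1) y) ord0 (lshift n ord0)).
  by rewrite row_mxEl mxE eqxx.
by congr (_ _ _); exact/val_inj.
Qed.

Lemma ge0_integral_trans n (a : 'rV[R]_n) (f : 'rV[R]_n -> \bar R) :
  measurable_fun setT f -> (forall x, 0 <= f x) ->
  \int[lam n]_x f (x + a)%R = \int[lam n]_x f x.
Proof.
elim: n a f => [a f mf f0|n IH a f mf f0].
  by apply: eq_integral => x _; congr f; apply/rowP => -[].
have ma : measurable_fun setT (fun x : 'rV[R]_n.+1 => f (x + a)%R).
  apply: measurableT_comp => //; apply: measurable_rVD => //.
rewrite (ge0_integral_cons ma (fun=> f0 _)) (ge0_integral_cons mf f0).
have E x y : (cons_rV (x, y) + a)%R =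
    cons_rV ((x + a ord0 ord0)%R, (y + \row_j a ord0 (lift ord0 j))%R).
  apply/rowP => i; rewrite mxE; have [j ->|->] := unliftP ord0 i.
    by rewrite !cons_rV_lift/= !mxE.
  by rewrite !cons_rV0.
rewrite -(IH (\row_j a ord0 (lift ord0 j)) _ (measurable_int1 mf f0)); last first.
  by move=> y; exact: integral_ge0.
apply: eq_integral => y _; under eq_integral do rewrite E.
exact: (ge0_integral_shift _ (measurable_slice1 mf _) (fun=> f0 _)).
Qed.

(** Named because it is stable under products: the change of variables then reduces to shears and
    block diagonal factors. *)
Definition scales_measure n (A : 'M[R]_n) := forall f : 'rV[R]_n -> \bar R,
  measurable_fun setT f -> (forall x, 0 <= f x) ->
  \int[lam n]_x f (x *m A) = (`|\det A|^-1)%:E * \int[lam n]_x f x.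

Lemma scales_measureM n (A B : 'M[R]_n) :
  scales_measure A -> scales_measure B -> scales_measure (A *m B).
Proof.
move=> hA hB f mf f0.
under eq_integral do rewrite mulmxA.
rewrite (hA (fun x => f (x *m B)))//; last first.
  by apply: measurableT_comp => //; exact: measurable_mulmx.
rewrite hB// det_mulmx normrM invfM EFinM -muleA//.
Qed.

Lemma cons_mul_block n (x a : R) (y b : 'rV[R]_n) (c : 'cV[R]_n) (S : 'M[R]_n) :
  (cons_rV (x, y) : 'rV[R]_(1 + n)) *m (block_mx a%:M b c S : 'M[R]_(1 + n)) =
  cons_rV ((a * x + (y *m c) ord0 ord0)%R, (x *: b + y *m S)%R) :> 'rV[R]_(1 + n).
Proof.
rewrite cons_rVE (@mul_row_block _ 1 1 n 1 n) cons_rVE -scalar_mxM mul_scalar_mx mulrC.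
by congr row_mx; apply/rowP => i; rewrite !ord1 !mxE eqxx.
Qed.

(** For a fixed tail [y] this shear translates the first coordinate by [y *m c]. The upper shear
    translates the tail at a fixed first coordinate, hence the two orders of integration. *)
Lemma scales_measure_lower n (c : 'cV[R]_n) :
  scales_measure (block_mx 1%:M 0 c 1%:M : 'M[R]_(1 + n)).
Proof.
move=> f mf f0.
rewrite det_lblock !det1 mulr1 normr1 invr1 mul1e.
have mf' : measurable_fun setT (fun x : 'rV[R]_n.+1 =>
    f (x *m (block_mx 1%:M 0 c 1%:M : 'M[R]_(1 + n)))).
  by apply: measurableT_comp => //; exact: measurable_mulmx.
rewrite (ge0_integral_cons mf' (fun=> f0 _)) (ge0_integral_cons (mf : measurable_fun (T := 'rV[R]_n.+1) _ _) f0).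
apply: eq_integral => y _.
rewrite -[RHS](ge0_integral_shift ((y *m c) ord0 ord0) (measurable_slice1 mf y) (fun=> f0 _)).
apply: eq_integral => x _; congr (f _).
by rewrite [LHS]cons_mul_block mul1r scaler0 add0r mulmx1.
Qed.

Lemma scales_measure_upper n (b : 'rV[R]_n) :
  scales_measure (block_mx 1%:M b 0 1%:M : 'M[R]_(1 + n)).
Proof.
move=> f mf f0.
rewrite det_ublock !det1 mulr1 normr1 invr1 mul1e.
have mf' : measurable_fun setT (fun x : 'rV[R]_n.+1 =>
    f (x *m (block_mx 1%:M b 0 1%:M : 'M[R]_(1 + n)))).
  by apply: measurableT_comp => //; exact: measurable_mulmx.
rewrite (ge0_integral_cons' mf' (fun=> f0 _)) (ge0_integral_cons' (mf : measurable_fun (T := 'rV[R]_n.+1) _ _) f0).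
apply: eq_integral => x _.
rewrite -[RHS](ge0_integral_trans (x *: b) (measurable_slice2 mf x) (fun=> f0 _)).
apply: eq_integral => y _; congr (f _).
by rewrite [LHS]cons_mul_block mul1r mulmx0 mxE addr0 mulmx1 addrC.
Qed.

Lemma scales_measure_diag n (a : R) (S : 'M[R]_n) : a != 0%R -> scales_measure S ->
  scales_measure (block_mx a%:M 0 0 S : 'M[R]_(1 + n)).
Proof.
move=> a0 hS f mf f0.
have mf' : measurable_fun setT (fun x : 'rV[R]_n.+1 =>
    f (x *m (block_mx a%:M 0 0 S : 'M[R]_(1 + n)))).
  by apply: measurableT_comp => //; exact: measurable_mulmx.
rewrite det_ublock det_scalar1 normrM invfM EFinM.
rewrite (ge0_integral_cons mf' (fun=> f0 _)) (ge0_integral_cons (mf : measurable_fun (T := 'rV[R]_n.+1) _ _) f0).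
transitivity (\int[lam n]_y ((`|a|^-1)%:E *
    \int[@lebesgue_measure R]_x f (cons_rV (x, y *m S)))).
  apply: eq_integral => y _.
  rewrite -(ge0_integral_scale a0 (measurable_slice1 mf _) (fun=> f0 _)).
  apply: eq_integral => x _; congr (f _).
  by rewrite [LHS]cons_mul_block mulmx0 mxE addr0 scaler0 add0r.
rewrite /= (ge0_integralZl (lam n) measurableT
  (measurableT_comp (measurable_int1 mf f0) (measurable_mulmx S))); last 2 first.
- by move=> y _; exact: integral_ge0.
- by rewrite lee_fin invr_ge0.
rewrite (hS _ (measurable_int1 mf f0)) ?muleA// => y; exact: integral_ge0.
Qed.

(** Gaussian elimination by blocks: with a nonzero pivot, [A] is a lower shear times a block
    diagonal matrix times an upper shear, and the induction hypothesis handles the lower right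
    block. *)
Lemma ge0_integral_mulmx n (A : 'M[R]_n) : A \in unitmx -> scales_measure A.
Proof.
elim: n A => [A _ f mf f0|n IH].
  rewrite det_mx00 normr1 invr1 mul1e; apply: eq_integral => x _.
  by congr f; apply/rowP => -[].
suff H (A : 'M[R]_(1 + n)) : (ulsubmx A) ord0 ord0 != 0%R -> A \in unitmx ->
    scales_measure A.
  suff K (A : 'M[R]_(1 + n)) : A \in unitmx -> scales_measure A by exact: K.
  move=> uA.
  have [A0|/H] := eqVneq (ulsubmx A ord0 ord0) 0%R; last exact.
  have [i Ai0] : exists i, dlsubmx A i ord0 != 0%R.
    apply/existsP; apply: contraT; rewrite negb_exists => /forallP Ai.
    move: uA; rewrite unitmxE unitfE -det_tr (expand_det_row _ ord0) big1 ?eqxx// => j _.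
    rewrite mxE; have [k ->|->] := unliftP ord0 j.
      have := Ai k; rewrite negbK !mxE => /eqP.
      rewrite (_ : rshift 1 k = lift ord0 k); last exact/val_inj.
      by rewrite (_ : lshift n ord0 = ord0) ?[X in (X * _)%R]mxE; [move=> ->; rewrite mul0r|exact/val_inj].
    by move: A0; rewrite !mxE (_ : lshift n ord0 = ord0); [move=> ->; rewrite mul0r|exact/val_inj].
  (* When the pivot is zero, the transvection [U 1] adds to the first row another one with a nonzero
     first entry; [U (-1)] undoes it. *)
  pose U (s : R) : 'M[R]_(1 + n) := block_mx 1%:M (s *: delta_mx ord0 i) 0 1%:M.
  have UU : U (-1)%R *m U 1%R = 1%:M.
    rewrite /U mulmx_block !mulmx1 !mul1mx !mulmx0 !mul0mx !addr0 !add0r.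
    by rewrite scale1r scaleN1r subrr -scalar_mx_block.
  have -> : A = U (-1)%R *m (U 1%R *m A) by rewrite mulmxA UU mul1mx.
  apply: scales_measureM; first exact: scales_measure_upper.
  apply: H.
    rewrite -{1}(submxK A) /U mulmx_block block_mxKul.
    rewrite mxE mul1mx A0 add0r scale1r mxE (bigD1 i)//= mxE !eqxx mul1r big1 ?addr0//.
    by move=> j ji; rewrite mxE eqxx/= (negbTE ji) mul0r.
  rewrite unitmx_mul uA andbT.
  by have /mulmx1_unit[] := UU.
move=> a0 uA.
set a := ulsubmx A ord0 ord0 in a0.
have ulE : ulsubmx A = a%:M by apply/matrixP => i j; rewrite !ord1 [RHS]mxE eqxx.
(* The Schur complement of the pivot. *)
pose S := (drsubmx A - dlsubmx A *m (a^-1 *: ursubmx A))%R.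
have AE : A = block_mx 1%:M 0 (a^-1 *: dlsubmx A) 1%:M *m
    (block_mx a%:M 0 0 S *m block_mx 1%:M (a^-1 *: ursubmx A) 0 1%:M).
  rewrite -{1}(submxK A) !mulmx_block !mulmx1 !mul1mx !mulmx0 !mul0mx !addr0 !add0r.
  rewrite ulE mul_scalar_mx scalerA mulfV// scale1r mul_mx_scalar scalerA mulfV// scale1r.
  by rewrite /S -scalemxAl -scalemxAr addrC subrK.
have uS : S \in unitmx.
  move: uA; rewrite {1}AE !unitmx_mul => /andP[_ /andP[+ _]].
  by rewrite !unitmxE det_ublock det_scalar1 unitrM => /andP[].
rewrite AE; apply: scales_measureM; first exact: scales_measure_lower.
apply: scales_measureM; last exact: scales_measure_upper.
by apply: scales_measure_diag => //; exact: IH.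
Qed.

Lemma ge0_integral_affine n (A : 'M[R]_n) (a : 'rV[R]_n) (f : 'rV[R]_n -> \bar R) :
  A \in unitmx -> measurable_fun setT f -> (forall x, 0 <= f x) ->
  \int[lam n]_x f (x *m A + a)%R = (`|\det A|^-1)%:E * \int[lam n]_x f x.
Proof.
move=> uA mf f0.
rewrite (ge0_integral_mulmx uA (f := fun x => f (x + a)%R))//.
  by rewrite ge0_integral_trans.
by apply: measurableT_comp => //; exact: measurable_rVD.
Qed.

Lemma integral_affine n (A : 'M[R]_n) (a : 'rV[R]_n) (f : 'rV[R]_n -> R) :
  A \in unitmx -> (lam n).-integrable setT (EFin \o f) ->
  (\int[lam n]_x f (x *m A + a) = `|\det A|^-1 * \int[lam n]_x f x)%R.
Proof.
move=> uA fi; have mf := measurable_int _ fi.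
have h1 := integrable_pos_fin_num measurableT fi.
have h2 := integrable_neg_fin_num measurableT fi.
rewrite /Rintegral integralE [in RHS]integralE.
rewrite [X in X - _](_ : _ = \int[lam n]_x (EFin \o f)^\+ (x *m A + a)%R); last first.
  by apply: eq_integral => x _; rewrite !funeposE.
rewrite [X in _ - X](_ : _ = \int[lam n]_x (EFin \o f)^\- (x *m A + a)%R); last first.
  by apply: eq_integral => x _; rewrite !funenegE.
rewrite (ge0_integral_affine a uA (measurable_funepos mf) (fun=> funepos_ge0 _ _)).
rewrite (ge0_integral_affine a uA (measurable_funeneg mf) (fun=> funeneg_ge0 _ _)).
rewrite -muleBr//; last by rewrite fin_num_adde_defl// fin_numN.
by rewrite fineM//= fin_numB h1 h2.
Qed.

End affine_change.


(** * Null hyperplanes, volumes of balls and of open sets *)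

Section null_and_positive.
Context {R : realType}.
Local Notation lam := (@lebesgue_rV R).
Local Open Scope ereal_scope.

Lemma lebesgue_cons_indic n (A : set 'rV[R]_n.+1) : measurable A ->
  lam n.+1 A = \int[lam n]_y \int[@lebesgue_measure R]_x (\1_A (cons_rV (x, y)))%:E.
Proof.
move=> mA; rewrite -(ge0_integral_cons (f := fun x => (\1_A x)%:E)).
- by rewrite integral_indic// setIT.
- exact/measurable_EFinP/measurable_indic.
- by move=> x; rewrite lee_fin.
Qed.

Lemma lebesgue_cons_indic' n (A : set 'rV[R]_n.+1) : measurable A ->
  lam n.+1 A = \int[@lebesgue_measure R]_x \int[lam n]_y (\1_A (cons_rV (x, y)))%:E.
Proof.
move=> mA; rewrite -(ge0_integral_cons' (f := fun x => (\1_A x)%:E)).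
- by rewrite integral_indic// setIT.
- exact/measurable_EFinP/measurable_indic.
- by move=> x; rewrite lee_fin.
Qed.

Lemma measurable_dot n (a : 'rV[R]_n) : measurable_fun [set: 'rV[R]_n] (dot a).
Proof.
apply: measurable_sum => i; apply: measurable_funM => //; exact: measurable_coord.
Qed.

Lemma dot_cons n (a : 'rV[R]_n.+1) (x : R) (y : 'rV[R]_n) :
  dot a (cons_rV (x, y)) = (a ord0 ord0 * x + dot (\row_j a ord0 (lift ord0 j)) y)%R.
Proof.
rewrite /dot big_ord_recl cons_rV0; congr (_ + _)%R; apply: eq_bigr => i _.
by rewrite cons_rV_lift mxE.
Qed.

Lemma measurable_hyperplane n (a : 'rV[R]_n) (b : R) :
  measurable [set x : 'rV[R]_n | dot a x = b].
Proof.
by have := @measurable_dot n a measurableT [set b] (measurable_set1 _); rewrite setTI.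
Qed.

(** If the first coefficient is nonzero, the lines along the first coordinate meet the hyperplane in
    one point; otherwise its slices at a fixed first coordinate are hyperplanes in one dimension
    less. *)
Lemma lebesgue_hyperplane n (a : 'rV[R]_n) (b : R) : a != 0%R ->
  lam n [set x : 'rV[R]_n | dot a x = b] = 0.
Proof.
elim: n a b => [a b|n IH a b a0].
  by move=> /eqP; case; apply/rowP => -[].
have [a00|a00] := eqVneq (a ord0 ord0) 0%R; last first.
  rewrite lebesgue_cons_indic; last exact: measurable_hyperplane.
  apply: integral0_eq => y _.
  transitivity (\int[@lebesgue_measure R]_x
    (\1_[set ((b - dot (\row_j a ord0 (lift ord0 j)) y) / a ord0 ord0)%R] x)%:E).
    apply: eq_integral => x _; congr EFin; rewrite !indicE; congr (_%:R); congr nat_of_bool.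
    apply/idP/idP; rewrite !inE/= dot_cons.
      by move=> <-; rewrite addrK mulrC mulKf.
    by move=> ->; rewrite mulrC divfK// subrK.
  rewrite integral_indic//.
  rewrite setIT; exact: lebesgue_measure_set1.
rewrite lebesgue_cons_indic'; last exact: measurable_hyperplane.
apply: integral0_eq => x _.
rewrite -[RHS](IH (\row_j a ord0 (lift ord0 j)) b); last first.
  apply: contra a0 => /eqP/rowP H; apply/eqP/rowP => i.
  by have [j ->|->] := unliftP ord0 i; [have := H j; rewrite !mxE|rewrite a00 mxE].
rewrite -[X in lam n X]setIT -integral_indic//; last exact: measurable_hyperplane.
apply: eq_integral => y _; congr EFin; rewrite !indicE; congr (_%:R); congr nat_of_bool.
by apply/idP/idP; rewrite !inE/= dot_cons a00 mul0r add0r.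
Qed.

Lemma lebesgue_ball_cons n (a : 'rV[R]_n.+1) (r : R) : (0 < r)%R ->
  lam n.+1 (ball a r) = (2 * r)%:E * lam n (ball (\row_j a ord0 (lift ord0 j)) r).
Proof.
move=> r0.
have E x y : \1_(ball a r) (cons_rV (x, y)) =
    (\1_(ball (a ord0 ord0) r) x * \1_(ball (\row_j a ord0 (lift ord0 j)) r) y)%R :> R.
  rewrite !indicE -natrM mulnb; congr (_%:R); congr nat_of_bool.
  apply/idP/andP; rewrite !inE !ball_rV//.
    move=> H; split; first by have := H ord0 Logic.I; rewrite /= cons_rV0.
    by move=> j _ /=; have := H (lift ord0 j) Logic.I; rewrite /= cons_rV_lift mxE.
  move=> [h1 h2] i _; have [j ->|->] := unliftP ord0 i => /=.
    by rewrite cons_rV_lift; have := h2 j Logic.I; rewrite /= mxE.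
  by rewrite cons_rV0.
rewrite lebesgue_cons_indic; last exact: measurable_ball_rV.
have mI : measurable_fun [set: measurableTypeR R]
    (fun x : measurableTypeR R => (\1_(ball (a ord0 ord0) r) x)%:E : \bar R).
  by apply/measurable_EFinP; apply: measurable_indic; exact: (@measurable_ball R).
rewrite (_ : \int[_]_y _ = \int[lam n]_y ((2 * r)%:E *
    (\1_(ball (\row_j a ord0 (lift ord0 j)) r) y)%:E)); last first.
  apply: eq_integral => y _.
  under eq_integral do rewrite E EFinM.
  rewrite (ge0_integralZr _ measurableT mI) ?lee_fin//.
  congr (_ * _); rewrite integral_indic; [|exact: measurableT|exact: (@measurable_ball R)].
  by rewrite setIT; apply: etrans (lebesgue_measure_ball _ (ltW r0)) _; rewrite mulr_natl.
rewrite ge0_integralZl//; last 2 first.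
- apply/measurable_EFinP; apply: measurable_indic; exact: measurable_ball_rV.
- by rewrite lee_fin mulr_ge0// ltW.
rewrite integral_indic// ?setIT//; exact: measurable_ball_rV.
Qed.

Lemma lebesgue_ball_gt0 n (a : 'rV[R]_n) (r : R) : (0 < r)%R -> 0 < lam n (ball a r).
Proof.
move=> r0; elim: n a => [a|n IH a].
  by rewrite /= diracE mem_set ?lte01// ball_rV// => -[].
by rewrite lebesgue_ball_cons// mule_gt0// lte_fin mulr_gt0.
Qed.

Lemma lebesgue_ball_lty n (a : 'rV[R]_n) (r : R) : (0 < r)%R -> lam n (ball a r) < +oo.
Proof.
move=> r0; elim: n a => [a|n IH a].
  by rewrite /= diracE; case: (_ \in _); rewrite ltry.
by rewrite lebesgue_ball_cons// lte_mul_pinfty// lee_fin mulr_ge0 ?ler0n// ltW.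
Qed.

Lemma open_lebesgue_gt0 n (U : set 'rV[R]_n) : open U -> U !=set0 -> 0 < lam n U.
Proof.
move=> oU [a Ua].
have /nbhs_ballP[r /= r0 aU] : nbhs a U by exact: open_nbhs_nbhs.
apply: lt_le_trans (lebesgue_ball_gt0 a r0) _.
apply: le_measure => //; rewrite inE; first exact: measurable_ball_rV.
exact: open_measurable_rV.
Qed.

Lemma bounded_lebesgue_lty n (A : set 'rV[R]_n) : measurable A -> bounded_set A ->
  lam n A < +oo.
Proof.
move=> mA [M [_ MA]].
have A_ball : A `<=` ball (0%R : 'rV[R]_n) (`|M| + 2)%R.
  move=> x Ax; rewrite -ball_normE /ball_/= sub0r normrN.
  have := MA (`|M| + 1)%R; rewrite (le_lt_trans (ler_norm M)) ?ltrDl// => /(_ isT x Ax).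
  by move=> /le_lt_trans; apply; rewrite ltrD2l ltr1n.
apply: le_lt_trans (lebesgue_ball_lty (0%R : 'rV[R]_n) (r := (`|M| + 2)%R) _).
  by apply: le_measure => //; rewrite inE//; exact: measurable_ball_rV.
by rewrite ltr_pwDr.
Qed.

End null_and_positive.


(** * Differentiable and polynomial functions *)

Section C1_functions.
Context {R : realType} {n : nat}.
Local Notation E := 'rV[R]_n.+1.
Implicit Types (f g : E -> R) (x v : E).

(** The last clause is kept explicitly: derivatives are taken direction by direction, and linearity
    in the direction is what continuity of the partials buys. *)
Definition C1 f := [/\ continuous f, forall i, continuous (partial i f)
  & forall x v, is_derive x v f (dot (grad f x) v)].

Lemma is_derive_line f x v (t l : R) : is_derive (x + t *: v) v f l ->
  is_derive t (1 : R) (fun t : R => f (x + t *: v)) l.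
Proof.
move=> [df <-].
have EQ : (fun h : R => h^-1 *: (((fun t : R => f (x + t *: v)) \o shift t) (h *: 1) -
      f (x + t *: v))) =
    (fun h : R => h^-1 *: ((f \o shift (x + t *: v)) (h *: v) - f (x + t *: v))).
  apply/funext => h /=; congr (_ *: (f _ - _)).
  by rewrite [h *: 1]mulr1 scalerDl addrCA addrC.
split; first by rewrite /derivable EQ.
by rewrite /derive EQ.
Qed.

(** The sign of an increment along a coordinate is unknown, so the three cases are merged; for the
    limit it is enough that the intermediate point be at most |s| in absolute value. *)
Lemma MVT_abs (g g' : R -> R) (s : R) : (forall t : R, is_derive t (1 : R) g (g' t)) ->
  exists2 t, `|t| <= `|s| & g s - g 0 = s * g' t.
Proof.
move=> dg.
have cg : forall a b, {within `[a, b], continuous g}.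
  by move=> a b; apply: derivable_within_continuous => t _; case: (dg t).
have [s0|s0|->] := ltgtP s 0; last by exists 0; rewrite ?subrr ?mul0r.
- have [t] := MVT s0 (fun t _ => dg t) (cg _ _).
  rewrite in_itv/= => /andP[st t0] gE; exists t.
    by rewrite !ltr0_norm// lerN2 ltW.
  by rewrite -opprB gE; ring.
- have [t] := MVT s0 (fun t _ => dg t) (cg _ _).
  rewrite in_itv/= => /andP[st t0] gE; exists t.
    by rewrite !gtr0_norm// ltW.
  by rewrite gE; ring.
Qed.

Lemma partial_line f x (i : 'I_n.+1) (t : R) :
  (forall x, derivable f x (delta_mx ord0 i : E)) ->
  is_derive t (1 : R) (fun t : R => f (x + t *: (delta_mx ord0 i : E)))
    (partial i f (x + t *: (delta_mx ord0 i : E))).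
Proof. by move=> df; apply: is_derive_line; exact: derivableP. Qed.

(* Increments along v are split into increments along the coordinates, each
   handled by the mean value theorem. *)
Lemma C1_of_partials f : continuous f ->
  (forall i x, derivable f x (delta_mx ord0 i : E)) ->
  (forall i, continuous (partial i f)) -> C1 f.
Proof.
move=> cf df cdf; split => // x v.
pose w (k : nat) : E := \row_i (if (i < k)%N then v ord0 i else 0).
pose Q (u : E) (h : R) := h^-1 *: (f (h *: u + x) - f x).
suff H (k : nat) : (k <= n.+1)%N ->
    Q (w k) h @[h --> 0^'] --> \sum_(i < n.+1 | (i < k)%N) v ord0 i * partial i f x.
  have wn : w n.+1 = v by apply/rowP => i; rewrite mxE ltn_ord.
  have := H n.+1 (leqnn _); rewrite wn => Hv.
  have L : Q v h @[h --> 0^'] --> dot (grad f x) v.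
    apply: cvg_trans Hv _; rewrite /dot.
    rewrite [X in _ --> X](_ : _ = \sum_(i < n.+1 | (i < n.+1)%N) v ord0 i * partial i f x)//.
    by apply: eq_big => i; rewrite ?ltn_ord// => _; rewrite mxE mulrC.
  split; first by apply/cvg_ex; exists (dot (grad f x) v).
  exact/cvg_lim.
elim: k => [_|k IH kn].
  rewrite big_pred0//; apply: cvg_near_cst; apply: nearW => h.
  rewrite /Q (_ : w 0 = 0) ?scaler0 ?add0r ?subrr ?scaler0//.
  by apply/rowP => i; rewrite !mxE.
pose i0 : 'I_n.+1 := Ordinal kn.
pose e : E := delta_mx ord0 i0.
have wS : w k.+1 = w k + v ord0 i0 *: e.
  apply/rowP => i; rewrite !mxE eqxx/= ltnS leq_eqVlt.
  have [->|ii0] := eqVneq i i0; first by rewrite /= eqxx ltnn add0r mulr1.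
  by rewrite (negbTE (ii0 : i != k :> nat))/= mulr0 addr0.
have -> : \sum_(i < n.+1 | (i < k.+1)%N) v ord0 i * partial i f x =
    v ord0 i0 * partial i0 f x + \sum_(i < n.+1 | (i < k)%N) v ord0 i * partial i f x.
  rewrite (bigD1 i0)//=; congr (_ + _); apply: eq_bigl => i.
  by rewrite ltnS [RHS]ltn_neqAle andbC.
have -> : Q (w k.+1) = fun h => h^-1 *: (f (h *: w k.+1 + x) - f (h *: w k + x)) + Q (w k) h.
  by apply/funext => h; rewrite /Q -scalerDr addrA subrK.
apply: cvgD; last exact: IH (ltnW kn).
apply/cvgrPdist_lt => eps eps0.
(* The summand 1, here and in [C] below, only ensures positivity; [C] is chosen so that every
   intermediate point lies within |h| C of [x]. *)
pose V := `|v ord0 i0| + 1.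
have V0 : 0 < V by rewrite ltr_wpDl.
have /cvgrPdist_lt/(_ _ (divr_gt0 eps0 V0))/nbhs_ballP[d /= d0 dP] := cdf i0 x.
pose C := `|w k| + `|v ord0 i0| * `|e| + 1.
have C0 : 0 < C by rewrite ltr_wpDl// addr_ge0// mulr_ge0.
near=> h.
have h0 : h != 0 by near: h; exact: nbhs_dnbhs_neq.
have [t ht] := @MVT_abs _ _ (h * v ord0 i0)
  (fun t => partial_line (h *: w k + x) t (df i0)).
rewrite scale0r addr0 -/e => E1.
have -> : h *: w k.+1 + x = (h *: w k + x) + (h * v ord0 i0) *: e.
  by rewrite wS scalerDr scalerA addrAC.
rewrite E1 [_ *: _]mulrA mulrA mulVf// mul1r -mulrBr normrM.
apply: (@le_lt_trans _ _ (V * `|partial i0 f x - partial i0 f (h *: w k + x + t *: e)|)).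
  by rewrite ler_wpM2r// lerDl.
rewrite -ltr_pdivlMl// mulrC; apply: dP.
rewrite /= -ball_normE /ball_/=.
rewrite (_ : x - _ = - (h *: w k + t *: e)); last by rewrite opprD; apply/rowP => j; rewrite !mxE; ring.
rewrite normrN; apply: (@le_lt_trans _ _ (`|h| * C)).
  apply: (le_trans (ler_normD _ _)); rewrite !normrZ /C.
  have : `|t| * `|e| <= `|h| * (`|v ord0 i0| * `|e|).
    by rewrite mulrA -normrM ler_wpM2r.
  have := normr_ge0 h; nra.
rewrite -ltr_pdivlMr//.
near: h; apply: dnbhs0_lt; exact: divr_gt0.
Unshelve. all: by end_near. Qed.

Lemma Ck1_C1 f : Ck 1 f -> C1 f.
Proof. by move=> [cf [df cdf]]; apply: C1_of_partials => // i; case: (cdf i). Qed.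

Lemma partial_cst (c : R) i x : partial i (fun=> c : R) x = 0.
Proof. exact: derive_cst. Qed.

Lemma coordE (i : 'I_n.+1) x v : is_derive x v (fun x => x ord0 i) (v ord0 i).
Proof.
have h : (fun h : R => h^-1 *: (((fun x => x ord0 i) \o shift x) (h *: v) - x ord0 i)) @ 0^'
    --> v ord0 i.
  apply: cvg_near_cst; near=> h.
  have h0 : h != 0 by near: h; exact: nbhs_dnbhs_neq.
  by rewrite /= !mxE addrK [_ *: _]mulrA mulVf// mul1r.
split; first by apply/cvg_ex; exists (v ord0 i).
exact/cvg_lim.
Unshelve. all: by end_near. Qed.

Lemma partial_coord (i j : 'I_n.+1) x : partial i (fun x => x ord0 j) x = (i == j)%:R.
Proof.
by rewrite /partial; have [_ ->] := coordE j x (delta_mx ord0 i); rewrite mxE eqxx eq_sym.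
Qed.

Lemma partialD f g (i : 'I_n.+1) x : derivable f x (delta_mx ord0 i : E) ->
  derivable g x (delta_mx ord0 i : E) ->
  partial i (fun x => f x + g x) x = partial i f x + partial i g x.
Proof. exact: deriveD. Qed.

Lemma partialM f g (i : 'I_n.+1) x : derivable f x (delta_mx ord0 i : E) ->
  derivable g x (delta_mx ord0 i : E) ->
  partial i (fun x => f x * g x) x = f x * partial i g x + g x * partial i f x.
Proof. exact: deriveM. Qed.

(** An inductive closure instead of formal polynomials: induction on it yields derivability,
    smoothness and, later, bounds uniform over all simplices. *)
Inductive polyfun : (E -> R) -> Prop :=
| polyfun_cst c : polyfun (fun=> c)
| polyfun_coord i : polyfun (fun x => x ord0 i)
| polyfunD f g : polyfun f -> polyfun g -> polyfun (fun x => f x + g x)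
| polyfunM f g : polyfun f -> polyfun g -> polyfun (fun x => f x * g x).

Lemma polyfun_derivable f : polyfun f -> forall x v, derivable f x v.
Proof.
elim=> [c|i|{}f g _ df _ dg|{}f g _ df _ dg] x v.
- exact: derivable_cst.
- by case: (coordE i x v).
- exact: derivableD.
- exact: derivableM.
Qed.

Lemma polyfun_continuous f : polyfun f -> continuous f.
Proof.
elim=> [c|i|{}f g _ cf _ cg|{}f g _ cf _ cg] x.
- exact: cst_continuous.
- exact: continuous_coord.
- exact: (continuousD (cf x) (cg x)).
- exact: (continuousM (cf x) (cg x)).
Qed.

Lemma polyfun_partial f i : polyfun f -> polyfun (partial i f).
Proof.
elim=> [c|j|{}f g pf df pg dg|{}f g pf df pg dg].
- by rewrite (_ : partial i _ = fun=> 0); [exact: polyfun_cst|apply/funext => x; exact: partial_cst].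
- by rewrite (_ : partial i _ = fun=> (i == j)%:R); [exact: polyfun_cst|apply/funext => x; exact: partial_coord].
- rewrite (_ : partial i _ = fun x => partial i f x + partial i g x); first exact: polyfunD.
  by apply/funext => x; apply: partialD; exact: polyfun_derivable.
- rewrite (_ : partial i _ = fun x => f x * partial i g x + g x * partial i f x).
    by apply: polyfunD; exact: polyfunM.
  by apply/funext => x; apply: partialM; exact: polyfun_derivable.
Qed.

Lemma polyfun_smooth f : polyfun f -> smooth f.
Proof.
move=> pf k; elim: k f pf => [|k IH] f pf; split => //; try exact: polyfun_continuous.
split=> [i x|i]; first exact: polyfun_derivable.
exact/IH/polyfun_partial.
Qed.

Lemma polyfun_C1 f : polyfun f -> C1 f.
Proof. by move=> /polyfun_smooth/(_ 1%N)/Ck1_C1. Qed.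

Lemma C1M f g : C1 f -> C1 g -> C1 (fun x => f x * g x).
Proof.
move=> [cf cdf df] [cg cdg dg]; apply: C1_of_partials.
- by move=> x; exact: (continuousM (cf x) (cg x)).
- by move=> i x; apply: derivableM; [case: (df x (delta_mx ord0 i))|case: (dg x (delta_mx ord0 i))].
- move=> i; rewrite (_ : partial i _ = fun x => f x * partial i g x + g x * partial i f x).
    move=> x; apply: (continuousD (continuousM (cf x) (cdg i x)) (continuousM (cg x) (cdf i x))).
  by apply/funext => x; apply: partialM; [case: (df x (delta_mx ord0 i))|case: (dg x (delta_mx ord0 i))].
Qed.

Lemma polyfun_sum I (r : seq I) (P : pred I) (F : I -> E -> R) :
  (forall i, P i -> polyfun (F i)) -> polyfun (fun x => \sum_(i <- r | P i) F i x).
Proof.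
move=> pF; elim: r => [|i r IH].
  by under eq_fun do rewrite big_nil; exact: polyfun_cst.
under eq_fun do rewrite big_cons.
by have [Pi|//] := boolP (P i); apply: polyfunD => //; exact: pF.
Qed.

Lemma polyfun_prod I (r : seq I) (P : pred I) (F : I -> E -> R) :
  (forall i, P i -> polyfun (F i)) -> polyfun (fun x => \prod_(i <- r | P i) F i x).
Proof.
move=> pF; elim: r => [|i r IH].
  by under eq_fun do rewrite big_nil; exact: polyfun_cst.
under eq_fun do rewrite big_cons.
by have [Pi|//] := boolP (P i); apply: polyfunM => //; exact: pF.
Qed.

End C1_functions.

Lemma continuous_sum (R : realType) (T : topologicalType) I (r : seq I) (P : pred I)
    (F : I -> T -> R) : (forall i, continuous (F i)) ->
  continuous (fun x => \sum_(i <- r | P i) F i x).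
Proof.
move=> cF; elim: r => [|i r IH] x.
  by under eq_fun do rewrite big_nil; exact: cvg_cst.
under eq_fun do rewrite big_cons.
by case: (P i); [exact: (continuousD (cF i x) (IH x))|exact: IH].
Qed.

(** * The Euclidean inner product and norm *)

Section euclid.
Context {R : realType} {n : nat}.
Implicit Types (x y z : 'rV[R]_n) (a : R).

Lemma dotC x y : dot x y = dot y x.
Proof. by apply: eq_bigr => i _; rewrite mulrC. Qed.

Lemma dotDr x y z : dot x (y + z) = dot x y + dot x z.
Proof. by rewrite -big_split; apply: eq_bigr => i _; rewrite mxE mulrDr. Qed.

Lemma dotZr a x y : dot x (a *: y) = a * dot x y.
Proof. by rewrite /dot mulr_sumr; apply: eq_bigr => i _; rewrite mxE mulrCA. Qed.

Lemma dotNr x y : dot x (- y) = - dot x y.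
Proof. by rewrite -scaleN1r dotZr mulN1r. Qed.

Lemma dotBr x y z : dot x (y - z) = dot x y - dot x z.
Proof. by rewrite dotDr dotNr. Qed.

Lemma dotDl x y z : dot (x + y) z = dot x z + dot y z.
Proof. by rewrite dotC dotDr dotC (dotC z y). Qed.

Lemma dotZl a x y : dot (a *: x) y = a * dot x y.
Proof. by rewrite dotC dotZr dotC. Qed.

Lemma dotNl x y : dot (- x) y = - dot x y.
Proof. by rewrite dotC dotNr dotC. Qed.

Lemma dotBl x y z : dot (x - y) z = dot x z - dot y z.
Proof. by rewrite dotDl dotNl. Qed.

Lemma dot0r x : dot x 0 = 0.
Proof. by rewrite /dot big1// => i _; rewrite mxE mulr0. Qed.

Lemma dot0l x : dot 0 x = 0.
Proof. by rewrite dotC dot0r. Qed.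

Lemma dot_sumr I (r : seq I) (P : pred I) (F : I -> 'rV[R]_n) x :
  dot x (\sum_(i <- r | P i) F i) = \sum_(i <- r | P i) dot x (F i).
Proof. by apply: (big_morph (dot x) (dotDr x) (dot0r x)). Qed.

Lemma dot_delta x (i : 'I_n) : dot x (delta_mx ord0 i) = x ord0 i.
Proof.
rewrite /dot (bigD1 i)//= mxE !eqxx mulr1 big1 ?addr0// => k ki.
by rewrite mxE (negbTE ki) andbF mulr0.
Qed.

Lemma dot_ge0 x : 0 <= dot x x.
Proof. by apply: sumr_ge0 => i _; exact: sqr_ge0. Qed.

Lemma dot_eq0 x : (dot x x == 0) = (x == 0).
Proof.
apply/eqP/eqP => [|->]; last by rewrite dot0l.
move/eqP; rewrite psumr_eq0 => [/allP H|i _]; last exact: sqr_ge0.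
apply/rowP => i; have := H i (mem_index_enum _).
by rewrite mulf_eq0 orbb mxE => /eqP.
Qed.

Lemma enorm_ge0 x : 0 <= enorm x.
Proof. exact: sqrtr_ge0. Qed.

Lemma enorm_sqr x : enorm x ^+ 2 = dot x x.
Proof. by rewrite sqr_sqrtr// dot_ge0. Qed.

Lemma enorm_eq0 x : (enorm x == 0) = (x == 0).
Proof. by rewrite -dot_eq0 -enorm_sqr sqrf_eq0. Qed.

Lemma enormN x : enorm (- x) = enorm x.
Proof. by rewrite /enorm dotNl dotNr opprK. Qed.

Lemma enormZ a x : enorm (a *: x) = `|a| * enorm x.
Proof.
by rewrite /enorm dotZl dotZr mulrA -expr2 sqrtrM ?sqr_ge0// sqrtr_sqr.
Qed.

Lemma dot_le x y : `|dot x y| <= enorm x * enorm y.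
Proof.
have [->|x0] := eqVneq x 0; first by rewrite dot0l normr0 mulr_ge0 ?enorm_ge0.
have x2 : 0 < dot x x by rewrite lt_neqAle dot_ge0 eq_sym dot_eq0 x0.
have : 0 <= dot x x * dot y y - dot x y ^+ 2.
  (* The component of [y] orthogonal to [x], multiplied by [dot x x] to avoid a division. *)
  have := dot_ge0 (dot x x *: y - dot x y *: x).
  rewrite !(dotBl, dotBr, dotZl, dotZr) (dotC y x).
  rewrite [X in 0 <= X -> _](_ : _ = dot x x * (dot x x * dot y y - dot x y ^+ 2)); last by ring.
  by rewrite pmulr_rge0.
rewrite subr_ge0 => H; rewrite -sqrtr_sqr -sqrtrM ?dot_ge0//.
by rewrite ler_sqrt// mulr_ge0 ?dot_ge0.
Qed.

Lemma enormD x y : enorm (x + y) <= enorm x + enorm y.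
Proof.
rewrite -ler_sqr ?nnegrE ?addr_ge0 ?enorm_ge0// sqrrD !enorm_sqr dotDl !dotDr (dotC y x).
have := le_trans (ler_norm _) (dot_le x y); rewrite -mulr_natl; lra.
Qed.

Lemma coord_le_enorm x (i : 'I_n) : `|x ord0 i| <= enorm x.
Proof.
rewrite -sqrtr_sqr ler_sqrt ?dot_ge0// /dot (bigD1 i)//= -expr2 lerDl.
by apply: sumr_ge0 => j _; exact: sqr_ge0.
Qed.

Lemma enorm_le_sum x : enorm x <= \sum_i `|x ord0 i|.
Proof.
rewrite -ler_sqr ?nnegrE ?enorm_ge0 ?sumr_ge0// enorm_sqr /dot.
rewrite expr2 mulr_suml; apply: ler_sum => i _.
rewrite (le_trans (ler_norm _))// normrM ler_wpM2l// (bigD1 i)//= lerDl.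
exact: sumr_ge0.
Qed.

Lemma continuous_dot x : continuous (dot x).
Proof.
apply: continuous_sum => i y; apply: continuousM; first exact: cst_continuous.
exact: continuous_coord.
Qed.

Lemma continuous_enorm : continuous (@enorm R n).
Proof.
move=> y; apply: (@continuous_comp _ _ _ (fun x => dot x x) Num.sqrt); last exact: sqrt_continuous.
apply: continuous_sum => i z; apply: continuousM; exact: continuous_coord.
Qed.

End euclid.

(** * Barycentric coordinates and integrals over simplices *)

Section simplex_algebra.
Context {R : realType} {n : nat}.
Variable V : simplex R n.
Hypothesis hV : nondegenerate_simplex V.
Implicit Types (x v : 'rV[R]_n.+1) (l : 'rV[R]_n.+2) (i j k : 'I_n.+2).

Lemma mul_bary_mx l : l *m bary_mx V =
  row_mx (const_mx (\sum_j l ord0 j) : 'rV_1) (l *m V).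
Proof.
have <- : l *m (const_mx 1 : 'cV_n.+2) = const_mx (\sum_j l ord0 j) :> 'rV_1.
  by apply/rowP => i; rewrite !mxE; apply: eq_bigr => j _; rewrite mxE mulr1.
exact (@mul_mx_row R 1 n.+2 1 n.+1 l (const_mx 1) V).
Qed.

Let bary_mulV x : row_mx (const_mx (\sum_j bary V x ord0 j) : 'rV_1) (bary V x *m V) =
  row_mx (const_mx 1) x.
Proof. by rewrite -mul_bary_mx mulmxKV. Qed.

Lemma sum_bary x : \sum_j bary V x ord0 j = 1.
Proof. by have /eq_row_mx[/rowP/(_ ord0)] := bary_mulV x; rewrite !mxE. Qed.

Lemma bary_mul x : bary V x *m V = x.
Proof. by have /eq_row_mx[] := bary_mulV x. Qed.

Lemma baryK l : \sum_j l ord0 j = 1 -> bary V (l *m V) = l.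
Proof.
move=> l1; rewrite /bary.
have -> : row_mx (const_mx 1 : 'rV_1) (l *m V) = l *m bary_mx V :> 'rV_n.+2.
  by rewrite mul_bary_mx l1.
by rewrite mulmxK.
Qed.

Lemma bary_affine x j : bary V x ord0 j = bary V 0 ord0 j + dot (bary_grad V j) x.
Proof.
have E y : bary V y ord0 j = invmx (bary_mx V) ord0 j + dot (bary_grad V j) y.
  rewrite /bary mxE big_ord_recl; congr (_ + _).
    rewrite [X in X * _](_ : _ = 1) ?mul1r//.
    transitivity (row_mx (const_mx 1 : 'rV_1) y ord0 (lshift n.+1 ord0)).
      by congr (_ _ _); exact/val_inj.
    by rewrite row_mxEl mxE.
  apply: eq_bigr => i _; rewrite [bary_grad V j ord0 i]mxE mulrC; congr (_ * _).
  rewrite (_ : lift ord0 i = rshift 1 i); last exact/val_inj.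
  exact (@row_mxEr R 1 1 n.+1 (const_mx 1) y ord0 i).
rewrite !E dot0r addr0//.
Qed.

Lemma bary_line x v (t : R) j :
  bary V (x + t *: v) ord0 j = bary V x ord0 j + t * dot (bary_grad V j) v.
Proof. by rewrite bary_affine (bary_affine x) dotDr dotZr addrA. Qed.

Lemma faceP (A : pred 'I_n.+2) x : face V A x <->
  (forall j, 0 <= bary V x ord0 j) /\ (forall j, ~~ A j -> bary V x ord0 j = 0).
Proof.
split=> [[l [l0 lA l1 ->]]|[h0 hA]]; first by rewrite baryK.
by exists (bary V x); split => //; [exact: sum_bary|rewrite bary_mul].
Qed.

Lemma hullP x : hull V x <-> forall j, 0 <= bary V x ord0 j.
Proof. by rewrite /hull faceP; split=> [[]|h]//; split. Qed.

Lemma facetP j x : facet V j x <-> hull V x /\ bary V x ord0 j = 0.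
Proof.
rewrite /facet faceP hullP; split=> -[h hj]; split => //; last first.
  by move=> k; rewrite /= negbK => /eqP ->.
by apply: hj; rewrite /= negbK.
Qed.

Lemma facet_sub_hull j : facet V j `<=` hull V.
Proof. by move=> x /facetP[]. Qed.

Lemma hull_bary_le1 x j : hull V x -> bary V x ord0 j <= 1.
Proof.
move=> /hullP h; rewrite -(sum_bary x) (bigD1 j)//= lerDl; exact: sumr_ge0.
Qed.

Lemma bary_vertex i j : bary V (row i V) ord0 j = (i == j)%:R.
Proof.
rewrite rowE baryK ?mxE ?eqxx 1?eq_sym//.
by rewrite (bigD1 i)//= mxE !eqxx big1 ?addr0// => k ki; rewrite mxE eqxx (negbTE ki).
Qed.

Lemma hull_vertex i : hull V (row i V).
Proof. by apply/hullP => j; rewrite bary_vertex ler0n. Qed.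

Lemma dot_bary_grad_edge i k j :
  dot (bary_grad V j) (row i V - row k V) = (i == j)%:R - (k == j)%:R.
Proof.
have := bary_line (row k V) (row i V - row k V) 1 j.
by rewrite scale1r mul1r (addrC (row k V)) subrK !bary_vertex => ->; rewrite (addrC (k == j)%:R) addrK.
Qed.

Lemma sum_bary_grad v : \sum_j dot (bary_grad V j) v = 0.
Proof.
have := sum_bary (0 + 1 *: v).
under eq_bigr do rewrite bary_line mul1r.
by rewrite big_split/= sum_bary -[RHS]addr0 => /addrI.
Qed.

(** The derivative in direction [v] of the identity that writes a point as the combination of the
    vertices by its barycentric coordinates. *)
Lemma bary_grad_decomp v : v = \sum_j dot (bary_grad V j) v *: row j V.
Proof.
have H x : x = \sum_j bary V x ord0 j *: row j V.
  by rewrite -{1}(bary_mul x) mulmx_sum_row.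
have := H (0 + 1 *: v).
under eq_bigr do rewrite bary_line mul1r scalerDl.
by rewrite big_split/= -(H 0) !add0r scale1r.
Qed.

Lemma bary_grad_neq0 j : bary_grad V j != 0.
Proof.
have [i ij] : exists i, i != j.
  exists (lift j ord0); by rewrite eq_sym neq_lift.
apply/eqP => g0; have := dot_bary_grad_edge j i j.
by rewrite g0 dot0l eqxx (negbTE ij) subr0 => /esym/eqP; rewrite oner_eq0.
Qed.

Lemma enorm_bary_grad_gt0 j : 0 < enorm (bary_grad V j).
Proof. by rewrite lt_neqAle enorm_ge0 eq_sym enorm_eq0 bary_grad_neq0. Qed.

Lemma polyfun_dot (a : 'rV[R]_n.+1) : polyfun (dot a).
Proof.
apply: polyfun_sum => i _; apply: polyfunM; [exact: polyfun_cst|exact: polyfun_coord].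
Qed.

Lemma polyfun_bary j : polyfun (fun x => bary V x ord0 j).
Proof.
under eq_fun do rewrite bary_affine.
by apply: polyfunD; [exact: polyfun_cst|exact: polyfun_dot].
Qed.

Lemma partial_bary (i : 'I_n.+1) j x : partial i (fun x => bary V x ord0 j) x = bary_grad V j ord0 i.
Proof.

have L : is_derive x (delta_mx ord0 i : 'rV[R]_n.+1) (fun x => bary V x ord0 j)
    (bary_grad V j ord0 i).
  have h : (fun h : R => h^-1 *: (((fun x => bary V x ord0 j) \o shift x)
      (h *: (delta_mx ord0 i : 'rV[R]_n.+1)) - bary V x ord0 j)) @ 0^'
      --> bary_grad V j ord0 i.
    apply: cvg_near_cst; near=> h.
    have h0 : h != 0 by near: h; exact: nbhs_dnbhs_neq.
    rewrite /= (addrC _ x) bary_line (addrC (bary V x ord0 j)) addrK [_ *: _]mulrA mulVf// mul1r.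
    exact: dot_delta.
  split; first by apply/cvg_ex; exists (bary_grad V j ord0 i).
  exact/cvg_lim.
by case: L.
Unshelve. all: by end_near. Qed.

Lemma closed_hull : closed (hull V).
Proof.
have -> : hull V = \bigcap_(j in [set: 'I_n.+2]) [set x | 0 <= bary V x ord0 j].
  by apply/seteqP; split => x; [move/hullP => h j _; exact: h|move=> h; apply/hullP => j; exact: h].
apply: closed_bigI => j _.
apply: (@preimage_closed _ _ (fun x => bary V x ord0 j) [set y | 0 <= y]).
  by move=> x _; exact: (polyfun_continuous (polyfun_bary j)).
exact: closed_ge.
Qed.

End simplex_algebra.

Lemma patch_in (T U : Type) (d : T -> U) (A : set T) (f : T -> U) x :
  A x -> patch d A f x = f x.
Proof. by move=> Ax; rewrite /patch mem_set. Qed.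

Lemma patch_out (T U : Type) (d : T -> U) (A : set T) (f : T -> U) x :
  ~ A x -> patch d A f x = d x.
Proof. by move=> Ax; rewrite /patch memNset. Qed.

Section compact_integrals.
Context {R : realType} {n : nat}.
Local Notation lam := (@lebesgue_rV R n).

Lemma compact_integrable (K : set 'rV[R]_n) (f : 'rV[R]_n -> R) :
  compact K -> continuous f -> lam.-integrable K (EFin \o f).
Proof.
move=> cK cf.
have cfK : compact (f @` K).
  by apply: continuous_compact => //; exact: continuous_subspaceT.
have [M [_ MP]] := compact_bounded cfK.
have mK : measurable K by apply: closed_measurable_rV; exact: compact_closed.
apply: (@bounded_integrable _ _ _ _ _ _ (M + 1)) => //.
- exact: bounded_lebesgue_lty (compact_bounded cK).
- by apply: measurable_funTS; exact: continuous_measurable_rV.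
- by move=> x Kx; apply: (MP (M + 1)); [rewrite ltrDl|exists x].
Qed.

End compact_integrals.

(** * The reference simplex and integrals in barycentric coordinates *)

Section reference_simplex.
Context {R : realType}.
Local Notation lam := (@lebesgue_rV R).

Definition bary_ref m (s : 'rV[R]_m) : 'rV[R]_m.+1 := cons_rV (1 - \sum_i s ord0 i, s).

Lemma bary_ref0 m (s : 'rV[R]_m) : bary_ref s ord0 ord0 = 1 - \sum_i s ord0 i.
Proof. by rewrite cons_rV0. Qed.

Lemma bary_refS m (s : 'rV[R]_m) i : bary_ref s ord0 (lift ord0 i) = s ord0 i.
Proof. by rewrite cons_rV_lift. Qed.

Lemma sum_cons_rV m (x : R) (y : 'rV[R]_m) :
  \sum_i cons_rV (x, y) ord0 i = x + \sum_i y ord0 i.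
Proof.
by rewrite big_ord_recl cons_rV0; congr (_ + _); apply: eq_bigr => i _; rewrite cons_rV_lift.
Qed.

Lemma sum_bary_ref m (s : 'rV[R]_m) : \sum_i bary_ref s ord0 i = 1.
Proof.
by rewrite sum_cons_rV subrK.
Qed.

Lemma ref_simplexP m (s : 'rV[R]_m) : ref_simplex s <-> forall i, 0 <= bary_ref s ord0 i.
Proof.
split=> [[s0 s1] i|h].
  by have [j ->|->] := unliftP ord0 i; rewrite ?cons_rV_lift ?cons_rV0//= subr_ge0.
split; first by move=> i; have := h (lift ord0 i); rewrite cons_rV_lift.
by have := h ord0; rewrite cons_rV0 subr_ge0.
Qed.

Lemma continuous_bary_ref m (i : 'I_m.+1) : continuous (fun s : 'rV[R]_m => bary_ref s ord0 i).
Proof.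
have [j ->|->] := unliftP ord0 i.
  by under eq_fun do rewrite cons_rV_lift; exact: continuous_coord.
under eq_fun do rewrite cons_rV0/=.
move=> s; apply: continuousB; first exact: cst_continuous.
apply: continuous_sum => j; exact: continuous_coord.
Qed.

Lemma continuous_bary_ref_mul m p (W : 'M[R]_(m.+1, p)) (i : 'I_p) :
  continuous (fun s : 'rV[R]_m => (bary_ref s *m W) ord0 i).
Proof.
under eq_fun do rewrite mxE.
apply: continuous_sum => j s; apply: continuousM; last exact: cst_continuous.
exact: continuous_bary_ref.
Qed.

Lemma continuous_comp_bary_ref m p (W : 'M[R]_(m.+1, p)) (f : 'rV[R]_p -> R) :
  continuous f -> continuous (fun s : 'rV[R]_m => f (bary_ref s *m W)).
Proof.
move=> cf s; apply: continuous_comp; last exact: cf.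
by apply: continuous_rV => i; exact: continuous_bary_ref_mul.
Qed.

Lemma closed_ref_simplex m : closed (@ref_simplex R m).
Proof.
have -> : @ref_simplex R m = \bigcap_(i in [set: 'I_m.+1]) [set s | 0 <= bary_ref s ord0 i].
  apply/seteqP; split => s; first by move=> /ref_simplexP h i _; exact: h.
  by move=> h; apply/ref_simplexP => i; exact: h.
apply: closed_bigI => i _.
apply: (@preimage_closed _ _ (fun x => bary_ref x ord0 i) [set y | 0 <= y]).
  by move=> s _; exact: continuous_bary_ref.
exact: closed_ge.
Qed.

Lemma bounded_ref_simplex m : bounded_set (@ref_simplex R m).
Proof.
exists 1; split; first exact: num_real.
move=> M M1 s [s0 s1] /=; rewrite (le_trans _ (ltW M1))//.
rewrite /Num.norm/= mx_normrE; apply: bigmax_le => // -[i j] _ /=; rewrite ord1.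
by rewrite ger0_norm// (le_trans _ s1)// (bigD1 j)//= lerDl sumr_ge0.
Qed.

Lemma compact_ref_simplex m : compact (@ref_simplex R m).
Proof.
exact: bounded_closed_compact (@bounded_ref_simplex m) (@closed_ref_simplex m).
Qed.

Lemma measurable_ref_simplex m : measurable (@ref_simplex R m).
Proof. apply: closed_measurable_rV; exact: closed_ref_simplex. Qed.

Lemma ref_simplex_interior m (s : 'rV[R]_m) :
  (forall i, 0 < bary_ref s ord0 i) -> nbhs s (@ref_simplex R m).
Proof.
move=> s0.
have : \forall t \near s, forall i, 0 < bary_ref t ord0 i.
  apply: (filter_forall (F := nbhs s) (f := fun (i : 'I_m.+1) t => 0 < bary_ref t ord0 i)) => i.
  exact: (@continuous_bary_ref m i s _ (open_nbhs_nbhs (conj (@open_gt R 0) (s0 i)))).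
by apply: filterS => t t0; apply/ref_simplexP => i; exact/ltW/t0.
Qed.

Definition ref_vol m : R := fine (lam m (@ref_simplex R m)).

Lemma lebesgue_ref_simplex m : lam m (@ref_simplex R m) = (ref_vol m)%:E.
Proof.
rewrite fineK// ge0_fin_numE//; apply: bounded_lebesgue_lty.
  exact: measurable_ref_simplex.
exact: bounded_ref_simplex.
Qed.

Lemma ref_vol_gt0 m : 0 < ref_vol m.
Proof.
rewrite -lte_fin -lebesgue_ref_simplex.
pose s : 'rV[R]_m := const_mx (m.+1%:R^-1).
have sE i : bary_ref s ord0 i = m.+1%:R^-1.
  have [j ->|->] := unliftP ord0 i; rewrite ?cons_rV_lift ?cons_rV0/= ?mxE//.
  under eq_bigr do rewrite mxE.
  rewrite sumr_const card_ord -mulr_natr -natr1; field.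
  by rewrite natr1 pnatr_eq0.
have /nbhs_ballP[r /= r0 sr] : nbhs s (@ref_simplex R m).
  by apply: ref_simplex_interior => i; rewrite sE invr_gt0.
apply: lt_le_trans (lebesgue_ball_gt0 s r0) _.
apply: le_measure => //; rewrite inE; first exact: measurable_ball_rV.
exact: measurable_ref_simplex.
Qed.

(** No Jacobian, and a number of vertices independent of the ambient dimension: the same notion
    serves an element and, with one row of vertices removed, each of its facets. *)
Definition simplex_int m p (W : 'M[R]_(m.+1, p)) (f : 'rV[R]_p -> R) : R :=
  (\int[lam m]_(s in @ref_simplex R m) f (bary_ref s *m W))%R.

Lemma simplex_int_integrable m p (W : 'M[R]_(m.+1, p)) (f : 'rV[R]_p -> R) :
  continuous f ->
  (lam m).-integrable (@ref_simplex R m) (EFin \o (fun s => f (bary_ref s *m W))).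
Proof.
move=> cf; apply: (compact_integrable (f := fun s => f (bary_ref s *m W))).
  exact: compact_ref_simplex.
exact: continuous_comp_bary_ref.
Qed.

(** At fixed [y] the first coordinate moves the point parallel to the edge from vertex 0 to vertex
    1, starting on the facet opposite vertex 1. *)
Lemma bary_ref_cons m p (W : 'M[R]_(m.+2, p)) (x : R) (y : 'rV[R]_m) :
  bary_ref (cons_rV (x, y)) *m W =
  bary_ref y *m row' (lift ord0 ord0) W + x *: (row (lift ord0 ord0) W - row ord0 W).
Proof.
apply/rowP => i; rewrite !mxE !big_ord_recl !bary_ref0 bary_refS cons_rV0 sum_cons_rV/=.
have -> : row' (lift ord0 ord0) W ord0 i = W ord0 i by rewrite mxE; congr (W _ _); exact/val_inj.
have -> : \sum_(j < m) bary_ref (cons_rV (x, y)) ord0 (lift ord0 (lift ord0 j)) *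
    W (lift ord0 (lift ord0 j)) i =
    \sum_(j < m) bary_ref y ord0 (lift ord0 j) * row' (lift ord0 ord0) W (lift ord0 j) i.
  apply: eq_bigr => j _; rewrite !bary_refS cons_rV_lift mxE; congr (_ * W _ _); exact/val_inj.
ring.
Qed.

(** The other end of that segment: it lies on the facet opposite vertex 0, at the same parameter
    [y]. *)
Lemma bary_ref_row'0 m p (W : 'M[R]_(m.+2, p)) (y : 'rV[R]_m) :
  bary_ref y *m row' ord0 W = bary_ref y *m row' (lift ord0 ord0) W +
    (1 - \sum_i y ord0 i) *: (row (lift ord0 ord0) W - row ord0 W).
Proof.
apply/rowP => i; rewrite !mxE !big_ord_recl !bary_ref0 /=.
have -> : row' (lift ord0 ord0) W ord0 i = W ord0 i by rewrite mxE; congr (W _ _); exact/val_inj.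
have -> : row' ord0 W ord0 i = W (lift ord0 ord0) i by rewrite mxE.
have -> : \sum_(j < m) bary_ref y ord0 (lift ord0 j) * row' ord0 W (lift ord0 j) i =
   \sum_(j < m) bary_ref y ord0 (lift ord0 j) * row' (lift ord0 ord0) W (lift ord0 j) i.
  apply: eq_bigr => j _; rewrite !mxE; congr (_ * W _ _); exact/val_inj.
ring.
Qed.

Lemma ref_simplex_cons m (x : R) (y : 'rV[R]_m) :
  ref_simplex (cons_rV (x, y)) <-> ref_simplex y /\ 0 <= x <= 1 - \sum_i y ord0 i.
Proof.
rewrite /ref_simplex/= sum_cons_rV.
split=> [[h1 h2]|[[h1 h2] /andP[x0 x1]]].
  have x0 : 0 <= x by have := h1 ord0; rewrite cons_rV0.
  have y0 i : 0 <= y ord0 i by have := h1 (lift ord0 i); rewrite cons_rV_lift.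
  split; first by split => //; lra.
  by rewrite x0/=; lra.
split; last by lra.
by move=> i; have [j ->|->] := unliftP ord0 i; rewrite ?cons_rV_lift ?cons_rV0.
Qed.

End reference_simplex.

(** * Independence of simplex integrals from the list of vertices *)

Section reparametrization.
Context {R : realType}.
Local Notation lam := (@lebesgue_rV R).
Variable m : nat.

(* The linear part of the affine map of R^m given in barycentric coordinates by
   the matrix A. *)
Definition bary_lin (A : 'M[R]_m.+1) : 'M[R]_m :=
  \matrix_(i, k) (A (lift ord0 i) (lift ord0 k) - A ord0 (lift ord0 k)).
Let off (A : 'M[R]_m.+1) : 'rV[R]_m := \row_k A ord0 (lift ord0 k).
Let aff A (s : 'rV[R]_m) := s *m bary_lin A + off A.

Let aff_bary_ref (A : 'M[R]_m.+1) (s : 'rV[R]_m) : (forall i, \sum_k A i k = 1) ->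
  bary_ref (aff A s) = bary_ref s *m A.
Proof.
move=> A1.
have sum1 : \sum_k (bary_ref s *m A) ord0 k = 1.
  under eq_bigr do rewrite mxE.
  rewrite exchange_big/= -(sum_bary_ref s); apply: eq_bigr => i _.
  by rewrite -mulr_sumr A1 mulr1.
have E k : bary_ref (aff A s) ord0 (lift ord0 k) = (bary_ref s *m A) ord0 (lift ord0 k).
  rewrite bary_refS !mxE big_ord_recl bary_ref0 mulrBl mul1r mulr_suml -addrA addrC.
  congr (_ + _); rewrite -sumrN -big_split/=; apply: eq_bigr => i _.
  by rewrite bary_refS mxE; ring.
apply/rowP => i; have [k ->|->] := unliftP ord0 i; first exact: E.
have := sum_bary_ref (aff A s); rewrite -sum1 !big_ord_recl.
by under eq_bigr do rewrite E; move/addIr.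
Qed.

(** A stochastic matrix with a stochastic inverse induces an affine bijection of the reference
    simplex onto itself. It can change integrals only by the constant factor
    [|\det (bary_lin A)|^-1]. *)
Let reparam p (W W' : 'M[R]_(m.+1, p)) (A A' : 'M[R]_m.+1)
    (f : 'rV[R]_p -> R) :
  continuous f ->
  (forall i k, 0 <= A i k) -> (forall i, \sum_k A i k = 1) ->
  (forall i k, 0 <= A' i k) -> (forall i, \sum_k A' i k = 1) ->
  A *m A' = 1%:M -> W' = A *m W ->
  `|\det (bary_lin A)| = 1 /\ simplex_int W' f = simplex_int W f.
Proof.
move=> cf A0 A1 A'0 A'1 AA' WE.
have affK s : aff A' (aff A s) = s.
  apply/rowP => k; rewrite -bary_refS aff_bary_ref// aff_bary_ref// -mulmxA AA' mulmx1.
  exact: bary_refS.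
have U : bary_lin A \in unitmx.
  suff /mulmx1_unit[] : bary_lin A *m bary_lin A' = 1%:M by [].
  have off0 : off A *m bary_lin A' + off A' = 0.
    by have := affK 0; rewrite /aff mul0mx add0r.
  apply/row_matrixP => i; rewrite rowE row1.
  have := affK (delta_mx ord0 i).
  by rewrite {1}/aff {1}/aff mulmxDl -addrA off0 addr0 mulmxA.
have S s : ref_simplex (aff A s) <-> ref_simplex s.
  split=> /ref_simplexP h; apply/ref_simplexP => i.
    rewrite -(affK s) aff_bary_ref// mxE; apply: sumr_ge0 => k _; exact: mulr_ge0.
  rewrite aff_bary_ref// mxE; apply: sumr_ge0 => k _; exact: mulr_ge0.
have key (g : 'rV[R]_p -> R) : continuous g ->
    simplex_int W' g = `|\det (bary_lin A)|^-1 * simplex_int W g.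
  move=> cg; rewrite /simplex_int [in RHS]Rintegral_mkcond.
  rewrite -(integral_affine (off A) U); last first.
    rewrite -restrict_EFin; apply/integrable_restrict => //.
      exact: measurable_ref_simplex.
    by rewrite setTI; exact: simplex_int_integrable.
  rewrite Rintegral_mkcond; apply: eq_Rintegral => s _.
  rewrite -/(aff A s); have [hs|hs] := pselect (ref_simplex s).
    by rewrite patch_in// patch_in ?S// aff_bary_ref// WE mulmxA.
  by rewrite !patch_out// S.
(* The factor is found by integrating 1, both sides being the nonzero volume of the reference
   simplex; no determinant is computed. *)
have d1 : `|\det (bary_lin A)|^-1 = 1.
  have := key (fun=> 1) (@cst_continuous _ _ _).
  rewrite /simplex_int !Rintegral_cst; last exact: measurable_ref_simplex.
  rewrite mul1r -[LHS]mul1r => /esym/mulIf; apply; exact: lt0r_neq0 (ref_vol_gt0 _).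
by rewrite key// d1 mul1r -[`|_|]invrK d1 invr1.
Qed.

Lemma simplex_int_reparam p (W W' : 'M[R]_(m.+1, p)) (A A' : 'M[R]_m.+1)
    (f : 'rV[R]_p -> R) :
  continuous f ->
  (forall i k, 0 <= A i k) -> (forall i, \sum_k A i k = 1) ->
  (forall i k, 0 <= A' i k) -> (forall i, \sum_k A' i k = 1) ->
  A *m A' = 1%:M -> W' = A *m W -> simplex_int W' f = simplex_int W f.
Proof.
by move=> cf A0 A1 A'0 A'1 AA' WE; case: (reparam cf A0 A1 A'0 A'1 AA' WE).
Qed.

Lemma norm_det_bary_lin (A A' : 'M[R]_m.+1) :
  (forall i k, 0 <= A i k) -> (forall i, \sum_k A i k = 1) ->
  (forall i k, 0 <= A' i k) -> (forall i, \sum_k A' i k = 1) ->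
  A *m A' = 1%:M -> `|\det (bary_lin A)| = 1.
Proof.
move=> A0 A1 A'0 A'1 AA'.
by case: (@reparam m.+1 1%:M (A *m 1%:M) A A' (fun=> 0) (@cst_continuous _ _ _) A0 A1 A'0 A'1 AA').
Qed.

End reparametrization.

Section edge_derivative.
Context {R : realType}.
Local Notation lam := (@lebesgue_rV R).

Lemma C1_grad_continuous n (f : 'rV[R]_n.+1 -> R) (v : 'rV[R]_n.+1) : C1 f ->
  continuous (fun x => dot (grad f x) v).
Proof.
move=> [_ cdf _]; rewrite (_ : (fun x => _) = fun x => \sum_i partial i f x * v ord0 i).
  by apply: continuous_sum => i x; apply: continuousM; [exact: cdf|exact: cst_continuous].
by apply/funext => x; apply: eq_bigr => i _; rewrite mxE.
Qed.

Lemma integral_line (n : nat) (f : 'rV[R]_n.+1 -> R) (P v : 'rV[R]_n.+1) (L : R) :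
  C1 f -> (0 <= L)%R ->
  (\int[@lebesgue_measure R]_(x in `[0%R, L]) (dot (grad f (P + x *: v)) v)%:E)%E =
  (f (P + L *: v) - f P)%:E.
Proof.
move=> C1f; have [cf _ df] := C1f; rewrite le_eqVlt => /predU1P[<-|L0].
  by rewrite set_itv1 integral_set1 scale0r addr0 subrr.
pose F (x : R) := f (P + x *: v).
have dF (x : R) : is_derive x (1 : R) F (dot (grad f (P + x *: v)) v).
  exact: is_derive_line.
have cl : continuous (fun x : R => P + x *: v).
  by move=> x; apply: cvgD; [exact: cvg_cst|apply: cvgZr_tmp; exact: cvg_id].
have cg : continuous (fun x : R => dot (grad f (P + x *: v)) v).
  move=> x; apply: (@continuous_comp _ _ _ (fun x : R => P + x *: v) (fun x => dot (grad f x) v)).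
    exact: cl.
  exact: C1_grad_continuous.
have cF : continuous F.
  by move=> x; apply: (@continuous_comp _ _ _ (fun x : R => P + x *: v)); [exact: cl|exact: cf].
rewrite (@continuous_FTC2 _ _ F _ _ L0).
- by rewrite /F scale0r addr0 EFinB.
- exact: continuous_subspaceT.
- split.
  + by move=> x _; case: (dF x).
  + by apply: cvg_at_right_filter; exact: cF.
  + by apply: cvg_at_left_filter; exact: cF.
- by move=> x _; rewrite derive1E; case: (dF x).
Qed.

(** Slice along the lines parallel to the edge and apply the fundamental theorem of calculus on
    each; the end points sweep the two facets opposite the ends of the edge. *)
Lemma simplex_int_edge m (n : nat) (W : 'M[R]_(m.+2, n.+1)) (f : 'rV[R]_n.+1 -> R) :
  C1 f ->
  simplex_int W (fun x => dot (grad f x) (row (lift ord0 ord0) W - row ord0 W)) =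
  simplex_int (row' ord0 W) f - simplex_int (row' (lift ord0 ord0) W) f.
Proof.
move=> C1f; have [cf _ _] := C1f.
set v := row (lift ord0 ord0) W - row ord0 W.
have cg := C1_grad_continuous (v := v) C1f.
rewrite /simplex_int -RintegralB; [|exact: measurable_ref_simplex|
  exact: simplex_int_integrable|exact: simplex_int_integrable].
rewrite Rintegral_mkcond [RHS]Rintegral_mkcond; congr fine.
have : (lam m.+1).-integrable setT ((EFin \o
    (fun s => dot (grad f (bary_ref s *m W)) v)) \_ (@ref_simplex R m.+1)).
  apply/integrable_restrict => //; first exact: measurable_ref_simplex.
  by rewrite setTI; exact: (simplex_int_integrable W cg).
rewrite restrict_EFin => /integral_cons ->.
apply: eq_integral => y _.
have [yS|yS] := pselect (ref_simplex y).
  rewrite [in RHS]patch_in// bary_ref_row'0 -/v.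
  have L0 : 0 <= 1 - \sum_i y ord0 i by case: yS => _; rewrite subr_ge0.
  rewrite -(integral_line _ _ C1f L0) [RHS]integral_mkcond.
  apply: eq_integral => x _.
  have [xL|xL] := pselect (`[0, 1 - \sum_i y ord0 i]%classic x).
    rewrite [in RHS]patch_in//= patch_in ?bary_ref_cons//.
    by apply/ref_simplex_cons; split => //; move: xL; rewrite /= in_itv.
  rewrite [in RHS]patch_out//= patch_out// => /ref_simplex_cons[_ ?].
  by apply: xL; rewrite /= in_itv.
rewrite [in RHS]patch_out// integral0_eq// => x _.
by rewrite /= patch_out// => /ref_simplex_cons[].
Qed.

End edge_derivative.

Section permutations.
Context {R : realType}.
Variables (m p : nat).

(** The permutation matrix of the bijection that [s] induces from the complement of [j] onto that of
    [s j]. *)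
Let perm_sub (s : 'S_m.+2) (j : 'I_m.+2) : 'M[R]_m.+1 :=
  \matrix_(i, k) (s (lift j i) == lift (s j) k)%:R.

Let perm_subP (s : 'S_m.+2) (j : 'I_m.+2) (i : 'I_m.+1) :
  exists k, s (lift j i) = lift (s j) k.
Proof.
have [k ->|/perm_inj/eqP] := unliftP (s j) (s (lift j i)); first by exists k.
by rewrite eq_sym (negbTE (neq_lift _ _)).
Qed.

Let sum_perm_sub (s : 'S_m.+2) (j : 'I_m.+2) (i : 'I_m.+1) (F : 'I_m.+1 -> R) k :
  s (lift j i) = lift (s j) k -> \sum_k' perm_sub s j i k' * F k' = F k.
Proof.
move=> sk; rewrite (bigD1 k)//= mxE sk eqxx mul1r big1 ?addr0// => k' k'k.
by rewrite mxE sk (inj_eq lift_inj) eq_sym (negbTE k'k) mul0r.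
Qed.

Lemma simplex_int_row'_perm (W : 'M[R]_(m.+2, p)) (s : 'S_m.+2) (j : 'I_m.+2)
    (f : 'rV[R]_p -> R) : continuous f ->
  simplex_int (row' j (row_perm s W)) f = simplex_int (row' (s j) W) f.
Proof.
move=> cf.
apply: (@simplex_int_reparam _ _ _ _ _ (perm_sub s j) (perm_sub (s^-1)%g (s j))) => //.
- by move=> i k; rewrite mxE ler0n.
- move=> i; have [k sk] := perm_subP s j i.
  by rewrite -(sum_perm_sub (fun=> 1) sk); apply: eq_bigr => k' _; rewrite mulr1.
- by move=> i k; rewrite mxE ler0n.
- move=> i; have [k sk] := perm_subP (s^-1)%g (s j) i.
  by rewrite -(sum_perm_sub (fun=> 1) sk); apply: eq_bigr => k' _; rewrite mulr1.
- apply/matrixP => i l; have [k sk] := perm_subP s j i.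
  rewrite mxE (sum_perm_sub (fun k => perm_sub (s^-1)%g (s j) k l) sk) !mxE -sk !permK.
  by rewrite (inj_eq lift_inj).
- apply/matrixP => i c; have [k sk] := perm_subP s j i.
  by rewrite [RHS]mxE (sum_perm_sub (fun k => row' (s j) W k c) sk) !mxE sk.
Qed.

Lemma simplex_int_perm (W : 'M[R]_(m.+1, p)) (s : 'S_m.+1) (f : 'rV[R]_p -> R) :
  continuous f -> simplex_int (row_perm s W) f = simplex_int W f.
Proof.
move=> cf.
have sum1 (t : 'S_m.+1) i : \sum_k (perm_mx t : 'M[R]_m.+1) i k = 1.
  rewrite (bigD1 (t i))//= !mxE eqxx big1 ?addr0// => k ki.
  by rewrite !mxE eq_sym (negbTE ki).
apply: (@simplex_int_reparam _ _ _ _ _ (perm_mx s) (perm_mx (s^-1)%g)) => //.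
- by move=> i k; rewrite !mxE ler0n.
- by move=> i k; rewrite !mxE ler0n.
- by rewrite -perm_mxM mulgV perm_mx1.
- exact: row_permE.
Qed.

End permutations.

Section simplex_volume.
Context {R : realType} {n : nat}.
Local Notation lam := (@lebesgue_rV R).
Implicit Types V : simplex R n.

Definition simplex_jac V : R := `|\det (bary_mx V)|.

Definition edge_mx V : 'M[R]_n.+1 :=
  \matrix_(i, k) (V (lift ord0 i) k - V ord0 k).

(** Subtracting the first row of [bary_mx V] from the others leaves a block triangular matrix with
    the edges in its lower right corner. *)
Lemma det_edge_mx V : \det (edge_mx V) = \det (bary_mx V).
Proof.
have E : (block_mx 1%:M 0 (const_mx (-1)) 1%:M : 'M[R]_(1 + n.+1)) *m bary_mx V =
    block_mx 1%:M (row ord0 V) 0 (edge_mx V) :> 'M[R]_(1 + n.+1).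
  apply/matrixP => i k; rewrite mxE big_ord_recl.
  have bE (a : 'I_n.+2) : bary_mx V a ord0 = 1 /\
      forall c, bary_mx V a (lift ord0 c) = V a c.
    split.
      transitivity (bary_mx V a (lshift n.+1 (ord0 : 'I_1))); first by congr (_ _ _); exact/val_inj.
      transitivity ((const_mx 1 : 'cV[R]_n.+2) a ord0); last by rewrite mxE.
      exact (@row_mxEl R n.+2 1 n.+1 (const_mx 1) V a ord0).
    move=> c; transitivity (bary_mx V a (rshift 1 c)); first by congr (_ _ _); exact/val_inj.
    exact (@row_mxEr R n.+2 1 n.+1 (const_mx 1) V a c).
  have l0 : lshift n.+1 (ord0 : 'I_1) = ord0 :> 'I_n.+2 by exact/val_inj.
  have r0 c : rshift 1 c = lift ord0 c :> 'I_n.+2 by exact/val_inj.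
  have bL (A : 'M[R]_1) (B : 'rV[R]_n.+1) (C : 'cV[R]_n.+1) (D : 'M[R]_n.+1) :
     let M := (block_mx A B C D : 'M[R]_(1 + n.+1)) in
     [/\ M ord0 ord0 = A ord0 ord0, forall c, M ord0 (lift ord0 c) = B ord0 c,
      forall r, M (lift ord0 r) ord0 = C r ord0 &
      forall r c, M (lift ord0 r) (lift ord0 c) = D r c].
    split=> [|c|r|r c]; rewrite -?r0 -?l0.
    - exact: block_mxEul.
    - exact: block_mxEur.
    - exact: block_mxEdl.
    - exact: block_mxEdr.
  have [L00 L0c Lr0 Lrc] := bL 1%:M 0 (const_mx (-1)) 1%:M.
  have [M00 M0c Mr0 Mrc] := bL 1%:M (row ord0 V) 0 (edge_mx V).
  have e11 p (r : 'I_p) : (1%:M : 'M[R]_p) r r = 1 by rewrite mxE eqxx.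
  have [r ->|->] := unliftP ord0 i.
    rewrite Lr0 mxE; under eq_bigr do rewrite Lrc.
    rewrite (bigD1 r)//= big1 ?addr0; last first.
      by move=> c cr; rewrite mxE eq_sym (negbTE cr) mul0r.
    rewrite e11 mul1r mulN1r.
    have [c ->|->] := unliftP ord0 k.
      by rewrite Mrc !(bE _).2 [RHS]mxE addrC.
    by rewrite Mr0 !(bE _).1 [RHS]mxE addNr.
  rewrite L00 e11 mul1r; under eq_bigr do rewrite L0c mxE mul0r.
  rewrite big1_eq addr0.
  have [c ->|->] := unliftP ord0 k.
    by rewrite M0c (bE _).2 [RHS]mxE.
  by rewrite M00 (bE _).1 e11.
have := congr1 determinant E.
by rewrite det_mulmx det_lblock det_ublock !det1 !mul1r => ->.
Qed.

Lemma bary_ref_edge V (s : 'rV[R]_n.+1) : bary_ref s *m V = s *m edge_mx V + row ord0 V.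
Proof.
apply/rowP => k; rewrite !mxE big_ord_recl bary_ref0 mulrBl mul1r mulr_suml -addrA addrC.
congr (_ + _); rewrite -sumrN -big_split/=; apply: eq_bigr => i _.
by rewrite bary_refS mxE; ring.
Qed.

Lemma bary_mx_perm V (s : 'S_n.+2) : bary_mx (row_perm s V) = row_perm s (bary_mx V).
Proof.
rewrite !row_permE /bary_mx.
have cE : perm_mx s *m (const_mx 1 : 'cV[R]_n.+2) = const_mx 1.
  by rewrite -row_permE; apply/matrixP => i j; rewrite !mxE.
rewrite -{1}cE.
exact (esym (@mul_mx_row R n.+2 n.+2 1 n.+1 (perm_mx s) _ V)).
Qed.

Lemma simplex_jac_perm V (s : 'S_n.+2) : simplex_jac (row_perm s V) = simplex_jac V.
Proof.
rewrite /simplex_jac bary_mx_perm.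
by rewrite row_permE det_mulmx det_perm normrM normr_sign mul1r.
Qed.

Section nondegenerate.
Variable V : simplex R n.
Hypothesis hV : nondegenerate_simplex V.

Lemma simplex_jac_gt0 : 0 < simplex_jac V.
Proof. by rewrite normr_gt0 -unitfE -unitmxE. Qed.

Lemma hull_bary_ref (s : 'rV[R]_n.+1) : hull V (bary_ref s *m V) <-> ref_simplex s.
Proof. by rewrite hullP// baryK ?sum_bary_ref// ref_simplexP. Qed.

Lemma compact_hull : compact (hull V).
Proof.
have -> : hull V = (fun s => bary_ref s *m V) @` (@ref_simplex R n.+1).
  apply/seteqP; split => x; last by move=> [s hs <-]; apply/hull_bary_ref.
  move=> /(hullP hV) h.
  have E : bary_ref (\row_i bary V x ord0 (lift ord0 i)) = bary V x.
    apply/rowP => i; have [k ->|->] := unliftP ord0 i; first by rewrite bary_refS mxE.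
    rewrite bary_ref0 -(sum_bary hV x) big_ord_recl.
    by under [X in _ - X]eq_bigr do rewrite mxE; rewrite addrK.
  exists (\row_i bary V x ord0 (lift ord0 i)); last by rewrite E bary_mul.
  by apply/ref_simplexP => i; rewrite E.
apply: continuous_compact; last exact: compact_ref_simplex.
apply: continuous_subspaceT; apply: continuous_rV => i; exact: continuous_bary_ref_mul.
Qed.

Lemma measurable_hull : measurable (hull V).
Proof. apply: closed_measurable_rV; exact: closed_hull. Qed.

Lemma integral_hull (f : 'rV[R]_n.+1 -> R) : continuous f ->
  integ (hull V) f = simplex_jac V * simplex_int V f.
Proof.
move=> cf.
have : (lam n.+1).-integrable setT ((EFin \o f) \_ (hull V)).
  apply/integrable_restrict => //; first exact: measurable_hull.
  by rewrite setTI; apply: compact_integrable => //; exact: compact_hull.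
rewrite restrict_EFin => /integral_affine H.
have uE : edge_mx V \in unitmx by rewrite unitmxE det_edge_mx -unitmxE.
rewrite /integ [LHS]Rintegral_mkcond.
have := H _ (row ord0 V) uE; rewrite det_edge_mx -/(simplex_jac V).
move=> /(congr1 ( *%R (simplex_jac V))).
rewrite mulrA mulfV ?mul1r ?lt0r_neq0 ?simplex_jac_gt0// => <-.
congr (_ * _); rewrite /simplex_int [RHS]Rintegral_mkcond; apply: eq_Rintegral => s _.
rewrite -bary_ref_edge; have [hs|hs] := pselect (ref_simplex s).
  by rewrite !patch_in//; apply/hull_bary_ref.
by rewrite !patch_out// => /hull_bary_ref.
Qed.

Lemma lebesgue_hull : lam n.+1 (hull V) = (simplex_jac V * @ref_vol R n.+1)%:E.
Proof.
have := @integral_hull (fun=> 1) (@cst_continuous _ _ _).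
rewrite /integ /simplex_int !Rintegral_cst; [|exact: measurable_ref_simplex|exact: measurable_hull].
rewrite !mul1r => <-; rewrite fineK// ge0_fin_numE//.
apply: bounded_lebesgue_lty; first exact: measurable_hull.
exact/compact_bounded/compact_hull.
Qed.

End nondegenerate.
End simplex_volume.

Lemma Rintegral_fsum d (T : measurableType d) (R : realType)
    (mu : {measure set T -> \bar R}) (D : set T) (I : Type) (r : seq I)
    (F : I -> T -> R) : measurable D ->
  (forall i, mu.-integrable D (EFin \o F i)) ->
  mu.-integrable D (EFin \o (fun x => \sum_(i <- r) F i x)) /\
  (\int[mu]_(x in D) (\sum_(i <- r) F i x) = \sum_(i <- r) \int[mu]_(x in D) F i x)%R.
Proof.
move=> mD iF; elim: r => [|i r [IH1 IH2]].
  rewrite big_nil; under eq_Rintegral do rewrite big_nil.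
  rewrite (_ : _ \o _ = cst 0%E); last by apply/funext => x /=; rewrite big_nil.
  split; first exact: integrable0.
  by rewrite /Rintegral integral0.
rewrite big_cons (_ : EFin \o _ = (EFin \o F i) \+ (EFin \o (fun x => (\sum_(i <- r) F i x)%R)))%E.
  split; first exact: integrableD.
  under eq_Rintegral do rewrite big_cons.
  by rewrite RintegralD// IH2.
by apply/funext => x /=; rewrite big_cons EFinD.
Qed.

Lemma mulmx_tr_dot (R : realType) n (a b : 'rV[R]_n) : (a *m b^T) ord0 ord0 = dot a b.
Proof. by rewrite mxE; apply: eq_bigr => i _; rewrite mxE. Qed.

(** * Green's formula on one simplex *)

Section green.
Context {R : realType} {n : nat}.
Local Notation lam := (@lebesgue_rV R).
Variable V : simplex R n.
Hypothesis hV : nondegenerate_simplex V.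



(** A transposition of the vertices moves [a] to position 1, where the formula along an edge
    applies. *)
Lemma simplex_int_edge_from0 (a : 'I_n.+2) (f : 'rV[R]_n.+1 -> R) : C1 f ->
  simplex_int V (fun x => dot (grad f x) (row a V - row ord0 V)) =
  simplex_int (row' ord0 V) f - simplex_int (row' a V) f.
Proof.
move=> C1f; have [cf _ _] := C1f.
have [k ->|->] := unliftP ord0 a; last first.
  rewrite !subrr /simplex_int; under eq_Rintegral do rewrite dot0r.
  by rewrite Rintegral_cst ?mul0r//; exact: measurable_ref_simplex.
pose s : 'S_n.+2 := tperm (lift ord0 ord0) (lift ord0 k).
have s0 : s ord0 = ord0 by rewrite tpermD// eq_sym neq_lift.
have s1 : s (lift ord0 ord0) = lift ord0 k by rewrite tpermL.
have := simplex_int_edge (row_perm s V) C1f.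
rewrite !simplex_int_row'_perm// s0 s1 => <-.
have rE i : row i (row_perm s V) = row (s i) V by apply/rowP => c; rewrite !mxE.
by rewrite !rE s0 s1 simplex_int_perm//; exact: C1_grad_continuous.
Qed.

(** Expand [v] along the edges issued from vertex 0. Each edge contributes the facet integral
    opposite vertex 0 minus another one, and the former cancel because the coefficients sum to
    zero. *)
Lemma green_simplex (f : 'rV[R]_n.+1 -> R) (v : 'rV[R]_n.+1) : C1 f ->
  integ (hull V) (fun x => dot (grad f x) v) =
  - simplex_jac V * \sum_j dot (bary_grad V j) v * simplex_int (row' j V) f.
Proof.
move=> C1f; have [cf _ _] := C1f.
rewrite integral_hull//; last exact: C1_grad_continuous.
rewrite mulNr -mulrN; congr (_ * _).
have vE : v = \sum_a dot (bary_grad V a) v *: (row a V - row ord0 V).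
  under eq_bigr do rewrite scalerBr.
  by rewrite sumrB -scaler_suml sum_bary_grad// scale0r subr0 -bary_grad_decomp.
transitivity (\sum_a dot (bary_grad V a) v *
    simplex_int V (fun x => dot (grad f x) (row a V - row ord0 V))).
  rewrite {1}vE /simplex_int.
  under eq_Rintegral do rewrite dot_sumr.
  have I a : (lam n.+1).-integrable (@ref_simplex R n.+1) (EFin \o (fun s =>
      dot (grad f (bary_ref s *m V)) (dot (bary_grad V a) v *: (row a V - row ord0 V)))).
    apply: (@simplex_int_integrable R _ _ V (fun x => dot (grad f x)
      (dot (bary_grad V a) v *: (row a V - row ord0 V)))).
    exact: C1_grad_continuous.
  rewrite (Rintegral_fsum _ (@measurable_ref_simplex R _) I).2.
  apply: eq_bigr => a _; rewrite -RintegralZl; last 2 first.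
  - exact: measurable_ref_simplex.
  - apply: (@simplex_int_integrable R _ _ V (fun x => dot (grad f x) (row a V - row ord0 V))).
    exact: C1_grad_continuous.
  by apply: eq_Rintegral => s _; rewrite dotZr.
under eq_bigr do rewrite simplex_int_edge_from0// mulrBr.
by rewrite sumrB -mulr_suml sum_bary_grad// mul0r sub0r.
Qed.

(** Volume is base times height, the height over facet [j] being 1 / |grad lambda_j|. The square
    root of a Gram determinant is identified by computing one determinant in two ways. *)
Lemma facet_jacE j : facet_jac V j = simplex_jac V * enorm (bary_grad V j).
Proof.
(* Lists vertex [j] first and the vertices of the facet after it in their order, so that [edge_mx]
   becomes a shear times [Z]. *)
pose s : 'S_n.+2 := lift_perm ord0 j 1%g.
have s0 : s ord0 = j by rewrite lift_perm_id.
have sl k : s (lift ord0 k) = lift j k by rewrite lift_perm_lift perm1.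
pose w : 'rV[R]_n.+1 := row j V - row (lift j ord0) V.
pose E := facet_edges V j.
pose Z : 'M[R]_(1 + n) := col_mx (- w) E.
have ZE : edge_mx (row_perm s V) = (block_mx 1%:M 0 (const_mx 1) 1%:M : 'M[R]_(1 + n)) *m Z.
  rewrite /Z (@mul_block_col _ 1 n 1 n n.+1) mul0mx !mul1mx addr0.
  apply/matrixP => i c; rewrite [LHS]mxE.
  have rpE a : row_perm s V a c = V (s a) c by rewrite mxE.
  rewrite !rpE s0 sl; have [k ->|->] := unliftP ord0 i.
    transitivity (col_mx (- w) (const_mx 1 *m - w + E) (rshift 1 k) c); last first.
      by congr (_ _ _); exact/val_inj.
    rewrite col_mxEd !mxE big_ord1 !mxE mul1r.
    by ring.
  transitivity (col_mx (- w) (const_mx 1 *m - w + E) (lshift n (ord0 : 'I_1)) c); last first.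
    by congr (_ _ _); exact/val_inj.
  by rewrite col_mxEu !mxE; ring.
have dZ : `|\det Z| = simplex_jac V.
  rewrite -(simplex_jac_perm V s) /simplex_jac -det_edge_mx ZE.
  have -> : \det ((block_mx 1%:M 0 (const_mx 1) 1%:M : 'M[R]_(1 + n)) *m Z) =
      \det (block_mx 1%:M 0 (const_mx 1) 1%:M : 'M[R]_(1 + n)) * \det Z.
    exact: det_mulmx.
  have -> : \det (block_mx 1%:M 0 (const_mx 1) 1%:M : 'M[R]_(1 + n)) = 1.
    by rewrite det_lblock !det1 mul1r.
  by rewrite mul1r.
have gE : E *m (bary_grad V j)^T = 0.
  apply/matrixP => i c; rewrite !mxE ord1.
  have := dot_bary_grad_edge hV (lift j (lift ord0 i)) (lift j ord0) j.
  rewrite !(eq_sym _ j) !(negbTE (neq_lift _ _)) subrr => h; apply: etrans h.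
  by apply: eq_bigr => k _; rewrite !mxE mulrC.
have gw : w *m (bary_grad V j)^T = 1%:M.
  apply/matrixP => i c; rewrite !ord1 !mxE eqxx.
  have := dot_bary_grad_edge hV j (lift j ord0) j.
  rewrite eqxx !(eq_sym _ j) (negbTE (neq_lift _ _)) subr0 => h; apply: etrans h.
  by apply: eq_bigr => k _; rewrite !mxE mulrC.
(* The gradient is orthogonal to the edges of the facet and has product 1 with [w]: the matrix is
   block triangular with corner -1. *)
have d1 : \det (Z *m row_mx (bary_grad V j)^T E^T) = - \det (E *m E^T).
  rewrite mul_col_row gE mulNmx gw det_ublock.
  by rewrite (_ : - 1%:M = (-1)%:M) ?det_scalar1 ?mulN1r// raddfN.
have uZ : Z \in unitmx.
  by rewrite unitmxE unitfE -normr_gt0 dZ simplex_jac_gt0.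
(* Expand the gradient on the rows of [Z]; pairing the expansion with the gradient itself shows that
   the coefficient of the first row is minus its squared norm. *)
have d2 : \det (row_mx (bary_grad V j)^T E^T) = - (enorm (bary_grad V j)) ^+ 2 * \det Z.
  pose c : 'rV[R]_(1 + n) := bary_grad V j *m invmx Z.
  have cZ : bary_grad V j = lsubmx c *m - w + rsubmx c *m E.
    by rewrite -(@mul_row_col _ 1 1 n n.+1) hsubmxK mulmxKV.
  have -> : row_mx (bary_grad V j)^T E^T = (col_mx (bary_grad V j) E)^T :> 'M[R]_(1 + n).
    by rewrite tr_col_mx.
  rewrite det_tr.
  have -> : col_mx (bary_grad V j) E = block_mx (lsubmx c) (rsubmx c) 0 1%:M *m Z :> 'M[R]_(1 + n).
    by rewrite /Z (@mul_block_col _ 1 n 1 n n.+1) mul0mx mul1mx add0r -cZ.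
  have -> : \det ((block_mx (lsubmx c) (rsubmx c) 0 1%:M : 'M[R]_(1 + n)) *m Z) =
      \det (block_mx (lsubmx c) (rsubmx c) 0 1%:M : 'M[R]_(1 + n)) * \det Z.
    exact: det_mulmx.
  rewrite [X in X * _]det_ublock det1 mulr1; congr (_ * _).
  rewrite det_mx11.
  have := congr1 (fun u => (u *m (bary_grad V j)^T) ord0 ord0) cZ.
  rewrite mulmxDl -!mulmxA gE mulmx0 addr0 mulNmx gw mulmxN mulmx1.
  rewrite enorm_sqr => h; apply: oppr_inj; rewrite opprK; move: h.
  rewrite [in X in _ = X -> _]mxE => <-.
  exact: mulmx_tr_dot.
have : \det (E *m E^T) = (simplex_jac V * enorm (bary_grad V j)) ^+ 2.
  have dM : \det (Z *m row_mx (bary_grad V j)^T E^T) =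
    \det Z * \det (row_mx (bary_grad V j)^T E^T : 'M[R]_(1 + n)) by exact: det_mulmx.
  move: d1; rewrite dM d2 => h; apply: oppr_inj; rewrite -h exprMn -dZ real_normK ?num_real//.
  ring.
rewrite /facet_jac => ->; rewrite sqrtr_sqr ger0_norm// mulr_ge0 ?enorm_ge0// ltW//.
exact: simplex_jac_gt0.
Qed.

Lemma facet_paramE j s : facet_param V j s = bary_ref s *m row' j V.
Proof.
rewrite /facet_param; apply/rowP => k; rewrite !mxE big_ord_recl bary_ref0 mxE.
rewrite mulrBl mul1r mulr_suml -addrA; congr (_ + _); rewrite addrC -sumrB.
by apply: eq_bigr => i _; rewrite bary_refS !mxE; ring.
Qed.

Lemma facet_intE j f : facet_int V j f = facet_jac V j * simplex_int (row' j V) f.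
Proof.
by congr (_ * _); apply: eq_Rintegral => s _; rewrite facet_paramE.
Qed.

(** Surface Jacobian times unit normal is free of square roots; this turns the barycentric form of
    Green's formula into the one with outer normals. *)
Lemma facet_jac_normal j v :
  facet_jac V j * dot (outer_normal V j) v = - simplex_jac V * dot (bary_grad V j) v.
Proof.
rewrite facet_jacE /outer_normal dotZl !mulNr mulrN; congr (- _).
rewrite -mulrA; congr (_ * _); rewrite mulrA mulfV ?mul1r//.
exact: lt0r_neq0 (enorm_bary_grad_gt0 hV j).
Qed.

Lemma green_simplex_normal (f : 'rV[R]_n.+1 -> R) (v : 'rV[R]_n.+1) : C1 f ->
  integ (hull V) (fun x => dot (grad f x) v) =
  \sum_j dot (outer_normal V j) v * facet_int V j f.
Proof.
move=> C1f; rewrite green_simplex// mulr_sumr; apply: eq_bigr => j _.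
by rewrite facet_intE [LHS]mulrA -facet_jac_normal; ring.
Qed.

End green.

Lemma bigcup_null d (T : measurableType d) (R : realType)
    (mu : {measure set T -> \bar R}) (I : finType) (F : I -> set T) :
  (forall i, measurable (F i)) -> (forall i, mu (F i) = 0%E) ->
  measurable (\bigcup_(i in [set: I]) F i) /\ mu (\bigcup_(i in [set: I]) F i) = 0%E.
Proof.
move=> mF F0.
have -> : \bigcup_(i in [set: I]) F i = \big[setU/set0]_(i <- enum I) F i.
  by rewrite -bigcup_seq; apply: eq_bigcupl; split => i _ //=; rewrite mem_enum.
elim: (enum I) => [|i r [mU U0]]; first by rewrite big_nil.
by rewrite big_cons; split; [exact: measurableU|rewrite measureU0].
Qed.

(** * Geometry of conforming meshes *)

Section lipschitz_domain.
Context {R : realType} {n : nat}.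
Implicit Types D U : set 'rV[R]_n.+1.

Lemma lipschitz_continuous m (phi : 'rV[R]_m -> R) (L : R) :
  (forall a b, `|phi a - phi b| <= L * enorm (a - b)) -> continuous phi.
Proof.
move=> hphi b; apply/(@cvgrPdist_lt _ _ _ (nbhs b) (nbhs_filter b)) => e e0.
have L0 : 0 < `|L| + 1 by rewrite ltr_wpDl.
have : \forall z \near b, enorm (b - z) < e / (`|L| + 1).
  have c : {for b, continuous (fun z : 'rV[R]_m => enorm ((b : 'rV[R]_m) - z))}.
    apply: (@continuous_comp _ _ _ (fun z : 'rV[R]_m => (b : 'rV[R]_m) - z) (@enorm R m)); last exact: continuous_enorm.
    by apply: continuousB; [exact: cst_continuous|exact: cvg_id].
  have /cvgrPdist_lt/(_ _ (divr_gt0 e0 L0)) := c.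
  apply: filterS => z; rewrite subrr (_ : enorm 0 = 0); last by apply/eqP; rewrite enorm_eq0.
  by rewrite sub0r normrN ger0_norm// enorm_ge0.
apply: filterS => z hz; apply: (le_lt_trans (hphi b z)).
rewrite ltr_pdivlMr// in hz; apply: le_lt_trans hz.
rewrite [leRHS]mulrC ler_wpM2r ?enorm_ge0//.
by rewrite (le_trans (ler_norm L))// lerDl.
Qed.

Lemma continuous_mulmx_coord m p (A : 'M[R]_(m, p)) (i : 'I_p) :
  continuous (fun x : 'rV[R]_m => (x *m A) ord0 i).
Proof.
under eq_fun do rewrite mxE.
apply: continuous_sum => j x; apply: continuousM; last exact: cst_continuous.
exact: continuous_coord.
Qed.

(* Below the graph, points near the boundary are outside D. *)
Lemma open_sub_closure D U : open D -> lipschitz_boundary D -> open U ->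
  U `<=` closure D -> U `<=` D.
Proof.
move=> oD lipD oU UD x Ux; apply: contrapT => Dx.
have : boundary D x by split; [exact: UD|move=> /interior_subset].
move=> /lipD[Q [phi [L [r [QQ r0 hphi hD]]]]].
(* The signed height above the graph: near [x], membership in [D] is positivity of [a]. *)
pose a (y : 'rV[R]_n.+1) := (y *m Q) ord0 ord0 -
  phi (\row_j (y *m Q) ord0 (lift ord0 j)).
have ca : continuous a.
  move=> y; apply: continuousB; first exact: continuous_mulmx_coord.
  apply: (@continuous_comp _ _ _ (fun y : 'rV[R]_n.+1 => \row_j (y *m Q) ord0 (lift ord0 j)) phi).
    apply: continuous_rV => i; under eq_fun do rewrite mxE.
    exact: continuous_mulmx_coord.
  exact: (lipschitz_continuous hphi).
have hDa y : enorm (y - x) < r -> (D y <-> 0 < a y) by rewrite subr_gt0; exact: hD.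
have ax : a x <= 0.
  rewrite leNgt; apply/negP => /hDa ax0; apply: Dx; apply/ax0.
  by rewrite subrr (_ : enorm 0 = 0)//; apply/eqP; rewrite enorm_eq0.
(* The vertical direction of the rotated coordinates. Going down from [x] inside [U] reaches a point
   strictly below the graph, all of whose neighbors are outside [D], although it lies in the
   closure. *)
pose d : 'rV[R]_n.+1 := delta_mx ord0 ord0 *m Q^T.
have dQ : d *m Q = delta_mx ord0 ord0 by rewrite -mulmxA (mulmx1C QQ) mulmx1.
have ad e : a (x + (- e) *: d) = a x - e.
  rewrite /a mulmxDl -scalemxAl dQ.
  have -> : \row_j (x *m Q + - e *: delta_mx ord0 ord0) ord0 (lift ord0 j) =
      \row_j (x *m Q) ord0 (lift ord0 j).
    by apply/rowP => j; rewrite !mxE !eqxx/= mulr0 addr0.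
  have hm (A B : 'rV[R]_n.+1) i : (A + - e *: B) ord0 i = A ord0 i - e * B ord0 i.
    by rewrite !mxE mulNr.
  by rewrite hm [X in e * X]mxE !eqxx mulr1; ring.
have cl : continuous (fun e : R => x + (- e) *: d).
  move=> e; apply: cvgD; first exact: cvg_cst.
  by apply: cvgZr_tmp; apply: cvgN; exact: cvg_id.
have cen : continuous (fun y : 'rV[R]_n.+1 => enorm (y - x)).
  move=> y; apply: (@continuous_comp _ _ _ (fun y : 'rV[R]_n.+1 => y - x) (@enorm R n.+1)); last exact: continuous_enorm.
  by apply: continuousB; [exact: cvg_id|exact: cst_continuous].
have en0 : enorm (x - x) < r by rewrite subrr (_ : enorm 0 = 0)//; apply/eqP; rewrite enorm_eq0.
have nearr y : enorm (y - x) < r -> \forall z \near y, enorm (z - x) < r.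
  by move=> hy; exact: (cen y _ (open_nbhs_nbhs (conj (@open_lt R r) hy))).
have x0E : x + (- 0) *: d = x by rewrite oppr0 scale0r addr0.
have : \forall e \near (0 : R), U (x + (- e) *: d) /\ enorm (x + (- e) *: d - x) < r.
  have := cl 0; rewrite /continuous_at x0E => c0; apply: filterI.
    by apply: c0; exact: open_nbhs_nbhs.
  by have := c0 _ (nearr _ en0).
move=> /nbhs_ballP[s /= s0 hs].
have [] := hs (s / 2); first by rewrite /ball/= sub0r normrN gtr0_norm ?divr_gt0// ltr_pdivrMr// ltr_pMr// ltr1n.
set y := x + _; move=> Uy yr.
have ay : a y < 0 by rewrite /y ad subr_lt0 (le_lt_trans ax)// divr_gt0.
have [z [Dz [az zr]]] : exists z, D z /\ (a z < 0 /\ enorm (z - x) < r).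
  have := UD _ Uy [set z | a z < 0 /\ enorm (z - x) < r]; case.
    apply: filterI; last exact: nearr.
    exact: (ca y _ (open_nbhs_nbhs (conj (@open_lt R 0) ay))).
  by move=> z [Dz h]; exists z.
by have := (hDa z zr).1 Dz; rewrite ltNge (ltW az).
Qed.

End lipschitz_domain.

Section simplex_geometry.
Context {R : realType} {n : nat}.
Implicit Types V : simplex R n.

Definition open_hull V : set 'rV[R]_n.+1 := [set x | forall j, 0 < bary V x ord0 j].

(** Whole hyperplanes instead of facets, so that nullity is immediate; a point of the hull off these
    planes is in the open simplex. *)
Definition facet_planes V : set 'rV[R]_n.+1 :=
  \bigcup_(j in [set: 'I_n.+2]) [set x | bary V x ord0 j = 0].

Section one_simplex.
Variable V : simplex R n.
Hypothesis hV : nondegenerate_simplex V.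

Lemma open_open_hull : open (open_hull V).
Proof.
rewrite openE => x x0; rewrite /interior.
apply: (filter_forall (F := nbhs x) (f := fun (j : 'I_n.+2) t => 0 < bary V t ord0 j)) => j.
exact: (polyfun_continuous (polyfun_bary V j) (open_nbhs_nbhs (conj (@open_gt R 0) (x0 j)))).
Qed.

Lemma open_hull_sub : open_hull V `<=` hull V.
Proof. by move=> x h; apply/hullP => // j; exact: ltW. Qed.

Lemma hull_open_hull x : hull V x -> ~ facet_planes V x -> open_hull V x.
Proof.
move=> /(hullP hV) h hn j; rewrite lt_neqAle h andbT; apply/eqP => xj.
by apply: hn; exists j.
Qed.

Lemma measurable_facet_planes : measurable (facet_planes V).
Proof.
apply: fin_bigcup_measurable; first exact: finite_finset.
move=> j _; apply: closed_measurable_rV.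
apply: (@preimage_closed _ _ (fun x => bary V x ord0 j) [set (0 : R)]).
  by move=> x _; exact: (polyfun_continuous (polyfun_bary V j)).
exact: closed_eq.
Qed.

Lemma lebesgue_facet_planes : lebesgue_rV n.+1 (facet_planes V) = 0%E.
Proof.
have mF j : measurable [set x | bary V x ord0 j = 0].
  apply: closed_measurable_rV.
  apply: (@preimage_closed _ _ (fun x => bary V x ord0 j) [set (0 : R)]).
    by move=> x _; exact: (polyfun_continuous (polyfun_bary V j)).
  exact: closed_eq.
apply: (bigcup_null mF _).2 => j.
have -> : [set x | bary V x ord0 j = 0] = [set x | dot (bary_grad V j) x = - bary V 0 ord0 j].
  apply/seteqP; split => x /=; rewrite (bary_affine V x).
    by move=> /eqP; rewrite addrC addr_eq0 => /eqP.
  by move=> ->; rewrite subrr.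
by apply: lebesgue_hyperplane; exact: bary_grad_neq0.
Qed.

Lemma bary_comb V' (hV' : nondegenerate_simplex V') j x :
  bary V x ord0 j = \sum_i bary V' x ord0 i * bary V (row i V') ord0 j.
Proof.
rewrite bary_affine// -{1}(bary_mul hV' x) mulmx_sum_row dot_sumr.
under eq_bigr do rewrite dotZr.
rewrite -[X in X + _]mul1r -(sum_bary hV' x) mulr_suml -big_split/=.
by apply: eq_bigr => i _; rewrite -mulrDr -bary_affine.
Qed.

End one_simplex.

Section two_simplices.
Variables V V' : simplex R n.
Hypotheses (hV : nondegenerate_simplex V) (hV' : nondegenerate_simplex V').

(** An affine function that vanishes at every vertex but [j] is a multiple of the [j]-th coordinate,
    and the multiple is nonzero because the function takes the value 1 at vertex [j'] of [V']. *)
Lemma bary_proportional j j' : (forall i, i != j -> bary V' (row i V) ord0 j' = 0) ->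
  let c := bary V' (row j V) ord0 j' in
  c != 0 /\ forall x, bary V' x ord0 j' = c * bary V x ord0 j.
Proof.
move=> h c.
have E x : bary V' x ord0 j' = c * bary V x ord0 j.
  rewrite (bary_comb V' hV) (bigD1 j)//= big1 ?addr0 1?mulrC// => i ij.
  by rewrite h// mulr0.
split => //; apply/eqP => c0; have := E (row j' V').
by rewrite bary_vertex// eqxx c0 mul0r => /eqP; rewrite oner_eq0.
Qed.

Lemma bary_same_facet j j' : facet V j = facet V' j' ->
  exists2 c, c != 0 & forall x, bary V' x ord0 j' = c * bary V x ord0 j.
Proof.
move=> fE; have [|c0 E] := @bary_proportional j j'.
  move=> i ij; suff : facet V' j' (row i V) by move=> /(facetP hV')[].
  by rewrite -fE; apply/facetP => //; split; [exact: hull_vertex|rewrite bary_vertex// (negbTE ij)].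
by exists (bary V' (row j V) ord0 j').
Qed.

Lemma bary_grad_proportional j j' c :
  (forall x, bary V' x ord0 j' = c * bary V x ord0 j) ->
  bary_grad V' j' = c *: bary_grad V j.
Proof.
move=> E; apply/rowP => i.
have := E (0 + 1 *: delta_mx ord0 i); rewrite !bary_line// !mul1r mulrDr -E !dot_delta.
by move=> /addrI ->; rewrite [RHS]mxE.
Qed.

Lemma outer_normal_opp j j' c : c < 0 ->
  (forall x, bary V' x ord0 j' = c * bary V x ord0 j) ->
  outer_normal V' j' = - outer_normal V j.
Proof.
move=> c0 /bary_grad_proportional gE.
rewrite /outer_normal gE enormZ ltr0_norm// invfM scalerA scaleNr opprK -scaleNr.
congr (_ *: _); rewrite invrN mulrAC; field.
by rewrite (ltr0_neq0 c0) andbT lt0r_neq0// enorm_bary_grad_gt0.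
Qed.

End two_simplices.

Lemma facet_inj V (hV : nondegenerate_simplex V) j j' : facet V j = facet V j' -> j = j'.
Proof.
move=> /(bary_same_facet hV hV)[c c0 E]; have := E (row j' V); rewrite !bary_vertex// eqxx.
have [//|_] := eqVneq j j'.
have [->//|_] := eqVneq j' j; rewrite mulr0 => /eqP; by rewrite oner_eq0.
Qed.

Definition facet_center V (j : 'I_n.+2) : 'rV[R]_n.+1 :=
  (\row_i (if i == j then 0 else n.+1%:R^-1)) *m V.

Lemma bary_facet_center V (hV : nondegenerate_simplex V) j i :
  bary V (facet_center V j) ord0 i = if i == j then 0 else n.+1%:R^-1.
Proof.
rewrite baryK//; first by rewrite mxE.
under eq_bigr do rewrite mxE.
rewrite (bigD1 j)//= eqxx add0r (eq_bigr (fun=> n.+1%:R^-1)).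
  by rewrite sumr_const cardC1 card_ord -[LHS]mulr_natr mulVf// pnatr_eq0.
by move=> k /negbTE ->.
Qed.

Lemma near0_gt0 (a b : R) : 0 < a -> \forall e \near 0^'+, 0 < a + e * b.
Proof.
move=> a0.
have c : {for 0, continuous (fun e : R => a + e * b)}.
  by apply: continuousD; [exact: cst_continuous|apply: continuousM; [exact: cvg_id|exact: cst_continuous]].
have h : (fun e : R => a + e * b) e @[e --> 0^'+] --> a + 0 * b.
  exact: cvg_at_right_filter.
apply: (h [set y | 0 < y]); rewrite mul0r addr0.
exact: (open_nbhs_nbhs (conj (@open_gt R 0) a0)).
Qed.

End simplex_geometry.

(** * Adjacency of elements in a conforming mesh *)

Section mesh_topology.
Context {R : realType} {n : nat}.
Variables (D : set 'rV[R]_n.+1) (T : mesh R n).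
Hypotheses (oD : open D) (lipD : lipschitz_boundary D)
  (hT : conforming_triangulation D T).
Implicit Types (k l : 'I_(nelt T)) (j : 'I_n.+2).

Let ndT k : nondegenerate_simplex (T k).
Proof. by case: hT. Qed.

Lemma mesh_hull_sub k : hull (T k) `<=` closure D.
Proof. by case: hT => _ <- _ x hx; exists k. Qed.

Lemma mesh_open_hull_sub k : open_hull (T k) `<=` D.
Proof.
apply: (open_sub_closure oD lipD); first exact: open_open_hull.
by move=> x /open_hull_sub/mesh_hull_sub; apply.
Qed.

Lemma mesh_cover x : D x -> exists k, hull (T k) x.
Proof.
move=> Dx; have : closure D x by exact: subset_closure.
by case: hT => _ <- _ [k _ hx]; exists k.
Qed.

Lemma mesh_overlap k l x : k <> l -> hull (T k) x -> hull (T l) x ->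
  facet_planes (T k) x.
Proof.
move=> kl hk hl; case: hT => _ _ /(_ k l kl)[A [B [[j Aj] fA _]]].
have : face (T k) A x by rewrite -fA.
by move=> /(faceP (ndT k))[_ /(_ j Aj) xj]; exists j.
Qed.

Lemma facet_center_in k j : facet (T k) j (facet_center (T k) j).
Proof.
apply/facetP => //; rewrite bary_facet_center// eqxx; split => //.
apply/hullP => // i; rewrite bary_facet_center//.
by case: ifPn => // _; rewrite invr_ge0.
Qed.

(** The two coordinates that vanish on the common facet are proportional. Were the factor positive,
    a small step from the facet center along the gradient would enter the interior of both
    elements. *)
Lemma facet_opposite k j l j' : k <> l -> facet (T k) j = facet (T l) j' ->
  exists2 c, c < 0 & forall x, bary (T l) x ord0 j' = c * bary (T k) x ord0 j.
Proof.
move=> kl fE; have [c c0 cE] := bary_same_facet (ndT k) (ndT l) fE.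
exists c => //; rewrite lt_neqAle c0/= leNgt; apply/negP => cgt0.
pose y := facet_center (T k) j.
have yk i : i != j -> 0 < bary (T k) y ord0 i.
  by move=> /negbTE ij; rewrite bary_facet_center// ij invr_gt0.
have yj : bary (T k) y ord0 j = 0 by rewrite bary_facet_center// eqxx.
(* If another coordinate of [T l] vanished at the center, it would vanish at all vertices of the
   facet, hence be proportional to the coordinate [j'] as well. *)
have yl i : i != j' -> 0 < bary (T l) y ord0 i.
  move=> ij'; rewrite lt_neqAle.
  have fy : hull (T l) y by have := facet_center_in k j; rewrite fE => /(facetP (ndT l))[].
  rewrite (hullP (ndT l) y).1// andbT; apply/eqP => /esym yi0.
  have vert i' : i' != j -> bary (T l) (row i' (T k)) ord0 i = 0.
    move=> i'j; move: yi0; rewrite (bary_comb (T l) (ndT k)) => /eqP.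
    rewrite psumr_eq0.
      move=> /allP/(_ i' (mem_index_enum _))/implyP/(_ isT).
      by rewrite mulf_eq0 (gt_eqF (yk _ i'j))/= => /eqP.
    move=> m _; have [->|mj] := eqVneq m j; first by rewrite yj mul0r.
    apply: mulr_ge0; first exact/ltW/yk.
    have : facet (T l) j' (row m (T k)).
      rewrite -fE; apply/facetP => //; split; first exact: hull_vertex.
      by rewrite bary_vertex// (negbTE mj).
    by move=> /(facetP (ndT l))[/(hullP (ndT l))].
  have [c'0 c'E] := bary_proportional (ndT k) (ndT l) vert.
  have := cE (row i (T l)); rewrite bary_vertex// (negbTE ij') => /esym/eqP.
  rewrite mulf_eq0 (negbTE c0)/= => /eqP b0.
  have := c'E (row i (T l)); rewrite bary_vertex// eqxx b0 mulr0 => /eqP.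
  by rewrite oner_eq0.
pose g := bary_grad (T k) j.
have : \forall e \near (0 : R)^'+, [/\ 0 < e,
    forall i, i != j -> 0 < bary (T k) (y + e *: g) ord0 i &
    forall i, i != j' -> 0 < bary (T l) (y + e *: g) ord0 i].
  have h1 : \forall e \near (0 : R)^'+, 0 < e by exact: nbhs_right_gt.
  have h2 : \forall e \near (0 : R)^'+, forall i : 'I_n.+2, i != j -> 0 < bary (T k) (y + e *: g) ord0 i.
    apply: (filter_forall (F := (0 : R)^'+) (f := fun (i : 'I_n.+2) e => i != j -> 0 < bary (T k) (y + e *: g) ord0 i)) => i.
    have [ij|_] := boolP (i != j); last exact: nearW.
    have := near0_gt0 (dot (bary_grad (T k) i) g) (yk i ij).
    by apply: filterS => e; rewrite bary_line.
  have h3 : \forall e \near (0 : R)^'+, forall i : 'I_n.+2, i != j' -> 0 < bary (T l) (y + e *: g) ord0 i.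
    apply: (filter_forall (F := (0 : R)^'+) (f := fun (i : 'I_n.+2) e => i != j' -> 0 < bary (T l) (y + e *: g) ord0 i)) => i.
    have [ij|_] := boolP (i != j'); last exact: nearW.
    have := near0_gt0 (dot (bary_grad (T l) i) g) (yl i ij).
    by apply: filterS => e; rewrite bary_line.
  by apply: filterS3 h1 h2 h3 => e.
move=> /filter_ex[e [e0 hk hl]].
have kj : 0 < bary (T k) (y + e *: g) ord0 j.
  rewrite bary_line yj add0r mulr_gt0// -enorm_sqr exprn_gt0//.
  exact: enorm_bary_grad_gt0.
have hkall i : 0 < bary (T k) (y + e *: g) ord0 i.
  by have [->//|/hk] := eqVneq i j.
have hlall i : 0 < bary (T l) (y + e *: g) ord0 i.
  by have [->|/hl//] := eqVneq i j'; rewrite cE mulr_gt0.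
have [] := @mesh_overlap k l (y + e *: g) kl.
- by apply/hullP => // i; exact/ltW.
- by apply/hullP => // i; exact/ltW.
- by move=> i _ /= i0; have := hkall i; rewrite i0 ltxx.
Qed.

(** Near a point of [D] in the relative interior of the facet, the outer side of [T k] must be
    covered by other elements. One of them contains that point, so by conformity it meets [T k] in
    the whole facet. *)
Lemma facet_neighbor k j x : facet (T k) j x -> D x ->
  exists l j', l <> k /\ facet (T l) j' = facet (T k) j.
Proof.
move=> fx Dx.
have [hx xj] := (facetP (ndT k) j x).1 fx.
pose y0 := facet_center (T k) j.
have [y [Dy yj yi]] : exists y, [/\ D y, bary (T k) y ord0 j = 0 &
    forall i, i != j -> 0 < bary (T k) y ord0 i].
  have : \forall e \near (0 : R)^'+, [/\ 0 < e, e < 1 & D (x + e *: (y0 - x))].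
    have h1 : \forall e \near (0 : R)^'+, 0 < e by exact: nbhs_right_gt.
    have h2 : \forall e \near (0 : R)^'+, e < 1 by exact: nbhs_right_lt.
    have cl : (fun e : R => x + e *: (y0 - x)) e @[e --> 0^'+] --> x + (0 : R) *: (y0 - x).
      apply: cvg_at_right_filter; apply: cvgD; first exact: cvg_cst.
      by apply: cvgZr_tmp; exact: cvg_id.
    have h3 : \forall e \near (0 : R)^'+, D (x + e *: (y0 - x)).
      by apply: (cl D); rewrite scale0r addr0; exact: open_nbhs_nbhs.
    by apply: filterS3 h1 h2 h3 => e.
  move=> /filter_ex[e [e0 e1 De]]; exists (x + e *: (y0 - x)).
  have E i : bary (T k) (x + e *: (y0 - x)) ord0 i =
      (1 - e) * bary (T k) x ord0 i + e * bary (T k) y0 ord0 i.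
    rewrite bary_line (bary_affine (T k) x) (bary_affine (T k) y0) dotBr; ring.
  split => //; first by rewrite E xj bary_facet_center// eqxx !mulr0 addr0.
  move=> i ij; rewrite E bary_facet_center// (negbTE ij).
  apply: ltr_wpDl; last by rewrite mulr_gt0// invr_gt0.
  by apply: mulr_ge0; [rewrite subr_ge0 ltW|exact: (hullP (ndT k) x).1].
pose g := bary_grad (T k) j.
(* Elements are closed and finitely many: if none but [T k] contained [y], points just outside [T k]
   would be left uncovered. *)
have [l [lk hly]] : exists l, l <> k /\ hull (T l) y.
  apply: contrapT => /forallNP H.
  have : \forall e \near (0 : R)^'+, [/\ 0 < e, D (y + e *: - g) &
      forall l, l != k -> ~ hull (T l) (y + e *: - g)].
    have cl : (fun e : R => y + e *: - g) e @[e --> 0^'+] --> y + (0 : R) *: - g.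
      apply: cvg_at_right_filter; apply: cvgD; first exact: cvg_cst.
      by apply: cvgZr_tmp; exact: cvg_id.
    have h1 : \forall e \near (0 : R)^'+, 0 < e by exact: nbhs_right_gt.
    have h2 : \forall e \near (0 : R)^'+, D (y + e *: - g).
      by apply: (cl D); rewrite scale0r addr0; exact: open_nbhs_nbhs.
    have h3 : \forall e \near (0 : R)^'+, forall l, l != k -> ~ hull (T l) (y + e *: - g).
      apply: (filter_forall (F := (0 : R)^'+) (f := fun l e => l != k -> ~ hull (T l) (y + e *: - g))) => l.
      have [lk|_] := boolP (l != k); last exact: nearW.
      have oN : open (~` hull (T l)) by apply: closed_openC; exact: closed_hull.
      have yN : (~` hull (T l)) y.
        by move=> hl; apply: (H l); split => //; exact/eqP.
      have := cl (~` hull (T l)); rewrite scale0r addr0 => /(_ (open_nbhs_nbhs (conj oN yN))).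
      by move=> h; apply: (filterS (F := (0 : R)^'+) _ h) => e he _.
    by apply: filterS3 h1 h2 h3 => e.
  move=> /filter_ex[e [e0 De he]].
  have [l hl] := mesh_cover De.
  have [lk|/he//] := eqVneq l k; move: hl; rewrite lk => /(hullP (ndT k))/(_ j).
  rewrite bary_line yj add0r dotNr mulrN oppr_ge0 leNgt mulr_gt0// -enorm_sqr exprn_gt0//.
  exact: enorm_bary_grad_gt0.
have hky : hull (T k) y.
  apply/hullP => // i; have [->|/yi/ltW//] := eqVneq i j; by rewrite yj.
case: hT => _ _ /(_ k l (fun e => lk (esym e)))[A [B [[j0 Aj0] fA fAB]]].
have fAy : face (T k) A y by rewrite -fA.
have jj0 : j0 = j.
  apply/eqP; apply: contraT => /yi; move: fAy => /(faceP (ndT k))[_ /(_ _ Aj0) ->].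
  by rewrite ltxx.
have Ai i : i != j -> A i.
  move=> /yi yi0; apply: contraT => nAi.
  by move: fAy yi0 => /(faceP (ndT k))[_ /(_ _ nAi) ->]; rewrite ltxx.
have fAj : face (T k) A = facet (T k) j.
  apply/seteqP; split => z /(faceP (ndT k))[z0 zA]; apply/(faceP (ndT k)); split => // i.
    by rewrite /= negbK => /eqP ->; apply: zA; rewrite -jj0.
  move=> nAi; apply: zA; rewrite /= negbK; apply: contraT => /Ai; by rewrite (negbTE nAi).
have fB : facet (T k) j = face (T l) B by rewrite -fAj.
have vert i j' : i != j -> ~~ B j' -> bary (T l) (row i (T k)) ord0 j' = 0.
  move=> ij nB; have : face (T l) B (row i (T k)).
    rewrite -fB; apply/facetP => //; split; first exact: hull_vertex.
    by rewrite bary_vertex// (negbTE ij).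
  by move=> /(faceP (ndT l))[_ /(_ _ nB)].
(* If the face were all of [T l], the coordinate [j] of [T k] would vanish at every vertex of [T l],
   hence identically. *)
have [j' nBj'] : exists j', ~~ B j'.
  apply/existsP; apply: contraT; rewrite negb_exists => /forallP Ball.
  have v i : bary (T k) (row i (T l)) ord0 j = 0.
    have : facet (T k) j (row i (T l)).
      rewrite fB; apply/faceP => //; split => [m|m]; first by rewrite bary_vertex// ler0n.
      by rewrite (negbTE (Ball m)).
    by move=> /(facetP (ndT k))[].
  have := bary_comb (T k) (ndT l) j (row j (T k)).
  rewrite bary_vertex// eqxx big1 => [/eqP|i _]; first by rewrite oner_eq0.
  by rewrite v mulr0.
(* Two missing vertices would give two coordinates of [T l] proportional to a single coordinate of
   [T k]. *)
have uniqB m : ~~ B m -> m = j'.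
  move=> nBm; apply/eqP; apply: contraT => mj'.
  have [c0 cE] := bary_proportional (ndT k) (ndT l) (fun i ij => vert i m ij nBm).
  have [c'0 c'E] := bary_proportional (ndT k) (ndT l) (fun i ij => vert i j' ij nBj').
  have := c'E (row m (T l)); rewrite bary_vertex// (negbTE mj') => /esym/eqP.
  rewrite mulf_eq0 (negbTE c'0)/= => /eqP b0.
  have := cE (row m (T l)); rewrite bary_vertex// eqxx b0 mulr0 => /eqP.
  by rewrite oner_eq0.
exists l, j'; split => //; rewrite fB.
apply/seteqP; split => z /(faceP (ndT l))[z0 zA]; apply/(faceP (ndT l)); split => // i.
  by move=> /uniqB ->; apply: zA; rewrite /= negbK.
by rewrite /= negbK => /eqP ->; exact: zA.
Qed.

(** Among three distinct elements the pairwise factors would all be negative, while one of them is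
    the product of the other two. *)
Lemma facet_two k j l j' m i : l <> k -> facet (T l) j' = facet (T k) j ->
  facet (T m) i = facet (T k) j -> (m, i) = (k, j) \/ (m, i) = (l, j').
Proof.
move=> lk fl fm.
have [mk|/eqP mk] := eqVneq m k.
  by left; rewrite mk; congr pair; apply: (facet_inj (ndT k)); rewrite -mk in fm *; rewrite fm mk.
have [ml|/eqP ml] := eqVneq m l.
  by right; rewrite ml; congr pair; apply: (facet_inj (ndT l)); rewrite fl -fm ml.
have [c1 c10 c1E] := facet_opposite (fun e => lk (esym e)) (esym fl).
have [c2 c20 c2E] := facet_opposite (fun e => mk (esym e)) (esym fm).
have [c3 c30 c3E] := facet_opposite (fun e => ml (esym e)) (etrans fl (esym fm)).
have := c2E (row j (T k)); rewrite c3E c1E !bary_vertex// eqxx !mulr1 => h.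
by move: c20; rewrite -h nmulr_rlt0// ltNge ltW.
Qed.

Lemma facet_neighbor_boundary k j : ~ facet (T k) j `<=` boundary D ->
  exists l j', l <> k /\ facet (T l) j' = facet (T k) j.
Proof.
move=> /existsNP[x /not_implyP[fx nb]].
apply: (facet_neighbor fx); apply: contrapT => nD; apply: nb; split.
  by apply: mesh_hull_sub; exact: facet_sub_hull fx.
by move=> /interior_subset.
Qed.

End mesh_topology.

Lemma row'_entry (R : Type) m p (A : 'M[R]_(m.+1, p)) i a b :
  row' i A a b = A (lift i a) b.
Proof. by rewrite mxE. Qed.

Section same_facet.
Context {R : realType} {n : nat}.
Variables (V V' : simplex R n) (j j' : 'I_n.+2).
Hypotheses (hV : nondegenerate_simplex V) (hV' : nondegenerate_simplex V').
Hypothesis fE : facet V j = facet V' j'.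

(** The coordinates of the vertices of one facet in terms of those of the other. How the vertices
    correspond is never determined: it is enough that this matrix and its inverse are stochastic. *)
Let coords (V V' : simplex R n) (j j' : 'I_n.+2) : 'M[R]_n.+1 :=
  \matrix_(i, k) bary V (row (lift j' i) V') ord0 (lift j k).

Let coordsE (W W' : simplex R n) i i' a b :
  coords W W' i i' a b = bary W (row (lift i' a) W') ord0 (lift i b).
Proof. by rewrite mxE. Qed.

Let facet_vertex (W : simplex R n) i (a : 'I_n.+1) : nondegenerate_simplex W ->
  facet W i (row (lift i a) W).
Proof.
move=> hW; apply/facetP => //; split; first exact: hull_vertex.
by rewrite bary_vertex// eq_sym (negbTE (neq_lift _ _)).
Qed.

Let sum_lift (W : simplex R n) i x (F : 'I_n.+2 -> R) : nondegenerate_simplex W ->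
  facet W i x -> \sum_k bary W x ord0 (lift i k) * F (lift i k) =
    \sum_k bary W x ord0 k * F k.
Proof.
move=> hW /(facetP hW)[_ xi].
rewrite [RHS](bigD1_ord i)//= xi mul0r add0r.
by apply: eq_bigr => k _; congr (_ * _).
Qed.

Let coords_ge0 (W W' : simplex R n) i i' a b : nondegenerate_simplex W ->
  nondegenerate_simplex W' -> facet W i = facet W' i' -> 0 <= coords W W' i i' a b.
Proof.
move=> hW hW' E; rewrite mxE.
have : facet W i (row (lift i' a) W') by rewrite E; exact: facet_vertex.
by move=> /(facetP hW)[/(hullP hW)].
Qed.

Let coords_sum (W W' : simplex R n) i i' a : nondegenerate_simplex W ->
  nondegenerate_simplex W' -> facet W i = facet W' i' -> \sum_b coords W W' i i' a b = 1.
Proof.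
move=> hW hW' E.
have fx : facet W i (row (lift i' a) W') by rewrite E; exact: facet_vertex.
rewrite -(sum_bary hW (row (lift i' a) W')).
have := sum_lift (fun=> 1) hW fx.
by under eq_bigr do rewrite mulr1; under [RHS]eq_bigr do rewrite mulr1; move=> <-;
  apply: eq_bigr => b _; rewrite mxE.
Qed.

Let coordsM (W W' : simplex R n) i i' : nondegenerate_simplex W ->
  nondegenerate_simplex W' -> facet W i = facet W' i' ->
  coords W W' i i' *m coords W' W i' i = 1%:M.
Proof.
move=> hW hW' E; apply/matrixP => a b; rewrite mxE.
have fx : facet W i (row (lift i' a) W') by rewrite E; exact: facet_vertex.
under eq_bigr do rewrite !coordsE.
rewrite (sum_lift (fun k => bary W' (row k W) ord0 (lift i' b)) hW fx).
by rewrite -bary_comb// bary_vertex// (inj_eq lift_inj) [RHS]mxE.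
Qed.

Let row'_coords : row' j' V' = coords V V' j j' *m row' j V.
Proof.
apply/matrixP => a b.
have fx : facet V j (row (lift j' a) V') by rewrite fE; exact: facet_vertex.
transitivity ((bary V (row (lift j' a) V') *m V) ord0 b).
  by rewrite bary_mul// !mxE.
rewrite [LHS]mxE [RHS]mxE -(sum_lift (fun k => V k b) hV fx).
by apply: eq_bigr => k _; rewrite coordsE row'_entry.
Qed.

Lemma simplex_int_same_facet (f : 'rV[R]_n.+1 -> R) : continuous f ->
  simplex_int (row' j' V') f = simplex_int (row' j V) f.
Proof.
move=> cf; apply: (simplex_int_reparam cf _ _ _ _ (coordsM hV hV' fE) row'_coords).
- by move=> a b; exact: coords_ge0.
- by move=> a; exact: coords_sum.
- by move=> a b; exact: coords_ge0.
- by move=> a; exact: coords_sum.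
Qed.

(** The rows of [coords] sum to 1, so edges are mapped to edges by its linear part, whose
    determinant has absolute value 1. *)
Lemma facet_jac_same_facet : facet_jac V' j' = facet_jac V j.
Proof.
have EE : facet_edges V' j' = bary_lin (coords V V' j j') *m facet_edges V j.
  apply/matrixP => a b.
  have r'E (c : 'I_n.+1) : V' (lift j' c) b =
      \sum_k coords V V' j j' c k * V (lift j k) b.
    have := congr1 (fun M : 'M[R]_n.+1 => M c b) row'_coords.
    rewrite [LHS]mxE [RHS]mxE => ->.
    by apply: eq_bigr => k _; rewrite row'_entry.
  rewrite mxE !r'E -sumrB.
  transitivity (\sum_k (coords V V' j j' (lift ord0 a) k - coords V V' j j' ord0 k) *
     (V (lift j k) b - V (lift j ord0) b)).
    under [RHS]eq_bigr do rewrite mulrBr.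
    have S0 : \sum_k (coords V V' j j' (lift ord0 a) k - coords V V' j j' ord0 k) = 0.
      by rewrite sumrB !coords_sum// subrr.
    rewrite [RHS]sumrB -[X in _ - X]mulr_suml S0 mul0r subr0.
    by apply: eq_bigr => k _; rewrite mulrBl.
  rewrite big_ord_recl subrr mulr0 add0r [RHS]mxE.
  by apply: eq_bigr => k _; rewrite [bary_lin _ _ _]mxE [facet_edges _ _ _ _]mxE.
have d1 : `|\det (bary_lin (coords V V' j j'))| = 1.
  apply: (norm_det_bary_lin _ _ _ _ (coordsM hV hV' fE)).
  - by move=> a b; exact: coords_ge0.
  - by move=> a; exact: coords_sum.
  - by move=> a b; exact: coords_ge0.
  - by move=> a; exact: coords_sum.
rewrite /facet_jac EE trmx_mul.
set M := bary_lin _ in d1 *; set F := facet_edges V j.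
have -> : M *m F *m (F^T *m M^T) = M *m (F *m F^T) *m M^T by rewrite !mulmxA.
rewrite !det_mulmx det_tr mulrAC -expr2 -real_normK ?num_real// d1 expr1n mul1r//.
Qed.

End same_facet.

Section mesh_integrals.
Context {R : realType} {n : nat}.
Variables (D : set 'rV[R]_n.+1) (T : mesh R n).
Hypotheses (oD : open D) (lipD : lipschitz_boundary D)
  (hT : conforming_triangulation D T).
Implicit Types (k l : 'I_(nelt T)) (j : 'I_n.+2).
Local Notation lam := (@lebesgue_rV R n.+1).

Let ndT k : nondegenerate_simplex (T k).
Proof. by case: hT. Qed.

Definition mesh_null (M : mesh R n) : set 'rV[R]_n.+1 :=
  \bigcup_(k in [set: 'I_(nelt M)]) facet_planes (M k).

Lemma measurable_mesh_null : measurable (mesh_null T).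
Proof.
apply: (bigcup_null (mu := lam) _ _).1 => k; first exact: measurable_facet_planes.
exact: lebesgue_facet_planes.
Qed.

Lemma lebesgue_mesh_null : lam (mesh_null T) = 0%E.
Proof.
apply: (bigcup_null (mu := lam) _ _).2 => k; first exact: measurable_facet_planes.
exact: lebesgue_facet_planes.
Qed.

Lemma mesh_unique x : ~ mesh_null T x -> D x ->
  exists k, open_hull (T k) x /\ forall l, hull (T l) x -> l = k.
Proof.
move=> nx Dx; have [k hk] := mesh_cover hT Dx; exists k; split.
  by apply: hull_open_hull => // hx; apply: nx; exists k.
move=> l hl; apply: contrapT => lk.
by apply: nx; exists l => //; exact: (mesh_overlap hT lk hl hk).
Qed.

Lemma mesh_null_hull k x : ~ mesh_null T x -> hull (T k) x -> open_hull (T k) x /\ D x.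
Proof.
move=> nx hx; have ox : open_hull (T k) x.
  by apply: hull_open_hull => // h; apply: nx; exists k.
by split=> //; exact: (mesh_open_hull_sub oD lipD hT ox).
Qed.

(** Only the values of [f] inside the elements are prescribed, which accommodates classical
    derivatives, uncontrolled on the skeleton; the skeleton is null. *)
Lemma integ_mesh (f : 'rV[R]_n.+1 -> R) (F : 'I_(nelt T) -> 'rV[R]_n.+1 -> R) :
  (forall k, continuous (F k)) ->
  (forall k x, open_hull (T k) x -> f x = F k x) ->
  integ D f = \sum_k integ (hull (T k)) (F k).
Proof.
move=> cF fF.
have iF k : lam.-integrable setT (EFin \o (F k \_ (hull (T k)))).
  rewrite -restrict_EFin; apply/integrable_restrict => //; first exact: measurable_hull.
  by rewrite setTI; apply: compact_integrable => //; exact: compact_hull.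
transitivity (\int[lam]_x (\sum_k (F k \_ (hull (T k))) x))%R; last first.
  rewrite (Rintegral_fsum _ measurableT iF).2.
  by apply: eq_bigr => k _; rewrite /integ [RHS]Rintegral_mkcond.
apply: (eq_Rintegral_null measurable_mesh_null lebesgue_mesh_null) => x nx.
rewrite patch_setT; have [Dx|Dx] := pselect (D x).
  have [k [ok kl]] := mesh_unique nx Dx.
  rewrite patch_in// (bigD1 k)//= patch_in; last exact: open_hull_sub.
  rewrite big1 ?addr0 ?(fF k)// => l /eqP lk; rewrite patch_out// => /kl; exact: lk.
rewrite patch_out// big1// => k _; rewrite patch_out// => hx.
by apply: Dx; case: (mesh_null_hull nx hx).
Qed.

Lemma integ_hull_eq k (f F : 'rV[R]_n.+1 -> R) :
  (forall x, open_hull (T k) x -> f x = F x) ->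
  integ (hull (T k)) f = integ (hull (T k)) F.
Proof.
move=> fF; apply: (eq_Rintegral_null measurable_mesh_null lebesgue_mesh_null) => x nx.
have [hx|hx] := pselect (hull (T k) x); last by rewrite !patch_out.
by rewrite !patch_in// fF//; case: (mesh_null_hull nx hx).
Qed.

End mesh_integrals.

Section local_calculus.
Context {R : realType} {n : nat}.
Variables (V : simplex R n).
Hypothesis hV : nondegenerate_simplex V.

Lemma partial_open_hull (f F : 'rV[R]_n.+1 -> R) i x :
  (forall y, hull V y -> f y = F y) -> open_hull V x -> partial i f x = partial i F x.
Proof.
move=> fF ox; apply: near_eq_derive.
have := open_nbhs_nbhs (conj (open_open_hull (V := V)) ox).
by apply: filterS => y /(open_hull_sub hV); exact: fF.
Qed.

Lemma divergence_open_hull (v U : 'rV[R]_n.+1 -> 'rV[R]_n.+1) x :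
  (forall y, hull V y -> v y = U y) -> open_hull V x -> divergence v x = divergence U x.
Proof.
move=> vU ox; apply: eq_bigr => i _; apply: partial_open_hull => // y hy.
by rewrite vU.
Qed.

Lemma grad_open_hull (f F : 'rV[R]_n.+1 -> R) x :
  (forall y, hull V y -> f y = F y) -> open_hull V x -> grad f x = grad F x.
Proof. by move=> fF ox; apply/rowP => i; rewrite !mxE; exact: partial_open_hull. Qed.

Let facet_coords (j : 'I_n.+2) (s : 'rV[R]_n) : 'rV[R]_n.+2 :=
  \row_(i < n.+2) (if unlift j i is Some k then bary_ref s ord0 k else 0).

Let facet_coords_lift j s k : facet_coords j s ord0 (lift j k) = bary_ref s ord0 k.
Proof. by rewrite [LHS]mxE liftK. Qed.

Let facet_coords_id j s : facet_coords j s ord0 j = 0.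
Proof. by rewrite [LHS]mxE unlift_none. Qed.

Let facet_coords_sum j s : \sum_i facet_coords j s ord0 i = 1.
Proof.
rewrite (bigD1_ord j)//= facet_coords_id add0r -(sum_bary_ref s).
by apply: eq_bigr => k _; rewrite facet_coords_lift.
Qed.

Let facet_coords_mul j s : facet_param V j s = facet_coords j s *m V.
Proof.
rewrite facet_paramE; apply/rowP => c; rewrite [LHS]mxE [RHS]mxE.
rewrite [RHS](bigD1_ord j)//= facet_coords_id mul0r add0r.
by apply: eq_bigr => k _; rewrite facet_coords_lift row'_entry.
Qed.

Lemma ref_facet j s : ref_simplex s -> facet V j (facet_param V j s).
Proof.
move=> hs; exists (facet_coords j s); split => //.
- move=> i; have [k ->|->] := unliftP j i; last by rewrite facet_coords_id.
  by rewrite facet_coords_lift; exact: (ref_simplexP s).1.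
- by move=> i; rewrite /= negbK => /eqP ->; rewrite facet_coords_id.
Qed.

Lemma bary_facet_param j s k :
  bary V (facet_param V j s) ord0 (lift j k) = bary_ref s ord0 k.
Proof.
by rewrite facet_coords_mul baryK// facet_coords_lift.
Qed.

Lemma eq_facet_int j (f g : 'rV[R]_n.+1 -> R) :
  (forall x, facet V j x -> f x = g x) -> facet_int V j f = facet_int V j g.
Proof.
move=> fg; congr (_ * _); apply: eq_Rintegral => s /set_mem hs.
by apply: fg; exact: ref_facet.
Qed.

End local_calculus.

(** * Normal jumps and cancellation on interior facets *)

Section normal_jumps.
Context {R : realType} {n : nat}.
Variables (D : set 'rV[R]_n.+1) (T : mesh R n).
Hypotheses (oD : open D) (lipD : lipschitz_boundary D)
  (hT : conforming_triangulation D T).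
Implicit Types (k l : 'I_(nelt T)) (j : 'I_n.+2).

Let ndT k : nondegenerate_simplex (T k).
Proof. by case: hT. Qed.

Lemma closure_open_hull (V : simplex R n) (hV : nondegenerate_simplex V) x :
  hull V x -> closure (open_hull V) x.
Proof.
move=> hx B Bx.
pose y : 'rV[R]_n.+1 := const_mx (n.+2%:R^-1) *m V.
have yE i : bary V y ord0 i = n.+2%:R^-1.
  rewrite baryK ?mxE//; under eq_bigr do rewrite mxE.
  by rewrite sumr_const card_ord -[LHS]mulr_natr mulVf// pnatr_eq0.
have h1 : \forall e \near (0 : R)^'+, 0 < e by exact: nbhs_right_gt.
have h2 : \forall e \near (0 : R)^'+, e < 1 by exact: nbhs_right_lt.
have cl : (fun e : R => x + e *: (y - x)) e @[e --> 0^'+] --> x + (0 : R) *: (y - x).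
  apply: cvg_at_right_filter; apply: cvgD; first exact: cvg_cst.
  by apply: cvgZr_tmp; exact: cvg_id.
have h3 : \forall e \near (0 : R)^'+, B (x + e *: (y - x)).
  by apply: (cl B); rewrite scale0r addr0.
have : \forall e \near (0 : R)^'+, [/\ 0 < e, e < 1 & B (x + e *: (y - x))].
  by apply: filterS3 h1 h2 h3 => e.
move=> /filter_ex[e [e0 e1 Be]].
exists (x + e *: (y - x)); split => // i.
have -> : bary V (x + e *: (y - x)) ord0 i =
    (1 - e) * bary V x ord0 i + e * bary V y ord0 i.
  rewrite bary_line (bary_affine V x) (bary_affine V y) dotBr; ring.
rewrite yE; apply: ltr_wpDl; last by rewrite mulr_gt0// invr_gt0.
by apply: mulr_ge0; [rewrite subr_ge0 ltW|exact: (hullP hV x).1].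
Qed.

(** The one-sided limit is the value because [v] is continuous up to the boundary; density of the
    open simplex makes the filter proper, hence the limit meaningful. *)
Lemma normal_traceE (v : 'rV[R]_n.+1 -> 'rV[R]_n.+1) k j x : {within closure D, continuous v} -> hull (T k) x ->
  normal_trace v k j x = dot (v x) (outer_normal (T k) j).
Proof.
move=> cv hx; rewrite /normal_trace.
have PF : ProperFilter (within (hull (T k))° (nbhs x)).
  apply/within_nbhs_proper.
  apply: closureS (closure_open_hull (ndT k) hx).
  rewrite -open_subsetE; last exact: open_open_hull.
  exact: open_hull_sub.
apply/cvg_lim => //.
have cx : v @ within (closure D) (nbhs x) --> v x.
  by move/subspace_continuousP : cv; apply; exact: (mesh_hull_sub hT hx).
have cx' : v @ within (hull (T k))° (nbhs x) --> v x.
  apply: cvg_trans cx; apply: cvg_fmap2.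
  apply: within_subset.
  by move=> y /interior_subset/(mesh_hull_sub hT).
under eq_fun do rewrite dotC.
rewrite dotC; apply: (cvg_comp _ _ cx').
exact: continuous_dot.
Qed.

(** The sum defining the jump has exactly two terms, with the same value of [v] and opposite
    normals. *)
Lemma phi1_interior (v : 'rV[R]_n.+1 -> 'rV[R]_n.+1) k j x : {within closure D, continuous v} ->
  ~ facet (T k) j `<=` boundary D -> facet (T k) j x -> phi1 D v k j x = 0.
Proof.
move=> cv nb fx; rewrite /phi1; case: asboolP => // _.
have [l [j' [lk fl]]] := facet_neighbor_boundary oD hT nb.
have kl : k <> l by move=> e; exact: lk.
have [c c0 cE] := facet_opposite hT kl (esym fl).
rewrite /jump (bigD1 (k, j)) /=; last by apply/asboolP.
rewrite (bigD1 (l, j')) /=; last first.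
  rewrite (_ : (l, j') != (k, j)) ?andbT; first exact/asboolP.
  by apply/eqP => -[].
rewrite big1 ?addr0; last first.
  move=> [m i] /= /andP[/andP[/asboolP fm /eqP mk] /eqP ml].
  by case: (facet_two hT lk fl fm).
rewrite !normal_traceE//.
- by rewrite (outer_normal_opp (ndT k) c0 cE) dotNr subrr mulr0.
- by apply: (facet_sub_hull (ndT l) (j := j')); rewrite fl.
- exact: facet_sub_hull fx.
Qed.

(** Pairs that denote the same facet come in twos with opposite contributions. No involution is
    chosen: summing over each class gives zero, and exchanging the sums counts every contribution
    twice. *)
Lemma sum_interior_facets (w : 'rV[R]_n.+1 -> R) (v : 'rV[R]_n.+1 -> 'rV[R]_n.+1)
    (W : 'I_(nelt T) -> 'rV[R]_n.+1 -> R)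
    (U : 'I_(nelt T) -> 'rV[R]_n.+1 -> 'rV[R]_n.+1) :
  (forall k, continuous (W k)) -> (forall k i, continuous (fun x => U k x ord0 i)) ->
  (forall k x, hull (T k) x -> w x = W k x) ->
  (forall k x, hull (T k) x -> v x = U k x) ->
  \sum_(z : 'I_(nelt T) * 'I_n.+2 | ~~ `[< facet (T z.1) z.2 `<=` boundary D >])
    facet_int (T z.1) z.2 (fun x => w x * dot (v x) (outer_normal (T z.1) z.2)) = 0.
Proof.
move=> cW cU wW vU.
pose b (z : 'I_(nelt T) * 'I_n.+2) :=
  facet_int (T z.1) z.2 (fun x => w x * dot (v x) (outer_normal (T z.1) z.2)).
pose same (z z' : 'I_(nelt T) * 'I_n.+2) := `[< facet (T z.1) z.2 = facet (T z'.1) z'.2 >].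
pose Int (z : 'I_(nelt T) * 'I_n.+2) := ~~ `[< facet (T z.1) z.2 `<=` boundary D >].
have sameI z z' : same z z' -> Int z' = Int z by rewrite /Int => /asboolP ->.
have pair z : Int z -> exists z', [/\ z' != z, (forall y, same y z = (y == z) || (y == z')) &
    b z' = - b z].
  case: z => k j; rewrite /Int/= => /asboolP nb.
  have [l [j' [lk fl]]] := facet_neighbor_boundary oD hT nb.
  have kl : k <> l by move=> e; exact: lk.
  have [c c0 cE] := facet_opposite hT kl (esym fl).
  exists (l, j'); split.
  - by apply/eqP => -[].
  - move=> [m i]; apply/asboolP/orP => /=.
      by move=> fm; case: (facet_two hT lk fl fm) => ->; rewrite eqxx; [left|right].
    by case=> /eqP[-> ->].
  rewrite /b/= (outer_normal_opp (ndT k) c0 cE).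
  pose f x := W k x * dot (U k x) (outer_normal (T k) j).
  have cf : continuous f.
    have cg : continuous (fun x => dot (U k x) (outer_normal (T k) j)).
      apply: (continuous_sum (F := fun i x =>
        U k x ord0 i * outer_normal (T k) j ord0 i)) => i y.
      by apply: (cvgM (F := nbhs y)); [exact: (cU k i y)|exact: cvg_cst].
    by move=> x; exact: (cvgM (cW k x) (cg x)).
  rewrite [in RHS](@eq_facet_int _ _ _ _ _ f); last first.
    by move=> x /(facet_sub_hull (ndT k)) hx; rewrite (wW k)// (vU k).
  rewrite (@eq_facet_int _ _ _ _ _ (fun x => - f x)); last first.
    move=> x; rewrite fl => /(facet_sub_hull (ndT k)) hx.
    by rewrite (wW k)// (vU k)// dotNr mulrN.
  have cNf : continuous (fun x => - f x) by move=> x; apply: continuousN; exact: cf.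
  rewrite !facet_intE (simplex_int_same_facet (ndT k) (ndT l) (esym fl) cNf).
  rewrite (facet_jac_same_facet (ndT k) (ndT l) (esym fl)) -mulrN; congr (_ * _).
  rewrite /simplex_int -mulN1r -RintegralZl; [|exact: measurable_ref_simplex|
    exact: simplex_int_integrable].
  by apply: eq_Rintegral => s _; rewrite mulN1r.
rewrite -/(\sum_(z | Int z) b z).
have S : \sum_(z | Int z) \sum_(z' | same z' z) b z' = 0.
  rewrite big1// => z /pair[z' [z'z zE bE]].
  rewrite (bigD1 z)/= ?zE ?eqxx// (bigD1 z')/= ?zE ?eqxx ?orbT//.
  rewrite big1 ?addr0 ?bE ?subrr// => y; rewrite zE.
  by move=> /andP[/andP[/orP[/eqP ->|/eqP ->]]]; rewrite eqxx.
have : \sum_(z | Int z) b z *+ 2 = 0.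
  rewrite -[RHS]S [RHS](exchange_big_dep Int)/=; last by move=> z z' Iz /sameI <-.
  apply: eq_bigr => z Iz; have [z' [z'z zE bE]] := pair z Iz.
  rewrite sumr_const; congr (_ *+ _).
  rewrite -[RHS](_ : #|[set z; z']%SET| = _); first by rewrite cards2 eq_sym z'z.
  apply: eq_card => y; rewrite !inE -zE.
  transitivity (Int y && same z y) => //.
  have -> : same z y = same y z by apply/asbool_equiv_eq; split => ->.
  have [yz|_] := boolP (same y z); last by rewrite andbF.
  by rewrite andbT -(sameI y z).
rewrite sumrMnl => /eqP; rewrite mulrn_eq0/= => /eqP.
exact.
Qed.

End normal_jumps.

Section Lp_facts.
Context {R : realType} {n : nat}.
Local Notation lam := (@lebesgue_rV R n.+1).
Implicit Types (D N : set 'rV[R]_n.+1) (f : 'rV[R]_n.+1 -> R).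

Lemma Lp_normE (p : R) D f :
  Lp_norm p%:E D f = ((\int[lam]_x ((`|(f \_ D) x| `^ p)%R)%:E) `^ p^-1)%E.
Proof. by rewrite /Lp_norm unlock. Qed.

Lemma Lp_norm_lty (p M : R) D f : measurable D -> (lam D < +oo)%E -> 0 < p ->
  (forall x, D x -> `|f x| <= M) -> (Lp_norm p%:E D f < +oo)%E.
Proof.
move=> mD Doo p0 fM; rewrite Lp_normE; apply: poweR_lty.
apply: (@le_lt_trans _ _ (\int[lam]_(x in D) (M `^ p)%:E)%E).
  rewrite [leRHS]integral_mkcond; apply: le_integralT => x.
    by rewrite lee_fin powR_ge0.
  have [Dx|Dx] := pselect (D x).
    rewrite !patch_in// lee_fin; apply: ge0_ler_powR => //; first exact: ltW.
      by rewrite nnegrE (le_trans _ (fM _ Dx)).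
    exact: fM.
  by rewrite !patch_out// normr0 powR0// gt_eqF.
by rewrite integral_cst// lte_mul_pinfty// lee_fin powR_ge0.
Qed.

Lemma eq_Lp_norm_null (p : R) N D D' f g : measurable N -> lam N = 0%E ->
  (forall x, ~ N x -> (f \_ D) x = (g \_ D') x) ->
  Lp_norm p%:E D f = Lp_norm p%:E D' g.
Proof.
move=> mN N0 fg; rewrite !Lp_normE; congr (_ `^ _)%E.
apply: (ge0_eq_integral_null mN N0) => x; rewrite ?lee_fin ?powR_ge0//.
by move=> /fg ->.
Qed.

Lemma Lp_norm0 (p : R) D : 0 < p -> Lp_norm p%:E D (fun=> 0) = 0%E.
Proof.
move=> p0; rewrite Lp_normE integral0_eq ?poweR0r ?invr_neq0 ?gt_eqF//.
move=> x _; rewrite (_ : ((fun=> 0) \_ D) x = 0) ?normr0 ?powR0 ?gt_eqF//.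
by have [Dx|Dx] := pselect (D x); [rewrite patch_in|rewrite patch_out].
Qed.

Lemma le_Lp_norm (p : R) D D' f : 0 < p -> D `<=` D' ->
  (Lp_norm p%:E D f <= Lp_norm p%:E D' f)%E.
Proof.
move=> p0 DD'; rewrite !Lp_normE; apply: gt0_ler_poweR.
- by rewrite invr_ge0 ltW.
- by rewrite in_itv/= leey andbT; apply: integral_ge0 => x _; rewrite lee_fin powR_ge0.
- by rewrite in_itv/= leey andbT; apply: integral_ge0 => x _; rewrite lee_fin powR_ge0.
apply: le_integralT => x; first by rewrite lee_fin powR_ge0.
rewrite lee_fin; apply: ge0_ler_powR; rewrite ?nnegrE//; first exact: ltW.
have [Dx|Dx] := pselect (D x); last by rewrite patch_out// normr0.
by rewrite !patch_in//; exact: DD'.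
Qed.

End Lp_facts.

(** * Divergence theorem and the discrete flux *)

Section divergence_theorem.
Context {R : realType} {n : nat}.
Variables (V : simplex R n) (hV : nondegenerate_simplex V).
Local Notation E := 'rV[R]_n.+1.

Lemma grad_dot (a : E) (b : R) x : grad (fun x => dot a x + b) x = a.
Proof.
apply/rowP => i; rewrite [LHS]mxE; apply/cvg_lim => //.
apply: cvg_near_cst; near=> h.
have h0 : h != 0 by near: h; exact: nbhs_dnbhs_neq.
rewrite /= dotDr dotZr dot_delta -[h *  _ + _ + _]addrA addrK [_ *: _]mulrA.
by rewrite mulVf// mul1r.
Unshelve. all: by end_near. Qed.

Lemma integral_divergence (F : E -> E) : (forall i, C1 (fun x => F x ord0 i)) ->
  integ (hull V) (divergence F) =
  \sum_j facet_int V j (fun x => dot (F x) (outer_normal V j)).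
Proof.
move=> cF.
have cg i : continuous (fun x => partial i (fun x => F x ord0 i) x).
  by have [_ /(_ i)] := cF i.
have [_] := @Rintegral_fsum _ _ _ (@lebesgue_rV R n.+1) (hull V) 'I_n.+1 (index_enum _)
  (fun i x => partial i (fun x => F x ord0 i) x) (measurable_hull hV)
  (fun i => compact_integrable (compact_hull hV) (cg i)).
move=> EQ; rewrite /integ /divergence EQ.
have G i : (\int[@lebesgue_rV R n.+1]_(x in hull V) partial i (fun x => F x ord0 i) x =
    \sum_j outer_normal V j ord0 i * facet_int V j (fun x => F x ord0 i))%R.
  have := green_simplex_normal hV (delta_mx ord0 i) (cF i).
  under eq_bigr do rewrite dot_delta.
  by move=> <-; apply: eq_Rintegral => x _; rewrite dot_delta [RHS]mxE.
under eq_bigr do rewrite G.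
rewrite exchange_big /=; apply: eq_bigr => j _.
under eq_bigr do rewrite facet_intE mulrCA.
rewrite -mulr_sumr facet_intE; congr (_ * _).
have ci i : (@lebesgue_rV R n).-integrable (@ref_simplex R n)
   (EFin \o (fun s => (outer_normal V j ord0 i * F (bary_ref s *m row' j V) ord0 i))).
  have cG : continuous (fun x => outer_normal V j ord0 i * F x ord0 i).
    by move=> x; have [cFi _ _] := cF i; exact: (cvgM (cvg_cst _) (cFi x)).
  exact: (simplex_int_integrable _ cG).
have [_ EQ2] := Rintegral_fsum (index_enum _) (@measurable_ref_simplex R n) ci.
rewrite /simplex_int; transitivity (\sum_i
   (\int[@lebesgue_rV R n]_(s in @ref_simplex R n)
     (outer_normal V j ord0 i * F (bary_ref s *m row' j V) ord0 i))%R); last first.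
  by rewrite -EQ2; apply: eq_Rintegral => s _; apply: eq_bigr => i _; rewrite mulrC.
apply: eq_bigr => i _; rewrite RintegralZl//.
- exact: measurable_ref_simplex.
- have [cFi _ _] := cF i.
  exact: (simplex_int_integrable (row' j V) cFi).
Qed.

Lemma divergenceM (w : E -> R) (F : E -> E) x : polyfun w ->
  (forall i, polyfun (fun x => F x ord0 i)) ->
  divergence (fun x => w x *: F x) x = w x * divergence F x + dot (grad w x) (F x).
Proof.
move=> pw pF; rewrite /divergence mulr_sumr -big_split/=; apply: eq_bigr => i _.
rewrite (_ : (fun y => _) = (fun y => w y * F y ord0 i)); last first.
  by apply/funext => y; rewrite [LHS]mxE.
rewrite partialM; [|exact: polyfun_derivable|exact: polyfun_derivable].
by rewrite [grad _ _ _ _]mxE; ring.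
Qed.

End divergence_theorem.

Lemma compact_bound (R : realType) m (K : set 'rV[R]_m) (f : 'rV[R]_m -> R) :
  compact K -> continuous f -> exists2 M, 0 <= M & forall x, K x -> `|f x| <= M.
Proof.
move=> cK cf; have := continuous_compact (continuous_subspaceT cf) cK.
move=> /compact_bounded/ex_strict_bound_gt0[M M0 hM]; exists M; first exact: ltW.
by move=> x Kx; apply/ltW/hM; exists x.
Qed.

Section discrete_green.
Context {R : realType} {n : nat}.
Variables (D : set 'rV[R]_n.+1) (T : mesh R n).
Hypotheses (oD : open D) (lipD : lipschitz_boundary D)
  (hT : conforming_triangulation D T).
Local Notation E := 'rV[R]_n.+1.
Local Notation lam := (@lebesgue_rV R n.+1).
Implicit Types (k l : 'I_(nelt T)) (j : 'I_n.+2).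

Let ndT k : nondegenerate_simplex (T k).
Proof. by case: hT. Qed.

Definition bubble_field (V : simplex R n) (a : 'I_n.+1 -> E) (b c : 'I_n.+1 -> R) (x : E) : E :=
  \row_i (dot (a i) x + b i + c i * \prod_j bary V x ord0 j).

Lemma bubble_fieldE V a b c x i :
  bubble_field V a b c x ord0 i = dot (a i) x + b i + c i * \prod_j bary V x ord0 j.
Proof. exact: mxE. Qed.

Lemma polyfun_affine (a : E) (b : R) : polyfun (fun x => dot a x + b).
Proof. by apply: polyfunD; [exact: polyfun_dot|exact: polyfun_cst]. Qed.

Lemma polyfun_bubble_field V a b c i : polyfun (fun x => bubble_field V a b c x ord0 i).
Proof.
rewrite (_ : (fun x => _) = (fun x => dot (a i) x + b i + c i * \prod_j bary V x ord0 j)).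
  apply: polyfunD; first exact: polyfun_affine.
  apply: polyfunM; first exact: polyfun_cst.
  by apply: polyfun_prod => j _; exact: polyfun_bary.
by apply/funext => x; rewrite bubble_fieldE.
Qed.

(** On each element [v] is thus replaced by a polynomial field on the whole space, to which the
    calculus on closed simplices applies. *)
Lemma in_Xh_bubble v : in_Xh D T v -> exists (a : 'I_(nelt T) -> 'I_n.+1 -> E)
    (b c : 'I_(nelt T) -> 'I_n.+1 -> R),
  forall k x, hull (T k) x -> v x = bubble_field (T k) (a k) (b k) (c k) x.
Proof.
move=> [_ H].
have /choice[f hf] : forall z : 'I_(nelt T) * 'I_n.+1, exists p : E * R * R,
    forall x, hull (T z.1) x ->
    v x ord0 z.2 = dot p.1.1 x + p.1.2 + p.2 * \prod_j bary (T z.1) x ord0 j.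
  by move=> [k i]; have [a [b [c h]]] := H k i; exists (a, b, c).
exists (fun k i => (f (k, i)).1.1), (fun k i => (f (k, i)).1.2), (fun k i => (f (k, i)).2).
by move=> k x hx; apply/rowP => i; rewrite bubble_fieldE (hf (k, i)).
Qed.

Lemma in_P1c_affine w : in_P1c D T w -> exists (a : 'I_(nelt T) -> E)
    (b : 'I_(nelt T) -> R), forall k x, hull (T k) x -> w x = dot (a k) x + b k.
Proof.
move=> [_ H].
have /choice[f hf] : forall k, exists p : E * R,
    forall x, hull (T k) x -> w x = dot p.1 x + p.2.
  by move=> k; have [a [b h]] := H k; exists (a, b).
by exists (fun k => (f k).1), (fun k => (f k).2).
Qed.

Lemma in_P1cB w (m : R) : in_P1c D T w -> in_P1c D T (fun x => w x - m).
Proof.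
move=> [cw H]; split.
  by move=> x; exact: (cvgB (cw x) (cvg_cst m)).
move=> k; have [a [b wE]] := H k; exists a, (b - m) => x hx.
by rewrite wE// addrA.
Qed.

Lemma measurable_mesh (f : E -> R) (F : 'I_(nelt T) -> E -> R) :
  (forall k, continuous (F k)) -> (forall k x, hull (T k) x -> f x = F k x) ->
  measurable_fun D f.
Proof.
move=> cF fF mD Y mY.
have -> : D `&` f @^-1` Y = D `&` \bigcup_(k in [set: 'I_(nelt T)]) (hull (T k) `&` F k @^-1` Y).
  apply/seteqP; split=> x [Dx]/=.
    move=> Yx; split=> //; have [k hk] := mesh_cover hT Dx.
    by exists k => //; split=> //=; rewrite -(fF k).
  by move=> [k _ [hk /= Yk]]; split=> //=; rewrite (fF k).
apply: measurableI => //; apply: fin_bigcup_measurable => // k _.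
apply: measurableI; first exact: measurable_hull.
by rewrite -[X in measurable X]setTI; apply: continuous_measurable_rV.
Qed.

Lemma facet_int0 (V : simplex R n) j : facet_int V j (fun=> 0) = 0.
Proof.
by rewrite /facet_int /Rintegral (_ : integral _ _ _ = 0%E) ?mulr0// integral0_eq.
Qed.

(* The Clement interpolant enters the equation of the correction velocity only
   through this functional, which vanishes on continuous P1 functions. *)
Definition mesh_flux (v : E -> E) (w : E -> R) : R :=
  \sum_k (integ (hull (T k)) (fun x => w x * divergence v x) -
    \sum_j facet_int (T k) j (fun x => phi1 D v k j x * w x)).

Lemma mesh_flux_green v w : in_Xh D T v -> in_P1c D T w ->
  mesh_flux v w = - integ D (fun x => dot (grad w x) (v x)).
Proof.
move=> Xv Pw; have [cv _] := Xv.
have [a [b [c vE]]] := in_Xh_bubble Xv.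
have [p [q wE]] := in_P1c_affine Pw.
pose U k := bubble_field (T k) (a k) (b k) (c k).
pose W k (x : E) : R := dot (p k) x + q k.
have pU k i : polyfun (fun x => U k x ord0 i) by exact: polyfun_bubble_field.
have pW k : polyfun (W k) by exact: polyfun_affine.
have cdiv k : continuous (fun x => W k x * divergence (U k) x).
  apply: polyfun_continuous; apply: (polyfunM (pW k)).
  by apply: polyfun_sum => i _; exact: polyfun_partial.
have pg k : polyfun (fun x => dot (p k) (U k x)).
  by apply: polyfun_sum => i _; apply: polyfunM; [exact: polyfun_cst|exact: pU].
have cg k : continuous (fun x => dot (p k) (U k x)) by exact: polyfun_continuous.
have K k : integ (hull (T k)) (fun x => W k x * divergence (U k) x) +
    integ (hull (T k)) (fun x => dot (p k) (U k x)) =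
    \sum_j facet_int (T k) j (fun x => w x * dot (v x) (outer_normal (T k) j)).
  rewrite /integ -RintegralD; first last.
  - by apply: compact_integrable => //; exact: compact_hull.
  - by apply: compact_integrable => //; exact: compact_hull.
  - exact: measurable_hull.
  transitivity (integ (hull (T k)) (divergence (fun x => W k x *: U k x))).
    apply: eq_Rintegral => x _; rewrite divergenceM//; congr (_ + dot _ _).
    by rewrite grad_dot.
  rewrite integral_divergence//; last first.
    move=> i; apply: polyfun_C1.
    rewrite (_ : (fun x => _) = (fun x => W k x * U k x ord0 i)); first exact: polyfunM.
    by apply/funext => x; rewrite [LHS]mxE.
  apply: eq_bigr => j _; apply: eq_facet_int => x /(facet_sub_hull (ndT k)) hx.
  by rewrite (wE k)// (vE k)// dotZl.
have gE : integ D (fun x => dot (grad w x) (v x)) =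
    \sum_k integ (hull (T k)) (fun x => dot (p k) (U k x)).
  apply: (integ_mesh oD lipD hT) => // k x ox.
  rewrite (vE k); last exact: open_hull_sub.
  rewrite (grad_open_hull (ndT k) (F := W k))//; last exact: wE.
  by rewrite grad_dot.
apply/eqP; rewrite -subr_eq0 opprK gE -big_split/=; apply/eqP.
pose B (z : 'I_(nelt T) * 'I_n.+2) :=
  facet_int (T z.1) z.2 (fun x => w x * dot (v x) (outer_normal (T z.1) z.2)).
pose P (z : 'I_(nelt T) * 'I_n.+2) :=
  facet_int (T z.1) z.2 (fun x => phi1 D v z.1 z.2 x * w x).
transitivity (\sum_k \sum_j (B (k, j) - P (k, j))).
  apply: eq_bigr => k _; rewrite sumrB /B/= -K.
  have -> : integ (hull (T k)) (fun x => w x * divergence v x) =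
      integ (hull (T k)) (fun x => W k x * divergence (U k) x).
    apply: (integ_hull_eq oD lipD hT) => x ox; rewrite (wE k); last exact: open_hull_sub.
    by congr (_ * _); apply: (divergence_open_hull (ndT k)) ox => y; exact: vE.
  by rewrite addrAC.
(* On boundary facets [phi1] is the normal component and the two terms agree; on interior facets
   [phi1] vanishes and the remaining terms cancel in pairs. *)
rewrite pair_bigA/= (bigID (fun z => `[< facet (T z.1) z.2 `<=` boundary D >]))/=.
rewrite [X in X + _]big1 ?add0r; last first.
  move=> [k j]/= bd; apply/eqP; rewrite subr_eq0; apply/eqP.
  by apply: eq_facet_int => x _; rewrite /phi1 bd mulrC.
rewrite -[RHS](sum_interior_facets oD hT (w := w) (v := v) (W := W) (U := U))//.
- apply: eq_bigr => -[k j]/= nb; rewrite [P _](_ : _ = 0) ?subr0//.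
  rewrite -[RHS](facet_int0 (T k) j); apply: eq_facet_int => x fx.
  by rewrite phi1_interior ?mul0r//; exact/asboolPn.
- by move=> k; exact: polyfun_continuous.
- by move=> k i; exact: (polyfun_continuous (pU k i)).
Qed.

Hypotheses (bD : bounded_set D) (D0 : D !=set0).

Lemma lebesgue_domain : (0 < lam D < +oo)%E.
Proof.
rewrite open_lebesgue_gt0//=; apply: bounded_lebesgue_lty => //.
exact: open_measurable_rV.
Qed.

Lemma integ_domainB (f : E -> R) : lam.-integrable D (EFin \o f) ->
  integ D (fun x => f x - integ D f / fine (lam D)) = 0.
Proof.
move=> If; have /andP[D_gt0 Doo] := lebesgue_domain.
have mD : measurable D by exact: open_measurable_rV.
have Ic : lam.-integrable D (EFin \o (fun=> integ D f / fine (lam D))).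
  by apply: (bounded_integrable (M := `|integ D f / fine (lam D)|)).
rewrite /integ RintegralB// Rintegral_cst// mulfVK ?subrr//.
by rewrite gt_eqF// fine_gt0// D_gt0.
Qed.

(** Subtracting its mean turns [w] into a discrete pressure with the same gradient, so the discrete
    incompressibility applies. *)
Lemma mesh_flux_eq0 v w : in_Xh D T v -> in_P1c D T w ->
  (forall q, in_Mh D T q -> integ D (fun x => dot (grad q x) (v x)) = 0) ->
  mesh_flux v w = 0.
Proof.
move=> Xv Pw Mh; rewrite mesh_flux_green//.
have /andP[D_gt0 Doo] := lebesgue_domain.
have mD : measurable D by exact: open_measurable_rV.
have [p [q wE]] := in_P1c_affine Pw.
have [a [b [c vE]]] := in_Xh_bubble Xv.
pose m := integ D w / fine (lam D).
have [B hB] : exists B, forall x, D x -> `|w x| <= B.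
  have /choice[M hM] : forall k, exists M, forall x, hull (T k) x -> `|w x| <= M.
    move=> k; have [M _ hM] := compact_bound (compact_hull (ndT k))
      (polyfun_continuous (polyfun_affine (p k) (q k))).
    by exists M => x hx; rewrite (wE k)//; exact: hM.
  exists (\sum_k `|M k|) => x Dx; have [k hk] := mesh_cover hT Dx.
  apply: (le_trans (hM k x hk)); apply: (le_trans (ler_norm _)).
  by rewrite (bigD1 k)//= lerDl sumr_ge0.
have mw : measurable_fun D w.
  by apply: (measurable_mesh (F := fun k x => dot (p k) x + q k)) => // k; exact: polyfun_continuous (polyfun_affine _ _).
have Mq : in_Mh D T (fun x => w x - m).
  split; first exact: in_P1cB.
  split; [split|].
  - by apply: measurable_funB.
  - apply: (Lp_norm_lty (M := B + `|m|)) => // x Dx.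
    by apply: (le_trans (ler_normB _ _)); rewrite lerD2r hB.
  - by apply: integ_domainB; exact: (bounded_integrable (M := B)).
apply/eqP; rewrite oppr_eq0; apply/eqP; rewrite -[RHS](Mh _ Mq).
pose U k := bubble_field (T k) (a k) (b k) (c k).
have cg k : continuous (fun x => dot (p k) (U k x)).
  apply: polyfun_continuous; apply: polyfun_sum => i _.
  by apply: polyfunM; [exact: polyfun_cst|exact: polyfun_bubble_field].
transitivity (\sum_k integ (hull (T k)) (fun x => dot (p k) (U k x))).
  apply: (integ_mesh oD lipD hT) => // k x ox.
  rewrite (vE k); last exact: open_hull_sub.
  by rewrite (grad_open_hull (ndT k) (F := fun x => dot (p k) x + q k)) ?grad_dot//; exact: wE.
apply/esym/(integ_mesh oD lipD hT) => // k x ox.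
rewrite (vE k); last exact: open_hull_sub.
rewrite (grad_open_hull (ndT k) (F := fun x => dot (p k) x + (q k - m))) ?grad_dot//.
by move=> y hy; rewrite (wE k)// addrA.
Qed.

End discrete_green.

Section facet_facts.
Context {R : realType} {n : nat}.
Local Notation E := 'rV[R]_n.+1.
Variables (V : simplex R n) (j : 'I_n.+2).

Lemma facet_param_continuous (f : E -> R) : continuous f -> continuous (f \o facet_param V j).
Proof.
move=> cf; rewrite (_ : f \o _ = fun s => f (bary_ref s *m row' j V)).
  exact: continuous_comp_bary_ref.
by apply/funext => s; rewrite /= facet_paramE.
Qed.

Lemma facet_intB (f g : E -> R) : continuous f -> continuous g ->
  facet_int V j (fun x => f x - g x) = facet_int V j f - facet_int V j g.
Proof.
move=> cf cg; rewrite !facet_intE -mulrBr /simplex_int RintegralB//.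
- exact: measurable_ref_simplex.
- exact: simplex_int_integrable.
- exact: simplex_int_integrable.
Qed.

Lemma facet_jac_ge0 : 0 <= facet_jac V j.
Proof. exact: sqrtr_ge0. Qed.

Lemma facet_norm_lty (p M : R) (f : E -> R) : 0 < p ->
  (forall s, ref_simplex s -> `|f (facet_param V j s)| <= M) ->
  (facet_norm p V j f < +oo)%E.
Proof.
move=> p0 fM; apply: poweR_lty; rewrite lte_mul_pinfty ?lee_fin ?facet_jac_ge0//.
apply: (@le_lt_trans _ _ (\int[@lebesgue_rV R n]_(x in ref_simplex) (M `^ p)%:E)%E).
  rewrite [leLHS]integral_mkcond [leRHS]integral_mkcond; apply: le_integralT => s.
    have [hs|hs] := pselect (ref_simplex s); last by rewrite patch_out.
    by rewrite patch_in// lee_fin powR_ge0.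
  have [hs|hs] := pselect (ref_simplex s); last by rewrite !patch_out.
  rewrite !patch_in// lee_fin; apply: ge0_ler_powR => //; first exact: ltW.
    by rewrite nnegrE (le_trans _ (fM _ hs)).
  exact: fM.
rewrite integral_cst; last exact: measurable_ref_simplex.
have h : (@lebesgue_rV R n (@ref_simplex R n) < +oo)%E by rewrite lebesgue_ref_simplex ltry.
by apply: lte_mul_pinfty => //; rewrite lee_fin powR_ge0.
Qed.

Lemma facet_norm0 (p : R) (f : E -> R) : 0 < p ->
  (forall s, ref_simplex s -> f (facet_param V j s) = 0) -> facet_norm p V j f = 0%E.
Proof.
move=> p0 f0; rewrite /facet_norm integral0_eq ?mule0 ?poweR0r ?invr_neq0 ?gt_eqF//.
by move=> s /f0 ->; rewrite normr0 powR0 ?gt_eqF.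
Qed.

End facet_facts.

(** * Test functions supported in one element *)

Section test_functions.
Context {R : realType} {n : nat}.
Variables (D : set 'rV[R]_n.+1) (T : mesh R n).
Hypotheses (oD : open D) (lipD : lipschitz_boundary D)
  (hT : conforming_triangulation D T) (bD : bounded_set D) (D0 : D !=set0).
Local Notation E := 'rV[R]_n.+1.
Local Notation lam := (@lebesgue_rV R n.+1).
Implicit Types (l : 'I_(nelt T)) (j : 'I_n.+2).
Variables (k : 'I_(nelt T)) (Q : E -> R).
Hypotheses (pQ : polyfun Q)
  (Q0 : forall j x, ~ facet (T k) j `<=` boundary D -> facet (T k) j x -> Q x = 0).

Let ndT l : nondegenerate_simplex (T l).
Proof. by case: hT. Qed.

Definition elt_fun : E -> R := Q \_ (hull (T k)).
Definition elt_mean : R := integ D elt_fun / fine (lam D).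
Definition elt_test (x : E) : R := elt_fun x - elt_mean.
Definition elt_grad : E -> E := patch (fun=> 0) (hull (T k)) (grad Q).
(** The polynomial that the test function equals inside element [l]. Traces are taken from inside,
    so a shared facet receives one for each side. *)
Definition elt_trace l (x : E) : R := (l == k)%:R * Q x - elt_mean.

Lemma polyfun_elt_trace l : polyfun (elt_trace l).
Proof.
apply: polyfunD; last exact: polyfun_cst.
by apply: polyfunM => //; exact: polyfun_cst.
Qed.

Lemma elt_funE l x : ~ mesh_null T x -> hull (T l) x -> elt_fun x = (l == k)%:R * Q x.
Proof.
move=> nx hl; have [lk|lk] := eqVneq l k; first by rewrite mul1r /elt_fun patch_in// -lk.
rewrite mul0r /elt_fun patch_out// => hk; apply: nx; exists k => //.
by apply: (mesh_overlap hT _ hk hl) => kl; rewrite kl eqxx in lk.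
Qed.

Lemma elt_gradE l x : ~ mesh_null T x -> hull (T l) x ->
  elt_grad x = (l == k)%:R *: grad Q x.
Proof.
move=> nx hl; have [lk|lk] := eqVneq l k; first by rewrite scale1r /elt_grad patch_in// -lk.
rewrite scale0r /elt_grad patch_out// => hk; apply: nx; exists k => //.
by apply: (mesh_overlap hT _ hk hl) => kl; rewrite kl eqxx in lk.
Qed.

Lemma grad_elt_trace l x : grad (elt_trace l) x = (l == k)%:R *: grad Q x.
Proof.
apply/rowP => i; rewrite [LHS]mxE [RHS]mxE [X in _ * X]mxE.
have dQ : derivable Q x (delta_mx ord0 i) by exact: polyfun_derivable.
have dc (c : R) : derivable (fun _ : E => c) x (delta_mx ord0 i) by exact: derivable_cst.
transitivity (partial i (fun x => (l == k)%:R * Q x) x + partial i (fun=> - elt_mean) x).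
  exact: (partialD (derivableM (dc _) dQ) (dc _)).
rewrite partial_cst addr0.
transitivity ((l == k)%:R * partial i Q x + Q x * partial i (fun=> (l == k)%:R) x).
  exact: (partialM (dc _) dQ).
by rewrite partial_cst mulr0 addr0.
Qed.

Let mhull l : measurable (hull (T l)).
Proof. exact: measurable_hull. Qed.

Lemma measurable_elt_fun : measurable_fun [set: E] elt_fun.
Proof.
apply/(measurable_restrictT _ (mhull k)); apply: measurable_funTS.
by apply: continuous_measurable_rV; exact: polyfun_continuous.
Qed.

Lemma measurable_elt_grad : measurable_fun [set: E] elt_grad.
Proof.
apply: measurable_fun_rV => i.
rewrite (_ : (fun x => _) = (partial i Q) \_ (hull (T k))).
  apply/(measurable_restrictT _ (mhull k)); apply: measurable_funTS.
  apply: continuous_measurable_rV; apply: polyfun_continuous.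
  exact: polyfun_partial.
apply/funext => x; rewrite /elt_grad.
have [hx|hx] := pselect (hull (T k) x); last by rewrite !patch_out// [LHS]mxE.
by rewrite !patch_in// [LHS]mxE.
Qed.

Lemma elt_fun_bound : exists2 M, 0 <= M & forall x, `|elt_fun x| <= M.
Proof.
have [M M0 hM] := compact_bound (compact_hull (ndT k)) (polyfun_continuous pQ).
exists M => // x; rewrite /elt_fun; have [hx|hx] := pselect (hull (T k) x).
  by rewrite patch_in// hM.
by rewrite patch_out// normr0.
Qed.

Lemma elt_grad_bound : exists2 M, 0 <= M & forall x, enorm (elt_grad x) <= M.
Proof.
have cg : continuous (fun x => \sum_i `|partial i Q x|).
  apply: continuous_sum => i x; apply: continuous_comp; last exact: norm_continuous.
  exact/polyfun_continuous/polyfun_partial.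
have [M M0 hM] := compact_bound (compact_hull (ndT k)) cg.
exists M => // x; rewrite /elt_grad; have [hx|hx] := pselect (hull (T k) x).
  rewrite patch_in//; apply: (le_trans (enorm_le_sum _)).
  apply: (le_trans _ (hM x hx)); apply: (le_trans _ (ler_norm _)).
  by apply: ler_sum => i _; rewrite [grad _ _ _ _]mxE.
by rewrite patch_out// (_ : enorm 0 = 0)//; apply/eqP; rewrite enorm_eq0.
Qed.

Lemma boundary_test phi j l x : test_function D phi -> facet (T l) j `<=` boundary D ->
  facet (T l) j x -> phi x = 0.
Proof.
move=> [_ _ sD] fb fx; apply: contrapT => phix.
have [_ []] := fb x fx; move/interior_id : oD => ->.
by apply: sD; apply: subset_closure; exact/eqP.
Qed.

(** Integration by parts on each element. On boundary facets [phi] vanishes; on interior ones [Q]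
    does, and only the constant [- elt_mean] times [phi] is left, whose facet terms cancel in
    pairs. *)
Lemma weak_grad_elt_test : weak_grad D elt_test elt_grad.
Proof.
move=> phi tphi i; have [sphi cphi phiD] := tphi.
have Cphi : C1 phi by apply: Ck1_C1; exact: sphi.
have [cph cdph _] := Cphi.
have ctr l : continuous (elt_trace l) by exact/polyfun_continuous/polyfun_elt_trace.
have cQ l : continuous (fun x => (l == k)%:R * partial i Q x).
  apply: polyfun_continuous; apply: polyfunM; first exact: polyfun_cst.
  exact: polyfun_partial.
have c1 l : continuous (fun x => elt_trace l x * partial i phi x).
  by move=> x; exact: (cvgM (ctr l x) (cdph i x)).
have c2 l : continuous (fun x => (l == k)%:R * partial i Q x * phi x).
  by move=> x; exact: (cvgM (cQ l x) (cph x)).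
have openN l x : open_hull (T l) x -> elt_test x = elt_trace l x /\
    elt_grad x = (l == k)%:R *: grad Q x.
  move=> ox.
  rewrite /elt_test /elt_trace /elt_fun /elt_grad.
  have [<-|lk] := eqVneq l k.
    by rewrite !patch_in ?mul1r ?scale1r//; exact: open_hull_sub.
  have nk : ~ hull (T k) x.
    move=> hk; have [j _ /= xj] := mesh_overlap hT (elimN eqP lk) (open_hull_sub (ndT l) ox) hk.
    by have := ox j; rewrite xj ltxx.
  by rewrite !patch_out ?mul0r ?scale0r.
have E1 : integ D (fun x => elt_test x * partial i phi x) =
    \sum_l integ (hull (T l)) (fun x => elt_trace l x * partial i phi x).
  by apply: (integ_mesh oD lipD hT) => // l x /openN[-> _].
have E2 : integ D (fun x => elt_grad x ord0 i * phi x) =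
    \sum_l integ (hull (T l)) (fun x => (l == k)%:R * partial i Q x * phi x).
  by apply: (integ_mesh oD lipD hT) => // l x /openN[_ ->]; rewrite [_ ord0 i]mxE [grad _ _ _ _]mxE.
apply/eqP; rewrite E1 E2 -subr_eq0 opprK -big_split/=; apply/eqP.
pose e : E := delta_mx ord0 i.
pose w x := - elt_mean * phi x.
have cw : continuous w by move=> x; exact: (cvgM (cvg_cst _) (cph x)).
pose B (z : 'I_(nelt T) * 'I_n.+2) :=
  facet_int (T z.1) z.2 (fun x => w x * dot e (outer_normal (T z.1) z.2)).
transitivity (\sum_l \sum_j B (l, j)).
  apply: eq_bigr => l _.
  have Ctr : C1 (fun x => elt_trace l x * phi x).
    by apply: C1M => //; apply: polyfun_C1; exact: polyfun_elt_trace.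
  have := green_simplex_normal (ndT l) e Ctr.
  rewrite /integ -RintegralD//; first last.
  - by apply: compact_integrable => //; exact: compact_hull.
  - by apply: compact_integrable => //; exact: compact_hull.
  move=> G; transitivity (\sum_j dot (outer_normal (T l) j) e *
      facet_int (T l) j (fun x => elt_trace l x * phi x)).
    rewrite -G; apply: eq_Rintegral => x _; rewrite dot_delta [RHS]mxE.
    rewrite partialM; [|exact: (polyfun_derivable (polyfun_elt_trace l))|].
      have := grad_elt_trace l x; move/(congr1 (fun r : E => r ord0 i)).
      rewrite [LHS]mxE [RHS]mxE [grad _ _ _ _]mxE => ->; ring.
    by have [_ _ /(_ x (delta_mx ord0 i))[]] := Cphi.
  apply: eq_bigr => j _.
  transitivity (dot (outer_normal (T l) j) e * facet_int (T l) j w).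
    congr (_ * _); apply: eq_facet_int => x fx; rewrite /elt_trace /w.
    have [bd|nb] := pselect (facet (T l) j `<=` boundary D).
      by rewrite (boundary_test tphi bd fx) !mulr0.
    have [lk|lk] := eqVneq l k; last by rewrite mul0r sub0r.
    rewrite lk in fx nb.
    by rewrite (Q0 nb fx) mulr0 sub0r.
  rewrite /B /= !facet_intE mulrCA; congr (_ * _).
  rewrite /simplex_int -RintegralZl//; first last.
  - exact: (simplex_int_integrable (row' j (T l)) cw).
  - exact: measurable_ref_simplex.
  by apply: eq_Rintegral => s _; rewrite dotC mulrC.
rewrite pair_bigA/= (bigID (fun z => `[< facet (T z.1) z.2 `<=` boundary D >]))/=.
rewrite [X in X + _]big1 ?add0r; last first.
  move=> [l j]/= /asboolP bd; rewrite /B/= -[RHS](facet_int0 (T l) j).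
  by apply: eq_facet_int => x fx; rewrite /w (boundary_test tphi bd fx) mulr0 mul0r.
rewrite -[RHS](sum_interior_facets oD hT (w := w) (v := fun=> e) (W := fun=> w)
  (U := fun _ _ => e))//.
by move=> l a; exact: cst_continuous.
Qed.

Lemma in_M_elt_test : in_M D elt_test elt_grad.
Proof.
have /andP[D_gt0 Doo] := lebesgue_domain oD bD D0.
have mD : measurable D by exact: open_measurable_rV.
have [M M0 hM] := elt_fun_bound; have [M' M'0 hM'] := elt_grad_bound.
have mt : measurable_fun D elt_test.
  by apply: measurable_funB => //; apply: measurable_funTS; exact: measurable_elt_fun.
have hB x : D x -> `|elt_test x| <= M + `|elt_mean|.
  by move=> _; apply: (le_trans (ler_normB _ _)); rewrite lerD2r hM.
split; [split|split] => //.
- by split=> //; apply: (Lp_norm_lty (M := M + `|elt_mean|)).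
- split; first by apply: measurable_funTS; exact: measurable_elt_grad.
  apply: (Lp_norm_lty (M := M')) => // x _.
  by rewrite ger0_norm ?enorm_ge0.
- exact: weak_grad_elt_test.
- by split=> //; apply: (Lp_norm_lty (M := M + `|elt_mean|)).
- apply: integ_domainB => //; apply: (bounded_integrable (M := M)) => //.
  by apply: measurable_funTS; exact: measurable_elt_fun.
Qed.

(** Off a null set the test function is a polynomial on the element, so a constant approximating
    sequence is enough. *)
Lemma is_trace_elt_test l j :
  is_trace (3 / 2) (T l) j elt_test elt_grad (elt_trace l).
Proof.
have p0 : (0 : R) < 3 / 2 by [].
have ctr : continuous (elt_trace l) by exact/polyfun_continuous/polyfun_elt_trace.
have mN := measurable_mesh_null hT; have N0 := lebesgue_mesh_null hT.
split.
- apply: measurable_funTS; apply: continuous_measurable_rV.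
  exact: facet_param_continuous.
- have [M M0 hM] := compact_bound (compact_hull (ndT l)) ctr.
  apply: (facet_norm_lty (M := M)) => // s hs; apply: hM.
  by apply: (facet_sub_hull (ndT l) (j := j)); exact: ref_facet.
exists (fun=> elt_trace l); split.
- by move=> _; apply: polyfun_smooth; exact: polyfun_elt_trace.
- rewrite (_ : Lp_norm _ _ _ = 0%E); first exact: cvg_cst.
  rewrite -(Lp_norm0 (hull (T l)) p0); apply: (eq_Lp_norm_null _ mN N0) => x nx.
  have [hx|hx] := pselect (hull (T l) x); last by rewrite !patch_out.
  by rewrite !patch_in// /elt_trace /elt_test (elt_funE nx hx) subrr.
- rewrite (_ : vLp_norm _ _ _ = 0%E); first exact: cvg_cst.
  rewrite /vLp_norm -(Lp_norm0 (hull (T l)) p0); apply: (eq_Lp_norm_null _ mN N0) => x nx.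
  have [hx|hx] := pselect (hull (T l) x); last by rewrite !patch_out.
  rewrite !patch_in// (elt_gradE nx hx) grad_elt_trace subrr.
  by apply/eqP; rewrite enorm_eq0.
- rewrite (_ : facet_norm _ _ _ _ = 0%E); first exact: cvg_cst.
  by apply: facet_norm0 => // s _; rewrite subrr.
Qed.

End test_functions.

Lemma integ_hullB (R : realType) n (V : simplex R n) (f g : 'rV[R]_n.+1 -> R) :
  nondegenerate_simplex V -> continuous f -> continuous g ->
  integ (hull V) (fun x => f x - g x) = integ (hull V) f - integ (hull V) g.
Proof.
move=> hV cf cg; rewrite /integ RintegralB.
- by [].
- exact: measurable_hull.
- by apply: compact_integrable; [exact: compact_hull|exact: cf].
- by apply: compact_integrable; [exact: compact_hull|exact: cg].
Qed.

(** * The equation of the correction velocity tested on one element *)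

Section test_identity.
Context {R : realType} {n : nat}.
Variables (D : set 'rV[R]_n.+1) (T : mesh R n).
Hypotheses (oD : open D) (lipD : lipschitz_boundary D)
  (hT : conforming_triangulation D T) (bD : bounded_set D) (D0 : D !=set0).
Local Notation E := 'rV[R]_n.+1.
Local Notation lam := (@lebesgue_rV R n.+1).
Variables (v vr : E -> E) (r : (E -> R) -> E -> R) (ck ce c2 : R).
Hypotheses (Xv : in_Xh D T v)
  (Mh : forall q, in_Mh D T q -> integ D (fun x => dot (grad q x) (v x)) = 0)
  (cl : clement D T ck ce r) (corr : correction_velocity D T c2 r v vr).
Implicit Types (l : 'I_(nelt T)) (j : 'I_n.+2).

Let ndT l : nondegenerate_simplex (T l).
Proof. by case: hT. Qed.

Let mhull l : measurable (hull (T l)).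
Proof. exact: measurable_hull. Qed.

Lemma integ_hull0 l : integ (hull (T l)) (fun=> 0) = 0.
Proof. by rewrite /integ /Rintegral (_ : integral _ _ _ = 0%E)// integral0_eq. Qed.

Variables (k : 'I_(nelt T)) (Q : E -> R).
Hypotheses (pQ : polyfun Q)
  (Q0 : forall j x, ~ facet (T k) j `<=` boundary D -> facet (T k) j x -> Q x = 0).
Local Notation G := (elt_grad k Q).

(** The interpolant depends on the test function in an arbitrary, nonlocal way, but it is continuous
    P1: its total flux is zero, and what is left is supported in element [k]. *)
Lemma test_identity : integ D (fun x => dot (G x) (vr x)) =
  integ (hull (T k)) (fun x => Q x * divergence v x) -
  \sum_j facet_int (T k) j (fun x => phi1 D v k j x * Q x).
Proof.
have inM := in_M_elt_test oD lipD hT bD D0 pQ Q0.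
have [Pr _ _] := cl inM.1.
have [_ corrE _] := corr.
rewrite (corrE _ _ inM (fun l _ => elt_trace D k Q l)); last first.
  by move=> l j; exact: is_trace_elt_test.
set q := elt_test D k Q; set m := elt_mean D k Q.
(* The interpolant together with the subtracted mean, so that [q - r q] is [cQ l - w] on element [l]
   off the skeleton. *)
pose w x := r q x - (- m).
have Pw : in_P1c D T w by exact: in_P1cB.
have [a [b [c vE]]] := in_Xh_bubble Xv.
have [p [s wE]] := in_P1c_affine Pw.
pose U l := bubble_field (T l) (a l) (b l) (c l).
pose W l (x : E) : R := dot (p l) x + s l.
have pU l i : polyfun (fun x => U l x ord0 i) by exact: polyfun_bubble_field.
have pW l : polyfun (W l) by exact: polyfun_affine.
have pdiv l : polyfun (divergence (U l)).
  by apply: polyfun_sum => i _; exact: polyfun_partial.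
pose cQ l x := (l == k)%:R * Q x.
have pcQ l : polyfun (cQ l) by apply: polyfunM => //; exact: polyfun_cst.
(* A polynomial equal to [phi1] on the facet; its continuity justifies splitting the facet
   integrals. *)
pose Phi l j x : R := if `[< facet (T l) j `<=` boundary D >]
  then dot (U l x) (outer_normal (T l) j) else 0.
have pPhi l j : polyfun (Phi l j).
  rewrite /Phi; case: asboolP => _; last exact: polyfun_cst.
  by apply: polyfun_sum => i _; apply: polyfunM; [exact: pU|exact: polyfun_cst].
have PhiE l j x : facet (T l) j x -> phi1 D v l j x = Phi l j x.
  move=> fx; rewrite /Phi; case: asboolP => fb; last first.
    by rewrite (phi1_interior oD hT)//; case: Xv.
  rewrite /phi1; case: asboolP => // _.
  by rewrite (vE l)//; exact: (facet_sub_hull (ndT l) fx).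
have divE l x : open_hull (T l) x -> divergence v x = divergence (U l) x.
  by move=> ox; apply: (divergence_open_hull (ndT l)) ox => y; exact: vE.
pose A l := integ (hull (T l)) (fun x => cQ l x * divergence (U l) x) -
  \sum_j facet_int (T l) j (fun x => Phi l j x * cQ l x).
have splitE l : integ (hull (T l)) (fun x => (q x - r q x) * divergence v x) -
    \sum_j facet_int (T l) j (fun x => phi1 D v l j x * (elt_trace D k Q l x - r q x)) =
    A l - (integ (hull (T l)) (fun x => w x * divergence v x) -
    \sum_j facet_int (T l) j (fun x => phi1 D v l j x * w x)).
  have -> : integ (hull (T l)) (fun x => (q x - r q x) * divergence v x) =
      integ (hull (T l)) (fun x => cQ l x * divergence (U l) x) -
      integ (hull (T l)) (fun x => w x * divergence v x).
    transitivity (integ (hull (T l)) (fun x =>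
        cQ l x * divergence (U l) x - W l x * divergence (U l) x)).
      apply: (eq_Rintegral_null (measurable_mesh_null hT) (lebesgue_mesh_null hT)) => x nx.
      have [hx|hx] := pselect (hull (T l) x); last by rewrite !patch_out.
      have ox : open_hull (T l) x by case: (mesh_null_hull oD lipD hT nx hx).
      rewrite !patch_in// (divE l)// /W -(wE l)// /w /q /elt_test (elt_funE hT k Q nx hx).
      by rewrite -/(cQ l x) -/q -/m; ring.
    rewrite (integ_hullB (ndT l) (polyfun_continuous (polyfunM (pcQ l) (pdiv l)))
      (polyfun_continuous (polyfunM (pW l) (pdiv l)))).
    have e1 : integ (hull (T l)) (fun x => w x * divergence v x) =
        integ (hull (T l)) (fun x => W l x * divergence (U l) x).
      apply: (integ_hull_eq oD lipD hT) => x ox.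
      by rewrite (divE l)// (wE l)//; exact: open_hull_sub.
    by rewrite e1.
  have fE j : facet_int (T l) j (fun x => phi1 D v l j x * (elt_trace D k Q l x - r q x)) =
      facet_int (T l) j (fun x => Phi l j x * cQ l x) -
      facet_int (T l) j (fun x => phi1 D v l j x * w x).
    have -> : facet_int (T l) j (fun x => phi1 D v l j x * w x) =
        facet_int (T l) j (fun x => Phi l j x * W l x).
      apply: eq_facet_int => x fx; rewrite PhiE// (wE l)//.
      exact: (facet_sub_hull (ndT l) fx).
    rewrite -facet_intB; first last.
    - exact: (polyfun_continuous (polyfunM (pPhi l j) (pW l))).
    - exact: (polyfun_continuous (polyfunM (pPhi l j) (pcQ l))).
    apply: eq_facet_int => x fx; rewrite PhiE// /W -(wE l); last exact: (facet_sub_hull (ndT l) fx).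
    by rewrite /w /elt_trace -/(cQ l x) -/m; ring.
  under eq_bigr do rewrite fE.
  have alg (x y z t : R) : x - y - (z - t) = x - z - (y - t) by ring.
  by rewrite sumrB; exact: alg.
under eq_bigr do rewrite splitE.
rewrite sumrB -/(mesh_flux D T v w) (mesh_flux_eq0 oD lipD hT bD D0 Xv Pw Mh) subr0.
rewrite (bigD1 k)//= [X in _ + X]big1 ?addr0; last first.
  move=> l /negbTE lk; rewrite /A /cQ lk.
  rewrite (_ : integ _ _ = 0) ?sub0r; last first.
    by rewrite -[RHS](integ_hull0 l); apply: eq_Rintegral => x _; rewrite !mul0r.
  rewrite big1 ?oppr0// => j _; rewrite -[RHS](facet_int0 (T l) j).
  by apply: eq_facet_int => x _; rewrite mul0r mulr0.
have e1 : integ (hull (T k)) (fun x => Q x * divergence v x) =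
    integ (hull (T k)) (fun x => cQ k x * divergence (U k) x).
  by apply: (integ_hull_eq oD lipD hT) => x ox; rewrite (divE k)// /cQ eqxx mul1r.
have e2 j : facet_int (T k) j (fun x => phi1 D v k j x * Q x) =
    facet_int (T k) j (fun x => Phi k j x * cQ k x).
  by apply: eq_facet_int => x fx; rewrite (PhiE _ _ _ fx) /cQ eqxx mul1r.
by rewrite e1; under [in RHS]eq_bigr do rewrite e2.
Qed.

Lemma measurable_enorm : measurable_fun [set: E] (@enorm R n.+1).
Proof. by apply: continuous_measurable_rV; exact: continuous_enorm. Qed.

(** Hölder's inequality with exponents 3/2 and 3 on the support of the gradient; the sup bound [B]
    brings the volume of the element to the power 2/3. *)
Lemma test_bound (B : R) : 0 <= B ->
  (forall x, hull (T k) x -> enorm (grad Q x) <= B) ->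
  (`|integ D (fun x => dot (G x) (vr x))|%:E <=
   (B * fine (lam (hull (T k))) `^ (2 / 3))%:E * vLp_norm 3%:E (elt_patch T k) vr)%E.
Proof.
move=> B0 gB; have [[mvr vroo] _ _] := corr.
have mD : measurable D by exact: open_measurable_rV.
have hoo : (lam (hull (T k)) < +oo)%E.
  apply: bounded_lebesgue_lty => //; apply: compact_bounded; exact: compact_hull.
(* [vr] is measurable on [D] only, and the closed element may contain boundary points outside
   [D]. *)
pose A := D `&` hull (T k).
have mA : measurable A by exact: measurableI.
pose f : E -> R := (fun=> B) \_ A.
pose g : E -> R := (fun x => enorm (vr x)) \_ A.
pose h : E -> R := (fun x => dot (G x) (vr x)) \_ D.
have mf : measurable_fun [set: E] f.
  by apply/(measurable_restrictT _ mA).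
have mg : measurable_fun [set: E] g.
  apply/(measurable_restrictT _ mA).
  apply: measurable_funS mD _ _; first by move=> x [].
  exact: (measurableT_comp measurable_enorm).
have mh : measurable_fun [set: E] h.
  apply/(measurable_restrictT _ mD).
  apply: measurable_sum => i; apply: measurable_funM.
    apply: measurable_funTS; apply: (measurableT_comp (measurable_coord i)).
    exact: (measurable_elt_grad hT k pQ).
  exact: (measurableT_comp (measurable_coord i)).
have hfg x : `|h x| <= `|f x * g x|.
  rewrite /h /f /g; have [Dx|Dx] := pselect (D x); last first.
    by rewrite patch_out// normr0 normr_ge0.
  rewrite patch_in// /elt_grad; have [hx|hx] := pselect (hull (T k) x); last first.
    by rewrite patch_out// dot0l normr0 normr_ge0.
  rewrite !patch_in//; apply: (le_trans (dot_le _ _)).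
  rewrite ger0_norm ?mulr_ge0 ?enorm_ge0//.
  by apply: ler_wpM2r; [exact: enorm_ge0|exact: gB].
have hol := @hoelder _ _ _ lam f g (3 / 2) 3 mf mg.
have {hol} : ('N[lam]_1[(EFin \o (f \* g)%R)] <= 'N[lam]_(3 / 2)%:E[EFin \o f] * 'N[lam]_3%:E[EFin \o g])%E.
  by apply: hol => //; rewrite invf_div; lra.
have gE : ('N[lam]_3%:E[EFin \o g] <= vLp_norm 3%:E (elt_patch T k) vr)%E.
  apply: le_Lp_norm => // x [_ hx]; exists k => //=.
  by exists x.
have goo : ('N[lam]_3%:E[EFin \o g] < +oo)%E.
  apply: le_lt_trans vroo; apply: le_Lp_norm => //; by move=> x [].
have fE : ('N[lam]_(3 / 2)%:E[EFin \o f] <= (B * fine (lam (hull (T k))) `^ (2 / 3))%:E)%E.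
  rewrite unlock.
  apply: (@le_trans _ _ (((B `^ (3 / 2))%:E * lam (hull (T k))) `^ (2 / 3))%E).
    rewrite invf_div; apply: gt0_ler_poweR => //.
    - by rewrite in_itv/= leey andbT; apply: integral_ge0 => x _; rewrite lee_fin powR_ge0.
    - by rewrite in_itv/= leey andbT mule_ge0// lee_fin powR_ge0.
    rewrite -integral_cst; last exact: mhull.
    rewrite [leRHS]integral_mkcond; apply: le_integralT => x.
      by rewrite ?lee_fin ?powR_ge0 ?poweR_ge0.
    rewrite /f /=; have [hx|hx] := pselect (A x); last first.
      rewrite patch_out//= normr0 powR0 ?gt_eqF//.
      by have [hx'|hx'] := pselect (hull (T k) x); [rewrite patch_in// lee_fin powR_ge0|rewrite patch_out].
    by rewrite patch_in//= patch_in ?ger0_norm//; case: hx.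
  rewrite -[X in (_ * X)%E]fineK ?ge0_fin_numE// -EFinM poweR_EFin lee_fin.
  rewrite powRM ?powR_ge0 ?fine_ge0// -powRrM (_ : 3 / 2 * (2 / 3) = 1 :> R); last by field.
  by rewrite powRr1.
(* The real integral is the finite part of an extended one; integrability ensures that taking it
   loses nothing. *)
move=> H; have Ih : lam.-integrable [set: E] (EFin \o h).
  apply/integrableP; split; first exact/measurable_EFinP.
  apply: (@le_lt_trans _ _ ('N[lam]_1[(EFin \o (f \* g)%R)])%E).
    rewrite Lnorm1; apply: le_integralT => x; first by rewrite abse_ge0.
    by rewrite lee_fin hfg.
  apply: (le_lt_trans H); apply: lte_mul_pinfty => //.
    exact: Lnorm_ge0.
    by rewrite ge0_fin_numE ?Lnorm_ge0// (le_lt_trans fE) ?ltry.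
have -> : integ D (fun x => dot (G x) (vr x)) = (\int[lam]_x h x)%R.
  by apply: eq_Rintegral_null measurable0 (measure0 _) _ => x _; rewrite [RHS]patch_in.
apply: (@le_trans _ _ ('N[lam]_1[(EFin \o (f \* g)%R)])%E).
  rewrite Lnorm1; apply: (@le_trans _ _ (\int[lam]_x `|(EFin \o h) x|)%E); last first.
    by apply: le_integralT => x; [rewrite abse_ge0|rewrite lee_fin hfg].
  have mE : measurable_fun [set: E] (EFin \o h) by exact/measurable_EFinP.
  have := le_abse_integral lam measurableT mE.
  apply: le_trans; rewrite -abse_EFin /Rintegral fineK//.
  exact: integrable_fin_num Ih.
by apply: (le_trans H); apply: lee_pmul => //; exact: Lnorm_ge0.
Qed.

End test_identity.

Lemma continuous_mul (R : realType) (T : topologicalType) (f g : T -> R) :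
  continuous f -> continuous g -> continuous (fun x => f x * g x).
Proof. by move=> cf cg x; exact: (continuousM (cf x) (cg x)). Qed.

(** * Norm equivalences and scaling *)

Section gram.
Context {R : realType} {m : nat}.
Local Notation lam := (@lebesgue_rV R m).
Local Notation S := (@ref_simplex R m).

Lemma bary_ref_surj (l : 'rV[R]_m.+1) : \sum_i l ord0 i = 1 ->
  exists s : 'rV[R]_m, bary_ref s = l.
Proof.
move=> l1; exists (\row_i l ord0 (lift ord0 i)); apply/rowP => i.
have [k ->|->] := unliftP ord0 i; first by rewrite bary_refS mxE.
rewrite bary_ref0 -l1 big_ord_recl.
by under [X in _ - X]eq_bigr do rewrite mxE; rewrite addrK.
Qed.

Lemma ref_simplex_closure (s : 'rV[R]_m) : S s ->
  closure [set t | forall i, 0 < bary_ref t ord0 i] s.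
Proof.
move=> hs B Bs.
have [c cE] : exists c : 'rV[R]_m, bary_ref c = const_mx (m.+1%:R^-1).
  apply: bary_ref_surj; under eq_bigr do rewrite mxE.
  by rewrite sumr_const card_ord -[LHS]mulr_natr mulVf// pnatr_eq0.
have h1 : \forall e \near (0 : R)^'+, 0 < e by exact: nbhs_right_gt.
have h2 : \forall e \near (0 : R)^'+, e < 1 by exact: nbhs_right_lt.
have cl : (fun e : R => s + e *: (c - s)) e @[e --> 0^'+] --> s + (0 : R) *: (c - s).
  apply: cvg_at_right_filter; apply: cvgD; first exact: cvg_cst.
  by apply: cvgZr_tmp; exact: cvg_id.
have h3 : \forall e \near (0 : R)^'+, B (s + e *: (c - s)).
  by apply: (cl B); rewrite scale0r addr0.
have : \forall e \near (0 : R)^'+, [/\ 0 < e, e < 1 & B (s + e *: (c - s))].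
  by apply: filterS3 h1 h2 h3 => e.
move=> /filter_ex[e [e0 e1 Be]].
exists (s + e *: (c - s)); split => // i.
have -> : bary_ref (s + e *: (c - s)) ord0 i =
    (1 - e) * bary_ref s ord0 i + e * bary_ref c ord0 i.
  have L j : (s + e *: (c - s)) ord0 j = (1 - e) * s ord0 j + e * c ord0 j.
    rewrite [LHS]mxE [X in _ + X]mxE [X in _ * X]mxE [X in _ * (_ + X)]mxE; ring.
  have [k ->|->] := unliftP ord0 i; first by rewrite !bary_refS L.
  rewrite !bary_ref0; under eq_bigr do rewrite L.
  by rewrite big_split/= -!mulr_sumr; ring.
rewrite cE [const_mx _ _ _]mxE; apply: ltr_wpDl; last by rewrite mulr_gt0// invr_gt0.
by apply: mulr_ge0; [rewrite subr_ge0 ltW|exact: (ref_simplexP s).1].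
Qed.

Lemma ref_integral_gt0 (f : 'rV[R]_m -> R) (s : 'rV[R]_m) : continuous f ->
  (forall t, S t -> 0 <= f t) -> S s -> f s != 0 -> 0 < (\int[lam]_(t in S) f t)%R.
Proof.
move=> cf f0 Ss fs.
have [t [/= ft ti]] : exists t, f t != 0 /\ forall i, 0 < bary_ref t ord0 i.
  have [t [ti ft]] : [set t | forall i, 0 < bary_ref t ord0 i] `&` [set t | f t != 0] !=set0.
    apply: (ref_simplex_closure Ss); apply: open_nbhs_nbhs; split => //.
    by apply: (open_comp (f := f) (D := [set x | x != 0]));
      [move=> ? _; exact: cf|exact: open_neq].
  by exists t.
have St : nbhs t S by exact: ref_simplex_interior.
have ft0 : 0 < f t by rewrite lt_neqAle eq_sym ft f0//; exact: nbhs_singleton St.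
have : nbhs t (S `&` [set x | f t / 2 < f x]).
  apply: filterI => //; apply: open_nbhs_nbhs; split.
    by apply: (open_comp (f := f) (D := [set x | f t / 2 < x]));
      [move=> ? _; exact: cf|exact: open_gt].
  by rewrite /= ltr_pdivrMr// ltr_pMr// ltr1n.
rewrite nbhsE => -[U [oU Ut] Usub].
have mS : measurable S by exact: measurable_ref_simplex.
have mU : measurable U by exact: open_measurable_rV.
have If : lam.-integrable S (EFin \o f).
  by apply: compact_integrable => //; exact: compact_ref_simplex.
have U0 : (0 < lam U)%E by apply: open_lebesgue_gt0 => //; exists t.
rewrite fine_gt0//; apply/andP; split; last first.
  rewrite -ge0_fin_numE; first exact: integrable_fin_num If.
  by apply: integral_ge0 => x Sx; rewrite lee_fin f0.
apply: (@lt_le_trans _ _ (\int[lam]_(x in U) (f t / 2)%:E)%E).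
  by rewrite integral_cst// mule_gt0// lte_fin divr_gt0.
rewrite [leLHS]integral_mkcond [leRHS]integral_mkcond; apply: le_integralT => x.
  have [Ux|Ux] := pselect (U x); last by rewrite patch_out.
  by rewrite patch_in// lee_fin divr_ge0// ltW.
have [Ux|Ux] := pselect (U x).
  by have [Sx /ltW fx] := Usub x Ux; rewrite !patch_in.
rewrite patch_out//; have [Sx|Sx] := pselect (S x); last by rewrite patch_out.
by rewrite patch_in// lee_fin f0.
Qed.

Variables (N : nat) (w : 'rV[R]_m -> R) (e : 'I_N -> 'rV[R]_m -> R).
Hypotheses (cw : continuous w) (ce : forall k, continuous (e k)).
Hypotheses (w_ge0 : forall s, S s -> 0 <= w s)
  (w_gt0 : forall s, (forall i, 0 < bary_ref s ord0 i) -> 0 < w s).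
Hypothesis e_free : forall y : 'rV[R]_N,
  (forall s, S s -> \sum_k y ord0 k * e k s = 0) -> y = 0.

Let F (y : 'rV[R]_N) s := w s * (\sum_k y ord0 k * e k s) ^+ 2.
Let Phi y := (\int[lam]_(s in S) F y s)%R.

Let cF y : continuous (F y).
Proof.
have cs : continuous (fun s => \sum_k y ord0 k * e k s).
  by apply: continuous_sum => k; apply: continuous_mul => //; exact: cst_continuous.
by apply: continuous_mul => //; exact: continuous_mul.
Qed.

Let F_ge0 y s : S s -> 0 <= F y s.
Proof. by move=> Ss; rewrite mulr_ge0 ?sqr_ge0 ?w_ge0. Qed.

Let Phi_gt0 y : y != 0 -> 0 < Phi y.
Proof.
move=> y0.
have cs : continuous (fun s => \sum_k y ord0 k * e k s).
  by apply: continuous_sum => k; apply: continuous_mul => //; exact: cst_continuous.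
have [s [Ss sN]] : exists s, S s /\ \sum_k y ord0 k * e k s != 0.
  apply: contrapT => H; move/eqP : y0; apply; apply: e_free => s Ss.
  by apply: contrapT => /eqP sN; apply: H; exists s.
have [t [ti /= tN]] : [set t | forall i, 0 < bary_ref t ord0 i] `&`
    [set t | \sum_k y ord0 k * e k t != 0] !=set0.
  apply: (ref_simplex_closure Ss); apply: open_nbhs_nbhs; split => //.
  by apply: (open_comp (f := fun s => \sum_k y ord0 k * e k s) (D := [set x | x != 0]));
    [move=> ? _; exact: cs|exact: open_neq].
apply: (ref_integral_gt0 (s := t)); [exact: cF|exact: F_ge0| |].
  by apply/ref_simplexP => i; exact: ltW.
by rewrite mulf_neq0// ?expf_neq0// gt_eqF// w_gt0.
Qed.

Let PhiE y : Phi y = \sum_k \sum_l y ord0 k * y ord0 l *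
  (\int[lam]_(s in S) (w s * (e k s * e l s)))%R.
Proof.
have mS : measurable S by exact: measurable_ref_simplex.
have ci k l : continuous (fun s => w s * (e k s * e l s)).
  by apply: continuous_mul => //; exact: continuous_mul.
have Ii k l : lam.-integrable S (EFin \o (fun s => w s * (e k s * e l s))).
  by apply: compact_integrable; [exact: compact_ref_simplex|exact: ci].
have Iy k l : lam.-integrable S
    (EFin \o (fun s => y ord0 k * y ord0 l * (w s * (e k s * e l s)))).
  apply: compact_integrable; first exact: compact_ref_simplex.
  by apply: continuous_mul => //; exact: cst_continuous.
have I1 k := Rintegral_fsum (index_enum 'I_N) mS (Iy k).
have [_ I2] := Rintegral_fsum (index_enum 'I_N) mS (fun k => (I1 k).1).
transitivity (\int[lam]_(s in S) (\sum_k \sum_l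
    (y ord0 k * y ord0 l * (w s * (e k s * e l s)))))%R.
  apply: eq_Rintegral => s _; rewrite /F expr2 mulr_suml mulr_sumr.
  apply: eq_bigr => k _; rewrite mulr_sumr mulr_sumr; apply: eq_bigr => l _; ring.
rewrite I2; apply: eq_bigr => k _; rewrite (I1 k).2; apply: eq_bigr => l _.
by rewrite RintegralZl.
Qed.

Let cPhi : continuous Phi.
Proof.
have -> : Phi = fun y => \sum_k \sum_l y ord0 k * y ord0 l *
    (\int[lam]_(s in S) (w s * (e k s * e l s)))%R.
  by apply/funext => y; exact: PhiE.
apply: continuous_sum => k; apply: continuous_sum => l.
apply: continuous_mul; last exact: cst_continuous.
by apply: continuous_mul; exact: continuous_coord.
Qed.

(** [Phi] is a continuous quadratic form. It is positive off 0, since a combination that is nonzero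
    somewhere on the simplex is nonzero at an interior point, where the weight is positive. The
    constant is its minimum on the unit sphere. *)
Lemma gram_pos : exists2 c, 0 < c & forall y : 'rV[R]_N,
  c * enorm y ^+ 2 <= (\int[lam]_(s in S) (w s * (\sum_k y ord0 k * e k s) ^+ 2))%R.
Proof.
have PhiZ (a : R) y : Phi (a *: y) = a ^+ 2 * Phi y.
  rewrite !PhiE mulr_sumr; apply: eq_bigr => k _; rewrite mulr_sumr.
  by apply: eq_bigr => l _; rewrite !mxE; ring.
have Phi0 : Phi 0 = 0 by rewrite -(scale0r (0 : 'rV[R]_N)) PhiZ expr0n mul0r.
pose sph := [set y : 'rV[R]_N | enorm y = 1].
(* The sphere is empty when [N] is 0; any constant then works. *)
have [[y0 hy0]|sph0] := pselect (sph !=set0); last first.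
  exists 1 => // y; have [->|yN] := eqVneq y 0.
    by rewrite -/(Phi 0) Phi0 (_ : enorm 0 = 0) ?expr0n ?mulr0//; apply/eqP; rewrite enorm_eq0.
  exfalso; apply: sph0; exists ((enorm y)^-1 *: y).
  by rewrite /sph /= enormZ ger0_norm ?invr_ge0 ?enorm_ge0// mulVf// enorm_eq0.
have csph : compact sph.
  apply: bounded_closed_compact.
    exists 1; split; first exact: num_real.
    move=> M M1 y /= ey; rewrite [`|y|]mx_normrE; apply: bigmax_le; first by rewrite ltW// (lt_trans _ M1).
    move=> [i j] _ /=; rewrite (ord1 i); apply: (le_trans (coord_le_enorm _ _)).
    by rewrite ey ltW.
  by apply: (preimage_closed (f := @enorm R N) (D := [set 1]));
    [move=> ? _; exact: continuous_enorm|exact: closed_eq].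
have [z zs zmin] : exists2 z, sph z & forall y, sph y -> Phi z <= Phi y.
  have h0 : sph !=set0 by exists y0.
  have [z /set_mem zs zm] := EVT_min_rV h0 csph (continuous_subspaceT cPhi).
  by exists z => // y ys; apply: zm; exact: mem_set.
have zN : z != 0 by apply/eqP => z0; move: zs; rewrite /sph /= z0 (_ : enorm 0 = 0); [move=> /esym/eqP; rewrite oner_eq0|apply/eqP; rewrite enorm_eq0].
exists (Phi z); first exact: Phi_gt0.
move=> y; rewrite -/(F y) -/(Phi y); have [->|yN] := eqVneq y 0.
  by rewrite Phi0 (_ : enorm 0 = 0) ?expr0n ?mulr0//; apply/eqP; rewrite enorm_eq0.
have eN : enorm y != 0 by rewrite enorm_eq0.
have -> : Phi y = Phi ((enorm y)^-1 *: y) * enorm y ^+ 2.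
  by rewrite PhiZ mulrAC -exprMn mulVf// expr1n mul1r.
apply: ler_wpM2r; first exact: sqr_ge0.
by apply: zmin; rewrite /sph /= enormZ ger0_norm ?invr_ge0 ?enorm_ge0// mulVf.
Qed.

End gram.

Section bary_polynomials.
Context {R : realType} {n : nat}.
Local Notation E := 'rV[R]_n.+1.
Local Notation B := 'rV[R]_n.+2.

Lemma polyfun_partialD (f g : E -> R) i x : polyfun f -> polyfun g ->
  partial i (fun x => f x + g x) x = partial i f x + partial i g x.
Proof. by move=> pf pg; apply: partialD; exact: polyfun_derivable. Qed.

Lemma polyfun_partialM (f g : E -> R) i x : polyfun f -> polyfun g ->
  partial i (fun x => f x * g x) x = f x * partial i g x + g x * partial i f x.
Proof. by move=> pf pg; apply: partialM; exact: polyfun_derivable. Qed.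

Lemma polyfun_comp_bary (V : simplex R n) (P : B -> R) : polyfun P ->
  polyfun (fun x => P (bary V x)).
Proof.
elim=> [c|i|f g _ pf _ pg|f g _ pf _ pg].
- exact: polyfun_cst.
- exact: polyfun_bary.
- exact: polyfunD.
- exact: polyfunM.
Qed.

(** Plays the role of the inverse of the diameter: it bounds the derivatives of polynomials in the
    barycentric coordinates, and shape regularity bounds its product with the diameter. *)
Definition grad_sum (V : simplex R n) : R := \sum_j enorm (bary_grad V j).

Lemma grad_sum_ge0 V : 0 <= grad_sum V.
Proof. by apply: sumr_ge0 => j _; exact: enorm_ge0. Qed.

(** On the hull the coordinates lie between 0 and 1 and their derivatives are at most [grad_sum V];
    induction on [P] gives a constant that ignores the simplex. *)
Lemma poly_bary_bound (P : B -> R) : polyfun P ->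
  exists2 C, 0 <= C & forall (V : simplex R n) (x : E), nondegenerate_simplex V -> hull V x ->
    `|P (bary V x)| <= C /\
    forall i, `|partial i (fun x => P (bary V x)) x| <= C * grad_sum V.
Proof.
elim=> [c|j|f g pf [Cf Cf0 hf] pg [Cg Cg0 hg]|f g pf [Cf Cf0 hf] pg [Cg Cg0 hg]].
- exists `|c| => // V x hV hx; split => // i.
  by rewrite partial_cst normr0 mulr_ge0// grad_sum_ge0.
- exists 1 => // V x hV hx; split.
    by rewrite ger0_norm ?hull_bary_le1//; exact: (hullP hV x).1.
  move=> i; rewrite partial_bary mul1r; apply: (le_trans (coord_le_enorm _ _)).
  by rewrite /grad_sum (bigD1 j)//= lerDl sumr_ge0// => k _; exact: enorm_ge0.
- exists (Cf + Cg); first exact: addr_ge0.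
  move=> V x hV hx; have [f1 f2] := hf V x hV hx; have [g1 g2] := hg V x hV hx.
  split; first by apply: (le_trans (ler_normD _ _)); exact: lerD.
  move=> i; rewrite (polyfun_partialD _ _ (polyfun_comp_bary V pf) (polyfun_comp_bary V pg)).
  by apply: (le_trans (ler_normD _ _)); rewrite mulrDl lerD.
(* Doubled for the two terms of Leibniz' rule. *)
- exists (Cf * Cg *+ 2); first by rewrite mulrn_wge0// mulr_ge0.
  move=> V x hV hx; have [f1 f2] := hf V x hV hx; have [g1 g2] := hg V x hV hx.
  have fg0 : 0 <= Cf * Cg by exact: mulr_ge0.
  split.
    rewrite normrM; apply: (@le_trans _ _ (Cf * Cg)); first exact: ler_pM.
    by rewrite mulr2n lerDl.
  move=> i; rewrite (polyfun_partialM _ _ (polyfun_comp_bary V pf) (polyfun_comp_bary V pg)).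
  apply: (le_trans (ler_normD _ _)); rewrite !normrM mulr2n mulrDl; apply: lerD.
    by rewrite -mulrA; apply: ler_pM.
  by rewrite (mulrC Cf) -mulrA; apply: ler_pM.
Qed.

Lemma partial_lincomb (I : Type) (r : seq I) (c : I -> R) (F : I -> E -> R) i x :
  (forall k, polyfun (F k)) ->
  partial i (fun x => \sum_(k <- r) c k * F k x) x = \sum_(k <- r) c k * partial i (F k) x.
Proof.
move=> pF; elim: r => [|a r IH].
  rewrite big_nil -[RHS](partial_cst 0 i x); congr (partial i _ x).
  by apply/funext => y; rewrite big_nil.
rewrite big_cons -IH.
rewrite (_ : (fun x => _) = (fun x => c a * F a x + \sum_(k <- r) c k * F k x)); last first.
  by apply/funext => y; rewrite big_cons.
have pa : polyfun (fun x => c a * F a x) by apply: polyfunM => //; exact: polyfun_cst.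
have pr : polyfun (fun x => \sum_(k <- r) c k * F k x).
  by apply: polyfun_sum => k _; apply: polyfunM => //; exact: polyfun_cst.
rewrite (polyfun_partialD _ _ pa pr); congr (_ + _).
rewrite (polyfun_partialM _ _ (polyfun_cst (c a)) (pF a)).
by rewrite partial_cst mulr0 addr0.
Qed.

Lemma poly_family_bound N (P : 'I_N -> B -> R) : (forall k, polyfun (P k)) ->
  exists2 C, 0 <= C & forall (V : simplex R n) (y : 'rV[R]_N) (x : E),
    nondegenerate_simplex V -> hull V x ->
    `|\sum_k y ord0 k * P k (bary V x)| <= C * enorm y /\
    enorm (grad (fun x => \sum_k y ord0 k * P k (bary V x)) x) <=
      C * enorm y * grad_sum V.
Proof.
move=> pP.
have /choice[C hC] : forall k, exists C, 0 <= C /\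
    forall (V : simplex R n) (x : E), nondegenerate_simplex V -> hull V x ->
    `|P k (bary V x)| <= C /\
    forall i, `|partial i (fun x => P k (bary V x)) x| <= C * grad_sum V.
  by move=> k; have [C C0 h] := poly_bary_bound (pP k); exists C.
have S0 : 0 <= \sum_k C k by apply: sumr_ge0 => k _; case: (hC k).
(* The factor [n.+1] is the price of bounding the Euclidean norm of the gradient by the sum of its
   coordinates. *)
exists (n.+1%:R * \sum_k C k); first by rewrite mulr_ge0.
move=> V y x hV hx.
have L (z : 'I_N -> R) (M : R) : 0 <= M -> (forall k, `|z k| <= C k * M) ->
    `|\sum_k y ord0 k * z k| <= (\sum_k C k) * enorm y * M.
  move=> M0 zC; apply: (le_trans (ler_norm_sum _ _ _)).
  rewrite -mulrA mulr_suml; apply: ler_sum => k _; rewrite normrM mulrCA.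
  by apply: ler_pM => //; exact: coord_le_enorm.
split.
  apply: (@le_trans _ _ ((\sum_k C k) * enorm y * 1)).
    by apply: L => // k; rewrite mulr1; exact: ((hC k).2 V x hV hx).1.
  rewrite mulr1 -mulrA ler_peMl ?ler1n// mulr_ge0//; exact: enorm_ge0.
apply: (le_trans (enorm_le_sum _)).
apply: (@le_trans _ _ (\sum_(i < n.+1) (\sum_k C k) * enorm y * grad_sum V)).
  apply: ler_sum => i _; rewrite [grad _ _ _ _]mxE partial_lincomb; last first.
    by move=> k; exact: polyfun_comp_bary.
  by apply: L => [|k]; [exact: grad_sum_ge0|exact: ((hC k).2 V x hV hx).2].
by rewrite sumr_const card_ord -[_ *+ _]mulr_natl !mulrA.
Qed.

Lemma partial_prod (I : eqType) (r : seq I) (F : I -> E -> R) i x : uniq r ->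
  (forall k, polyfun (F k)) ->
  partial i (fun x => \prod_(k <- r) F k x) x =
  \sum_(k <- r) partial i (F k) x * \prod_(l <- r | l != k) F l x.
Proof.
move=> + pF; elim: r => [_|a r IH /= /andP[ar ur]].
  rewrite big_nil -[RHS](partial_cst 1 i x); congr (partial i _ x).
  by apply/funext => y; rewrite big_nil.
rewrite (_ : (fun x => _) = (fun x => F a x * \prod_(k <- r) F k x)); last first.
  by apply/funext => y; rewrite big_cons.
have pr : polyfun (fun x => \prod_(k <- r) F k x) by apply: polyfun_prod.
rewrite (polyfun_partialM _ _ (pF a) pr) IH//.
rewrite big_cons big_cons eqxx/= addrC mulrC; congr (_ * _ + _).
  rewrite [RHS]big_seq_cond [LHS]big_seq; apply: eq_bigl => k.
  by rewrite andb_idr// => kr; apply: contraNneq ar => <-.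
rewrite mulr_sumr !big_seq; apply: eq_bigr => k kr; rewrite big_cons ifT 1?mulrCA//.
by apply: contraNneq ar => ->.
Qed.

(* The divergence of a bubble field is a combination of 1 and of the products
   of all the barycentric coordinates but one. *)
Definition div_basis (a : 'I_n.+3) (l : B) : R :=
  if unlift ord0 a is Some j then \prod_(m | m != j) l ord0 m else 1.

Lemma polyfun_div_basis a : polyfun (div_basis a).
Proof.
rewrite /div_basis; case: (unlift _ _) => [j|]; last exact: polyfun_cst.
by apply: polyfun_prod => m _; exact: polyfun_coord.
Qed.

Lemma divergence_bubble_field (V : simplex R n) a b c : nondegenerate_simplex V ->
  exists y : 'rV[R]_n.+3, forall x,
    divergence (bubble_field V a b c) x = \sum_k y ord0 k * div_basis k (bary V x).
Proof.
move=> hV.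
pose s0 : R := \sum_i (a i) ord0 i.
pose g (j : 'I_n.+2) : R := \sum_i c i * bary_grad V j ord0 i.
exists (\row_k (if unlift ord0 k is Some j then g j else s0)) => x.
rewrite big_ord_recl mxE /div_basis unlift_none mulr1.
under [X in _ + X]eq_bigr do rewrite mxE liftK.
have E i : partial i (fun x => bubble_field V a b c x ord0 i) x = (a i) ord0 i +
    \sum_j c i * bary_grad V j ord0 i * \prod_(m | m != j) bary V x ord0 m.
  rewrite (_ : (fun x => _) =
    fun x => (dot (a i) x + b i) + c i * \prod_j bary V x ord0 j); last first.
    by apply/funext => z; rewrite bubble_fieldE.
  have pp : polyfun (fun x => \prod_j bary V x ord0 j).
    by apply: polyfun_prod => j _; exact: polyfun_bary.
  have pc := polyfunM (polyfun_cst (c i)) pp.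
  rewrite (polyfun_partialD _ _ (polyfun_affine (a i) (b i)) pc).
  rewrite (polyfun_partialM _ _ (polyfun_cst (c i)) pp).
  rewrite partial_cst mulr0 addr0; congr (_ + _).
    have := grad_dot (a i) (b i) x; move/(congr1 (fun r : E => r ord0 i)).
    by rewrite [LHS]mxE.
  rewrite partial_prod ?index_enum_uniq//; last by move=> j; exact: polyfun_bary.
  by rewrite mulr_sumr; apply: eq_bigr => j _; rewrite partial_bary mulrA.
transitivity (\sum_i ((a i) ord0 i +
    \sum_j c i * bary_grad V j ord0 i * \prod_(m | m != j) bary V x ord0 m)).
  by apply: eq_bigr => i _; exact: E.
rewrite big_split/=; congr (_ + _); rewrite exchange_big/=; apply: eq_bigr => j _.
by rewrite /g mulr_suml.
Qed.

(** At a vertex every product vanishes, having at least two factors, which isolates the constant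
    term; at the center of facet [j] only the product that omits [j] survives. For [n = 0] the
    products are the coordinates, which sum to the constant 1. *)
Lemma div_basis_free (y : 'rV[R]_n.+3) : (0 < n)%N ->
  (forall l : B, (forall i, 0 <= l ord0 i) -> \sum_i l ord0 i = 1 ->
    \sum_k y ord0 k * div_basis k l = 0) -> y = 0.
Proof.
move=> n0 H.
have y0 : y ord0 ord0 = 0.
  pose l : B := delta_mx ord0 ord0.
  have l0 i : 0 <= l ord0 i by rewrite mxE.
  have l1 : \sum_i l ord0 i = 1.
    rewrite (bigD1 ord0)//= big1 ?addr0 ?mxE ?eqxx// => i i0.
    by rewrite mxE (negbTE i0) andbF.
  have := H l l0 l1.
  rewrite big_ord_recl /div_basis unlift_none mulr1 [X in _ + X]big1 ?addr0//.
  move=> j _; rewrite liftK.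
  have [m [mj m0]] : exists m : 'I_n.+2, m != j /\ m != ord0.
    have [-> |j1] := eqVneq j (lift ord0 ord0).
      by exists ord_max; split => //; rewrite -(inj_eq val_inj) /= gtn_eqF// ltnS.
    by exists (lift ord0 ord0); split => //; rewrite eq_sym.
  by rewrite (bigD1 m)//= mxE (negbTE m0) andbF mul0r mulr0.
apply/rowP => k; rewrite [RHS]mxE; have [j ->|-> //] := unliftP ord0 k.
pose l : B := \row_i (if i == j then 0 else n.+1%:R^-1).
have l0 i : 0 <= l ord0 i by rewrite mxE; case: ifP => // _; rewrite invr_ge0.
have l1 : \sum_i l ord0 i = 1.
  rewrite (bigD1 j)//= mxE eqxx add0r.
  under eq_bigr => i /negbTE ij do rewrite mxE ij.
  rewrite sumr_const (_ : #|_| = n.+1); last by rewrite cardC1 card_ord.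
  by rewrite -[LHS]mulr_natr mulVf// pnatr_eq0.
have := H l l0 l1; rewrite (bigD1 (lift ord0 j))//= big1 ?addr0; last first.
  move=> m; have [i ->|->] := unliftP ord0 m; last by rewrite y0 mul0r.
  rewrite (inj_eq lift_inj) => ij; rewrite /div_basis liftK.
  by rewrite (bigD1 j) 1?eq_sym//= mxE eqxx mul0r mulr0.
rewrite /div_basis liftK => /eqP; rewrite mulf_eq0 => /orP[/eqP//|].
rewrite prodf_seq_eq0 => /hasP[m _ /andP[mj]].
by rewrite mxE (negbTE mj) invr_eq0 pnatr_eq0.
Qed.

End bary_polynomials.

(** * Shape regularity and barycentric gradients *)

Section shape.
Context {R : realType} {n : nat}.
Variables (V : simplex R n) (hV : nondegenerate_simplex V).
Local Notation E := 'rV[R]_n.+1.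

Lemma diam_ge (A : set E) x y : A `<=` hull V -> A x -> A y -> enorm (x - y) <= diam A.
Proof.
move=> AV Ax Ay; apply: ub_le_sup; last by exists (x, y).
have [M M0 hM] := compact_bound (compact_hull hV) (@continuous_enorm R n.+1).
exists (M + M) => _ [[a b] [/= Aa Ab] <-].
apply: (le_trans (enormD _ _)); rewrite enormN; apply: lerD.
  by apply: (le_trans (ler_norm _)); apply: hM; exact: AV.
by apply: (le_trans (ler_norm _)); apply: hM; exact: AV.
Qed.

Lemma facet_vertex j (m : 'I_n.+1) : facet V j (row (lift j m) V).
Proof.
apply/(facetP hV); split; first exact: hull_vertex.
by rewrite bary_vertex// eq_sym (negbTE (neq_lift _ _)).
Qed.

Lemma diam_facet_ge0 j : 0 <= diam (facet V j).
Proof.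
have h := facet_vertex j ord0.
apply: le_trans (diam_ge (facet_sub_hull hV (j := j)) h h).
exact: enorm_ge0.
Qed.

Lemma diam_facet_le j : diam (facet V j) <= diam (hull V).
Proof.
have h := facet_vertex j ord0.
apply: ge_sup; first by exists (enorm (row (lift j ord0) V - row (lift j ord0) V)); exists (row (lift j ord0) V, row (lift j ord0) V).
move=> _ [[a b] [/= Aa Ab] <-]; apply: diam_ge => //; exact: (facet_sub_hull hV (j := j)).
Qed.

(** The coordinate [j] grows from 0 to 1 along an edge, whose length is at most the diameter. *)
Lemma bary_grad_diam j : 1 <= enorm (bary_grad V j) * diam (hull V).
Proof.
have := dot_bary_grad_edge hV j (lift j ord0) j.
rewrite eqxx eq_sym (negbTE (neq_lift _ _)) subr0 => e1.
rewrite -[leLHS]e1; apply: (le_trans (ler_norm _)); apply: (le_trans (dot_le _ _)).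
apply: ler_wpM2l; first exact: enorm_ge0.
by apply: diam_ge => //; exact: hull_vertex.
Qed.

Lemma diam_gt0 : 0 < diam (hull V).
Proof.
have := bary_grad_diam ord0; have g0 := enorm_bary_grad_gt0 hV ord0.
by move=> h; rewrite -(pmulr_rgt0 _ g0) (lt_le_trans _ h).
Qed.

Let inballs : set R := [set 2 * r | r in [set r : R | 0 <= r /\
    exists x, forall y, enorm (y - x) <= r -> hull V y]].

(** Across a ball of radius [r], along its gradient, the coordinate [j] varies by 2 r |grad
    lambda_j|, yet it stays between 0 and 1. *)
Let inballs_ub j : ubound inballs (enorm (bary_grad V j))^-1.
Proof.
move=> _ [r [r0 [x hx]] <-]; set g := enorm _.
have g0 : 0 < g by exact: enorm_bary_grad_gt0.
have e (s : R) : `|s| <= 1 -> hull V (x + (s * r / g) *: bary_grad V j).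
  move=> s1; apply: hx; rewrite addrAC subrr add0r enormZ -/g.
  rewrite normrM normrM (ger0_norm r0) (gtr0_norm (x := g^-1)) ?invr_gt0//.
  by rewrite mulfVK ?gt_eqF// ler_piMl.
have h1 : bary V (x + (1 * r / g) *: bary_grad V j) ord0 j <= 1.
  by apply: hull_bary_le1 => //; apply: e; rewrite normr1.
have h2 : 0 <= bary V (x + ((-1) * r / g) *: bary_grad V j) ord0 j.
  by apply: (hullP hV _).1; apply: e; rewrite normrN1.
move: h1 h2; rewrite !bary_line -enorm_sqr -/g.
rewrite [1 * r / g * g ^+ 2](_ : _ = r * g); last by field; rewrite gt_eqF.
rewrite [-1 * r / g * g ^+ 2](_ : _ = - (r * g)); last by field; rewrite gt_eqF.
move=> h1 h2; rewrite -[leRHS]mul1r ler_pdivlMr//.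
by have := lerB h1 h2; lra.
Qed.

Lemma bary_grad_indiam j : enorm (bary_grad V j) * indiam (hull V) <= 1.
Proof.
have g0 := enorm_bary_grad_gt0 hV j.
rewrite mulrC -ler_pdivlMr// mul1r; apply: ge_sup; last exact: inballs_ub.
have [x hx] : hull V !=set0 by exists (row ord0 V); exact: hull_vertex.
exists (2 * 0); exists 0 => //; split => //; exists x => y yx.
suff -> : y = x by [].
apply/eqP; rewrite -subr_eq0 -enorm_eq0 eq_le yx; exact: enorm_ge0.
Qed.

Lemma indiam_gt0 : 0 < indiam (hull V).
Proof.
pose c : E := const_mx (n.+2%:R^-1) *m V.
have oc : open_hull V c.
  move=> i; rewrite baryK ?mxE ?invr_gt0//; under eq_bigr do rewrite mxE.
  by rewrite sumr_const card_ord -[LHS]mulr_natr mulVf// pnatr_eq0.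
have /nbhs_ballP[e /= e0 ceV] : nbhs c (open_hull V).
  by apply: open_nbhs_nbhs; split => //; exact: open_open_hull.
apply: (@lt_le_trans _ _ (2 * (e / 2))); first by rewrite mulr_gt0// divr_gt0.
apply: ub_le_sup; first by exists (enorm (bary_grad V ord0))^-1; exact: inballs_ub.
exists (e / 2) => //; split; first by rewrite divr_ge0// ltW.
exists c => y yc; apply: (open_hull_sub hV); apply: ceV.
rewrite ball_rV// => i _ /=; rewrite distrC.
apply: (@le_lt_trans _ _ (enorm (y - c))).
  apply: le_trans (coord_le_enorm _ i).
  by rewrite [X in _ <= `|X|]mxE [X in _ <= `|_ + X|]mxE.
by apply: (le_lt_trans yc); rewrite ltr_pdivrMr// ltr_pMr// ltr1n.
Qed.

Lemma diam_bary_grad (sigma : R) j : diam (hull V) / indiam (hull V) <= sigma ->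
  diam (hull V) * enorm (bary_grad V j) <= sigma.
Proof.
have i0 := indiam_gt0; have d0 := diam_gt0.
move=> hs; have s0 : 0 <= sigma.
  by apply: le_trans hs; rewrite divr_ge0// ltW.
move: hs; rewrite ler_pdivrMr// => hs.
apply: (@le_trans _ _ (sigma * indiam (hull V) * enorm (bary_grad V j))).
  by apply: ler_wpM2r => //; exact: enorm_ge0.
by rewrite -mulrA mulrC -[leRHS]mul1r ler_wpM2r// mulrC bary_grad_indiam.
Qed.

Lemma diam_grad_sum (sigma : R) : diam (hull V) / indiam (hull V) <= sigma ->
  diam (hull V) * grad_sum V <= n.+2%:R * sigma.
Proof.
move=> hs; rewrite /grad_sum mulr_sumr.
apply: (@le_trans _ _ (\sum_(j < n.+2) sigma)).
  by apply: ler_sum => j _; exact: diam_bary_grad.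
by rewrite sumr_const card_ord -[_ *+ _]mulr_natl.
Qed.

End shape.

Section norm_bounds.
Context {R : realType} {n : nat}.
Local Notation E := 'rV[R]_n.+1.
Local Notation lam := (@lebesgue_rV R n.+1).

Lemma Lp_norm_le (p M : R) (A : set E) (f : E -> R) : measurable A -> (lam A < +oo)%E ->
  0 < p -> 0 <= M -> (forall x, A x -> `|f x| <= M) ->
  (Lp_norm p%:E A f <= (M * fine (lam A) `^ p^-1)%:E)%E.
Proof.
move=> mA Aoo p0 M0 fM; rewrite Lp_normE.
apply: (@le_trans _ _ (((M `^ p)%:E * lam A) `^ p^-1)%E).
  apply: gt0_ler_poweR; first by rewrite invr_ge0 ltW.
  - by rewrite in_itv/= leey andbT; apply: integral_ge0 => x _; rewrite lee_fin powR_ge0.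
  - by rewrite in_itv/= leey andbT mule_ge0// lee_fin powR_ge0.
  rewrite -integral_cst// [leRHS]integral_mkcond; apply: le_integralT => x.
    by rewrite lee_fin powR_ge0.
  have [Dx|Dx] := pselect (A x); last first.
    by rewrite !patch_out// normr0 powR0// gt_eqF.
  rewrite !patch_in// lee_fin; apply: ge0_ler_powR => //; first exact: ltW.
  exact: fM.
rewrite -[X in (_ * X)%E]fineK ?ge0_fin_numE// -EFinM poweR_EFin lee_fin.
rewrite powRM ?powR_ge0 ?fine_ge0// -powRrM mulfV ?gt_eqF//.
by rewrite powRr1.
Qed.

Lemma facet_norm_le (p M : R) (V : simplex R n) j (f : E -> R) : 0 < p -> 0 <= M ->
  (forall s, ref_simplex s -> `|f (facet_param V j s)| <= M) ->
  (facet_norm p V j f <= (M * (facet_jac V j * @ref_vol R n) `^ p^-1)%:E)%E.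
Proof.
move=> p0 M0 fM.
have J0 := facet_jac_ge0 V j; have r0 := ltW (@ref_vol_gt0 R n).
apply: (@le_trans _ _ (((facet_jac V j * (M `^ p * @ref_vol R n))%:E) `^ p^-1)%E); last first.
  rewrite mulrCA poweR_EFin lee_fin [leLHS]powRM ?powR_ge0 ?mulr_ge0//.
  by rewrite -powRrM mulfV ?gt_eqF// powRr1.
apply: gt0_ler_poweR; first by rewrite invr_ge0 ltW.
- rewrite in_itv/= leey andbT mule_ge0 ?lee_fin//.
  by apply: integral_ge0 => x _; rewrite lee_fin powR_ge0.
- by rewrite in_itv/= leey andbT lee_fin !mulr_ge0 ?powR_ge0.
rewrite EFinM; apply: lee_wpmul2l; first by rewrite lee_fin.
apply: (@le_trans _ _ (\int[@lebesgue_rV R n]_(x in ref_simplex) (M `^ p)%:E)%E).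
  rewrite [leLHS]integral_mkcond [leRHS]integral_mkcond; apply: le_integralT => s.
    have [hs|hs] := pselect (ref_simplex s); last by rewrite patch_out.
    by rewrite patch_in// lee_fin powR_ge0.
  have [hs|hs] := pselect (ref_simplex s); last by rewrite !patch_out.
  rewrite !patch_in// lee_fin; apply: ge0_ler_powR => //; first exact: ltW.
  exact: fM.
rewrite integral_cst; last exact: measurable_ref_simplex.
have := @lebesgue_ref_simplex R n; rewrite EFinM => h.
by rewrite le_eqVlt; apply/orP; left; apply/eqP; congr (_ * _)%E; exact: h.
Qed.

Lemma integ_hull_le (M : R) (V : simplex R n) (f : E -> R) : nondegenerate_simplex V ->
  continuous f -> (forall x, hull V x -> `|f x| <= M) ->
  `|integ (hull V) f| <= M * fine (lam (hull V)).
Proof.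
move=> hV cf fM.
have mh := measurable_hull hV.
have I1 : lam.-integrable (hull V) (EFin \o f).
  by apply: compact_integrable => //; exact: compact_hull.
have I2 : lam.-integrable (hull V) (EFin \o (fun x => `|f x|)).
  apply: compact_integrable; first exact: compact_hull.
  by move=> x; apply: continuous_comp; [exact: cf|exact: norm_continuous].
have I3 : lam.-integrable (hull V) (EFin \o (fun=> M)).
  by apply: compact_integrable; [exact: compact_hull|exact: cst_continuous].
apply: (le_trans (le_normr_Rintegral mh I1)).
apply: (@le_trans _ _ (\int[lam]_(x in hull V) M)%R).
  by apply: le_Rintegral => // x /set_mem hx; exact: fM.
by rewrite Rintegral_cst.
Qed.

End norm_bounds.

Lemma continuous_prod (R : realType) (T : topologicalType) I (r : seq I)
    (F : I -> T -> R) : (forall i, continuous (F i)) ->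
  continuous (fun x => \prod_(i <- r) F i x).
Proof.
move=> cF; elim: r => [|i r IH].
  rewrite (_ : (fun x => _) = fun=> 1); first exact: cst_continuous.
  by apply/funext => x; rewrite big_nil.
rewrite (_ : (fun x => _) = fun x => F i x * \prod_(j <- r) F j x).
  exact: continuous_mul.
by apply/funext => x; rewrite big_cons.
Qed.

Section estimates.
Context {R : realType} {n : nat}.
Local Notation E := 'rV[R]_n.+1.
Local Notation B := 'rV[R]_n.+2.
Local Notation lam := (@lebesgue_rV R n.+1).

(** Expresses all powers of the Jacobian through its cube root, so that the scaling arguments become
    polynomial identities. *)
Lemma cube_root (d : R) : 0 <= d ->
  (d `^ (1 / 3)) ^+ 3 = d /\ d `^ (2 / 3) = (d `^ (1 / 3)) ^+ 2.
Proof.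
move=> d0; rewrite -!powR_mulrn ?powR_ge0// -!powRrM.
by rewrite !mul1r mulVf ?powRr1// (mulrC _ 2).
Qed.

Lemma continuous_poly_ref (P : B -> R) : polyfun P ->
  continuous (fun s : E => P (bary_ref s)).
Proof.
move=> /polyfun_continuous cP.
rewrite (_ : (fun s => _) = (fun s => P (bary_ref s *m 1%:M))).
  exact: continuous_comp_bary_ref.
by apply/funext => s; rewrite mulmx1.
Qed.

Lemma integral_poly_bary (V : simplex R n) (P : B -> R) : nondegenerate_simplex V ->
  polyfun P -> integ (hull V) (fun x => P (bary V x)) =
  simplex_jac V * (\int[lam]_(s in @ref_simplex R n.+1) P (bary_ref s))%R.
Proof.
move=> hV pP.
rewrite integral_hull//; last exact: polyfun_continuous (polyfun_comp_bary V pP).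
congr (_ * _); apply: eq_Rintegral => s _; rewrite baryK// sum_bary_ref//.
Qed.

Lemma polyfun_prod_coord (p : pred 'I_n.+2) : polyfun (fun l : B => \prod_(m | p m) l ord0 m).
Proof. by apply: polyfun_prod => m _; exact: polyfun_coord. Qed.

Lemma div_gram : (0 < n)%N -> exists2 c, 0 < c & forall y : 'rV[R]_n.+3,
  c * enorm y ^+ 2 <= (\int[lam]_(s in @ref_simplex R n.+1)
    ((\prod_m bary_ref s ord0 m) *
      (\sum_k y ord0 k * div_basis k (bary_ref s)) ^+ 2))%R.
Proof.
move=> n0; apply: (gram_pos (w := fun s => \prod_m bary_ref s ord0 m)
  (e := fun k s => div_basis k (bary_ref s))).
- by apply: continuous_prod => m; exact: continuous_bary_ref.
- by move=> k; apply: continuous_poly_ref; exact: polyfun_div_basis.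
- by move=> s hs; apply: prodr_ge0 => m _; exact: (ref_simplexP s).1.
- by move=> s hs; apply: prodr_gt0 => m _; exact: hs.
- move=> y hy; apply: div_basis_free => // l l0 l1.
  have [s sE] := bary_ref_surj l1; rewrite -sE; apply: hy.
  by apply/ref_simplexP => i; rewrite sE.
Qed.

Lemma facet_gram : exists2 c, 0 < c & forall y : 'rV[R]_n.+1,
  c * enorm y ^+ 2 <= (\int[@lebesgue_rV R n]_(s in @ref_simplex R n)
    ((\prod_m bary_ref s ord0 m) * (\sum_k y ord0 k * bary_ref s ord0 k) ^+ 2))%R.
Proof.
apply: (gram_pos (w := fun s => \prod_m bary_ref s ord0 m)
  (e := fun k s => bary_ref s ord0 k)).
- by apply: continuous_prod => m; exact: continuous_bary_ref.
- by move=> k; exact: continuous_bary_ref.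
- by move=> s hs; apply: prodr_ge0 => m _; exact: (ref_simplexP s).1.
- by move=> s hs; apply: prodr_gt0 => m _; exact: hs.
- move=> y hy; apply/rowP => k; rewrite [RHS]mxE.
  pose l : 'rV[R]_n.+1 := delta_mx ord0 k.
  have l1 : \sum_i l ord0 i = 1.
    rewrite (bigD1 k)//= big1 ?addr0 ?mxE ?eqxx// => i ik.
    by rewrite mxE (negbTE ik) andbF.
  have [s sE] := bary_ref_surj l1.
  have := hy s; rewrite sE (bigD1 k)//= big1 ?addr0 => [|i ik]; last first.
    by rewrite mxE (negbTE ik) andbF mulr0.
  rewrite mxE !eqxx mulr1; apply; apply/ref_simplexP => i.
  by rewrite sE mxE.
Qed.

Definition div_poly (V : simplex R n) (y : 'rV[R]_n.+3) (x : E) : R :=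
  \sum_k y ord0 k * div_basis k (bary V x).

(** The element bubble times [div_poly V y], expanded as a combination of fixed polynomials so that
    the uniform bounds for families apply. *)
Definition div_test (V : simplex R n) (y : 'rV[R]_n.+3) (x : E) : R :=
  \sum_k y ord0 k * ((\prod_m bary V x ord0 m) * div_basis k (bary V x)).

(** The bubble of facet [j] times the affine function with nodal values [y] on the facet and 0 at
    the opposite vertex. *)
Definition facet_test (V : simplex R n) j (y : 'rV[R]_n.+1) (x : E) : R :=
  \sum_m y ord0 m * ((\prod_(i | i != j) bary V x ord0 i) * bary V x ord0 (lift j m)).

Lemma polyfun_div_poly V y : polyfun (div_poly V y).
Proof.
apply: polyfun_sum => k _; apply: polyfunM; first exact: polyfun_cst.
exact: (polyfun_comp_bary V (polyfun_div_basis k)).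
Qed.

Lemma polyfun_prod_bary (V : simplex R n) (p : pred 'I_n.+2) :
  polyfun (fun x => \prod_(m | p m) bary V x ord0 m).
Proof. by apply: polyfun_prod => m _; exact: polyfun_bary. Qed.

Lemma polyfun_div_test V y : polyfun (div_test V y).
Proof.
apply: polyfun_sum => k _; apply: polyfunM; first exact: polyfun_cst.
apply: polyfunM; first exact: polyfun_prod_bary.
exact: (polyfun_comp_bary V (polyfun_div_basis k)).
Qed.

Lemma polyfun_facet_test V j y : polyfun (facet_test V j y).
Proof.
apply: polyfun_sum => k _; apply: polyfunM; first exact: polyfun_cst.
by apply: polyfunM; [exact: polyfun_prod_bary|exact: polyfun_bary].
Qed.

(** The tested equation is abstracted into a hypothesis on one simplex, which keeps [C] independent
    of meshes. With [t] the cube root of the Jacobian, the left side is at least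
    [t ^+ 3 * (c * enorm y ^+ 2)], the right side is of order [t ^+ 2 * enorm y], and one
    divides. *)
Lemma div_estimate : (0 < n)%N -> exists2 C, 0 <= C &
  forall (V : simplex R n) (y : 'rV[R]_n.+3) (L : R), nondegenerate_simplex V -> 0 <= L ->
  (forall M, 0 <= M -> (forall x, hull V x -> enorm (grad (div_test V y) x) <= M) ->
    integ (hull V) (fun x => div_test V y x * div_poly V y x) <=
    M * fine (lam (hull V)) `^ (2 / 3) * L) ->
  enorm y * simplex_jac V `^ (1 / 3) <= C * (grad_sum V * L).
Proof.
move=> n0; have [c c0 hc] := div_gram n0.
have [C1 C10 hC1] := @poly_family_bound R n n.+3
  (fun k l => (\prod_m l ord0 m) * div_basis k l)
  (fun k => polyfunM (polyfun_prod_coord predT) (polyfun_div_basis k)).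
pose r := @ref_vol R n.+1 `^ (2 / 3).
exists (C1 * r / c); first by rewrite divr_ge0 ?mulr_ge0 ?powR_ge0// ltW.
move=> V y L hV L0 H.
have jac0 := simplex_jac_gt0 hV.
have [t3 t2] := cube_root (ltW jac0); set t := simplex_jac V `^ (1 / 3) in t3 t2 *.
have t0 : 0 < t by exact: powR_gt0.
have [->|yN] := eqVneq (enorm y) 0.
  rewrite mul0r mulr_ge0 ?mulr_ge0 ?invr_ge0 ?powR_ge0 ?grad_sum_ge0//; exact: ltW.
have y0 : 0 < enorm y by rewrite lt_neqAle eq_sym yN enorm_ge0.
(* The admissible [M] is the uniform bound on the gradient of the test function. *)
have := H (C1 * enorm y * grad_sum V).
have -> : integ (hull V) (fun x => div_test V y x * div_poly V y x) =
    integ (hull V) (fun x => (\prod_m bary V x ord0 m) *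
      (\sum_k y ord0 k * div_basis k (bary V x)) ^+ 2).
  apply: eq_Rintegral => x _; rewrite /div_test /div_poly.
  rewrite (_ : \sum_k y ord0 k * (_ * _) =
    (\prod_m bary V x ord0 m) * \sum_k y ord0 k * div_basis k (bary V x)).
    by rewrite -mulrA expr2.
  by rewrite mulr_sumr; apply: eq_bigr => k _; rewrite mulrCA.
rewrite (integral_poly_bary (P := fun l => (\prod_m l ord0 m) *
    (\sum_k y ord0 k * div_basis k l) ^+ 2) hV); last first.
  apply: polyfunM; first exact: polyfun_prod_coord.
  suff ps : polyfun (fun l => \sum_k y ord0 k * div_basis k l) by exact: polyfunM.
  by apply: polyfun_sum => k _; apply: polyfunM; [exact: polyfun_cst|exact: polyfun_div_basis].
rewrite lebesgue_hull//= powRM; [|exact: ltW|exact/ltW/ref_vol_gt0].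
rewrite -/r t2 -t3 => /(_ _ _) h.
have {}h : t ^+ 3 * (c * enorm y ^+ 2) <= C1 * enorm y * grad_sum V * (t ^+ 2 * r) * L.
  apply: (le_trans _ (h _ _)).
  - by apply: ler_wpM2l; [rewrite exprn_ge0// ltW|exact: hc].
  - by rewrite !mulr_ge0 ?enorm_ge0 ?grad_sum_ge0.
  - by move=> x hx; exact: (hC1 V y x hV hx).2.
rewrite mulrAC ler_pdivlMr// -(ler_pM2l (_ : 0 < t ^+ 2 * enorm y)); last first.
  by rewrite mulr_gt0// exprn_gt0.
apply: (le_trans (le_trans _ h)); rewrite le_eqVlt; apply/orP; left; apply/eqP; ring.
Qed.

(** Same scaling on a facet. The volume term is bounded through sup norms and the hypothesis on [y];
    the factor [enorm (bary_grad V j)] is the ratio of the facet Jacobian to that of the element. *)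
Lemma facet_estimate (C0 : R) j : 0 <= C0 -> exists2 C, 0 <= C &
  forall (V : simplex R n) (y : 'rV[R]_n.+3) (z : 'rV[R]_n.+1) (L : R),
  nondegenerate_simplex V -> 0 <= L ->
  enorm y * simplex_jac V `^ (1 / 3) <= C0 * (grad_sum V * L) ->
  (forall M, 0 <= M -> (forall x, hull V x -> enorm (grad (facet_test V j z) x) <= M) ->
    facet_jac V j * (\int[@lebesgue_rV R n]_(s in @ref_simplex R n)
      ((\prod_m bary_ref s ord0 m) * (\sum_k z ord0 k * bary_ref s ord0 k) ^+ 2))%R <=
    `|integ (hull V) (fun x => facet_test V j z x * div_poly V y x)| +
    M * fine (lam (hull V)) `^ (2 / 3) * L) ->
  enorm z * enorm (bary_grad V j) * simplex_jac V `^ (1 / 3) <= C * (grad_sum V * L).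
Proof.
move=> C00; have [c c0 hc] := facet_gram.
have [C1 C10 hC1] := @poly_family_bound R n n.+1
  (fun m l => (\prod_(i | i != j) l ord0 i) * l ord0 (lift j m))
  (fun m => polyfunM (polyfun_prod_coord (fun i => i != j)) (polyfun_coord (lift j m))).
have [C2 C20 hC2] := @poly_family_bound R n n.+3 _ (@polyfun_div_basis R n).
pose r := @ref_vol R n.+1 `^ (2 / 3).
(* The first summand comes from the volume term, after the bound on [y]; the second from the
   correction velocity. *)
pose K := C1 * C2 * @ref_vol R n.+1 * C0 + C1 * r.
have r0 : 0 < @ref_vol R n.+1 by exact: ref_vol_gt0.
have K0 : 0 <= K by rewrite addr_ge0 ?mulr_ge0 ?powR_ge0// ltW.
exists (K / c); first by rewrite divr_ge0// ltW.
move=> V y z L hV L0 hy H.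
have jac0 := simplex_jac_gt0 hV.
have [t3 t2] := cube_root (ltW jac0); set t := simplex_jac V `^ (1 / 3) in t3 t2 hy *.
have t0 : 0 < t by exact: powR_gt0.
have G0 := grad_sum_ge0 V.
have [->|zN] := eqVneq (enorm z) 0.
  by rewrite !mul0r !mulr_ge0 ?invr_ge0 ?G0//; exact: ltW.
have z0 : 0 < enorm z by rewrite lt_neqAle eq_sym zN enorm_ge0.
have := H (C1 * enorm z * grad_sum V).
have volE : fine (lam (hull V)) = t ^+ 3 * @ref_vol R n.+1.
  by rewrite lebesgue_hull//= t3.
have I1 : `|integ (hull V) (fun x => facet_test V j z x * div_poly V y x)| <=
    C1 * enorm z * (C2 * enorm y) * (t ^+ 3 * @ref_vol R n.+1).
  rewrite -volE; apply: integ_hull_le => //.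
    exact: (polyfun_continuous (polyfunM (polyfun_facet_test V j z) (polyfun_div_poly V y))).
  move=> x hx; rewrite normrM; apply: ler_pM => //.
    exact: (hC1 V z x hV hx).1.
  exact: (hC2 V y x hV hx).1.
rewrite volE powRM ?exprn_ge0 ?(ltW t0) ?(ltW r0)// t3 t2 -/r facet_jacE// -t3 => h.
have {}h : t ^+ 3 * enorm (bary_grad V j) * (c * enorm z ^+ 2) <=
    C1 * enorm z * (C2 * enorm y) * (t ^+ 3 * @ref_vol R n.+1) +
    C1 * enorm z * grad_sum V * (t ^+ 2 * r) * L.
  apply: (@le_trans _ _ (t ^+ 3 * enorm (bary_grad V j) *
      (\int[@lebesgue_rV R n]_(s in @ref_simplex R n)
      ((\prod_m bary_ref s ord0 m) * (\sum_k z ord0 k * bary_ref s ord0 k) ^+ 2))%R)).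
    apply: ler_wpM2l; last exact: hc.
    by rewrite mulr_ge0 ?enorm_ge0// exprn_ge0// ltW.
  apply: (le_trans (h _ _)); last by rewrite lerD2r.
  - by rewrite !mulr_ge0 ?enorm_ge0.
  - by move=> x hx; exact: (hC1 V z x hV hx).2.
rewrite [leRHS]mulrAC ler_pdivlMr// -(ler_pM2l (_ : 0 < t ^+ 2 * enorm z)); last first.
  by rewrite mulr_gt0// exprn_gt0.
have h2 : C1 * enorm z * (C2 * enorm y) * (t ^+ 3 * @ref_vol R n.+1) <=
    t ^+ 2 * enorm z * (C1 * C2 * @ref_vol R n.+1 * C0 * (grad_sum V * L)).
  rewrite (_ : C1 * enorm z * (C2 * enorm y) * (t ^+ 3 * @ref_vol R n.+1) =
    t ^+ 2 * enorm z * (C1 * C2 * @ref_vol R n.+1 * (enorm y * t))); last by ring.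
  rewrite -[X in _ <= _ * X]mulrA; apply: ler_wpM2l.
    by rewrite mulr_ge0 ?exprn_ge0 ?enorm_ge0// ltW.
  by apply: ler_wpM2l; rewrite ?mulr_ge0// ltW.
rewrite (_ : t ^+ 2 * enorm z * (enorm z * enorm (bary_grad V j) * t * c) =
  t ^+ 3 * enorm (bary_grad V j) * (c * enorm z ^+ 2)); last by ring.
apply: (le_trans h); rewrite /K.
rewrite (_ : t ^+ 2 * enorm z * ((C1 * C2 * ref_vol n.+1 * C0 + C1 * r) * (grad_sum V * L)) =
  t ^+ 2 * enorm z * (C1 * C2 * @ref_vol R n.+1 * C0 * (grad_sum V * L)) +
  C1 * enorm z * grad_sum V * (t ^+ 2 * r) * L); last by ring.
by rewrite lerD2r.
Qed.

End estimates.

(** * Estimates of the indicators *)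

Section minkowski.
Context {R : realType} {n : nat}.
Local Notation E := 'rV[R]_n.+1.
Local Notation lam := (@lebesgue_rV R n.+1).

Lemma measurable_enorm_restrict (A : set E) (f : E -> E) : measurable A ->
  (forall i, measurable_fun A (fun x => f x ord0 i)) ->
  measurable_fun [set: E] ((fun x => enorm (f x)) \_ A).
Proof.
move=> mA mf; pose g : E -> E := patch (fun=> 0) A f.
have mg : measurable_fun [set: E] g.
  apply: measurable_fun_rV => i.
  rewrite (_ : (fun x => _) = (fun x => f x ord0 i) \_ A).
    by apply/(measurable_restrictT _ mA).
  apply/funext => x; rewrite /g; have [Ax|Ax] := pselect (A x).
    by rewrite !patch_in.
  by rewrite !patch_out// [LHS]mxE.
rewrite (_ : _ \_ A = @enorm R n.+1 \o g); first exact: (measurableT_comp measurable_enorm).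
apply/funext => x; rewrite /g /=; have [Ax|Ax] := pselect (A x).
  by rewrite !patch_in.
by rewrite !patch_out//; apply/esym/eqP; rewrite enorm_eq0.
Qed.

Lemma vLp_norm_triangle (p : R) (A : set E) (u a b : E -> E) : measurable A -> 1 <= p ->
  (forall i, measurable_fun A (fun x => u x ord0 i)) ->
  (forall i, measurable_fun A (fun x => a x ord0 i)) ->
  (forall i, measurable_fun A (fun x => b x ord0 i)) ->
  (vLp_norm p%:E A (fun x => (b x - a x)%R) <=
   vLp_norm p%:E A (fun x => (u x - a x)%R) + vLp_norm p%:E A (fun x => (u x - b x)%R))%E.
Proof.
move=> mA p1 mu ma mb; have p0 : 0 < p by exact: lt_le_trans p1.
have mB (c : E -> E) : (forall i, measurable_fun A (fun x => c x ord0 i)) ->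
    measurable_fun [set: E] ((fun x => enorm (u x - c x)) \_ A).
  move=> mc; apply: measurable_enorm_restrict => // i.
  rewrite (_ : (fun x => _) = (fun x => u x ord0 i - c x ord0 i)).
    exact: measurable_funB.
  by apply/funext => x; rewrite [LHS]mxE [X in _ + X]mxE.
apply: le_trans (minkowski_EFin lam (mB _ ma) (mB _ mb) p1).
rewrite /vLp_norm Lp_normE unlock; apply: gt0_ler_poweR; first by rewrite invr_ge0 ltW.
- by rewrite in_itv/= leey andbT; apply: integral_ge0 => x _; rewrite lee_fin powR_ge0.
- by rewrite in_itv/= leey andbT; apply: integral_ge0 => x _; rewrite lee_fin powR_ge0.
apply: le_integralT => x; first by rewrite lee_fin powR_ge0.
rewrite lee_fin; apply: ge0_ler_powR; rewrite ?nnegrE//; first exact: ltW.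
have [Ax|Ax] := pselect (A x); last by rewrite patch_out// normr0.
rewrite /= !patch_in// !ger0_norm ?addr_ge0 ?enorm_ge0//.
have -> : b x - a x = (u x - a x) + - (u x - b x) by rewrite opprB [RHS]addrC addrA subrK.
by apply: (le_trans (enormD _ _)); rewrite enormN.
Qed.

End minkowski.

Section elements.
Context {R : realType} {n : nat}.
Variables (D : set 'rV[R]_n.+1) (T : mesh R n).
Hypotheses (oD : open D) (lipD : lipschitz_boundary D)
  (hT : conforming_triangulation D T).
Local Notation E := 'rV[R]_n.+1.
Local Notation lam := (@lebesgue_rV R n.+1).

Let ndT k : nondegenerate_simplex (T k).
Proof. by case: hT. Qed.

(** The exact velocity is measurable on [D] only, whereas a closed element can reach outside it; its
    interior does not. *)
Lemma vLp_norm_open_hull (p : R) k (f : E -> E) :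
  vLp_norm p%:E (hull (T k)) f = vLp_norm p%:E (open_hull (T k)) f.
Proof.
apply: (eq_Lp_norm_null _ (measurable_mesh_null hT) (lebesgue_mesh_null hT)) => x nx.
have [hx|hx] := pselect (hull (T k) x).
  by rewrite !patch_in//; case: (mesh_null_hull oD lipD hT nx hx).
by rewrite !patch_out// => /(open_hull_sub (ndT k)).
Qed.

Lemma measurable_open_hull k : measurable (open_hull (T k)).
Proof. by apply: open_measurable_rV; exact: open_open_hull. Qed.

Lemma measurable_Xh v k i : in_Xh D T v -> measurable_fun (open_hull (T k)) (fun x => v x ord0 i).
Proof.
move=> Xv; have [a [b [c vE]]] := in_Xh_bubble Xv.
apply: (eq_measurable_fun (fun x => bubble_field (T k) (a k) (b k) (c k) x ord0 i)).
  by move=> x /set_mem/(open_hull_sub (ndT k)) hx; rewrite (vE k).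
apply: measurable_funTS; apply: continuous_measurable_rV.
exact: (polyfun_continuous (polyfun_bubble_field _ _ _ _ _)).
Qed.

Lemma eta_L1_le (u ui u1 : E -> E) k : measurable_fun D u ->
  in_Xh D T ui -> in_Xh D T u1 ->
  (eta_L1 T ui u1 k <= vLp_norm 2%:E (hull (T k)) (fun x => (u x - ui x)%R) +
    vLp_norm 2%:E (hull (T k)) (fun x => (u x - u1 x)%R))%E.
Proof.
move=> mu Xi X1; rewrite /eta_L1 !vLp_norm_open_hull.
apply: vLp_norm_triangle; [exact: measurable_open_hull|by rewrite ler1n| | |].
- move=> i; apply: measurable_funS (mesh_open_hull_sub oD lipD hT (k := k)) _.
    exact: open_measurable_rV.
  exact: (measurableT_comp (measurable_coord i)).
- by move=> i; exact: measurable_Xh.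
- by move=> i; exact: measurable_Xh.
Qed.

End elements.

Section facet_reduction.
Context {R : realType} {n : nat}.
Variables (V : simplex R n) (hV : nondegenerate_simplex V) (j : 'I_n.+2).
Local Notation E := 'rV[R]_n.+1.

Lemma prod_lift (F : 'I_n.+2 -> R) : \prod_(i | i != j) F i = \prod_m F (lift j m).
Proof.
rewrite (reindex (lift j)); first by apply: eq_bigl => m; rewrite eq_sym neq_lift.
exists (fun i => odflt ord0 (unlift j i)) => [m _|i]; first by rewrite liftK.
rewrite inE => ij; have [m ->|ij'] := unliftP j i; first by rewrite ?liftK.
by rewrite ij' eqxx in ij.
Qed.

Lemma prod_bary_facet x : facet V j x -> \prod_m bary V x ord0 m = 0.
Proof. by move=> /(facetP hV)[_ xj]; rewrite (bigD1 j)//= xj mul0r. Qed.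

Lemma facet_param_comb s : facet_param V j s = \sum_m bary_ref s ord0 m *: row (lift j m) V.
Proof.
rewrite facet_paramE mulmx_sum_row; apply: eq_bigr => m _; congr (_ *: _).
by apply/rowP => i; rewrite [LHS]mxE [RHS]mxE row'_entry.
Qed.

(** The element bubble vanishes on the facet, so [v] is affine there and determined by its values at
    the vertices. *)
Lemma bubble_field_facet (v : E -> E) a b c s (w : E) :
  (forall x, hull V x -> v x = bubble_field V a b c x) -> ref_simplex s ->
  dot (v (facet_param V j s)) w =
  \sum_m dot (v (row (lift j m) V)) w * bary_ref s ord0 m.
Proof.
move=> vE hs.
have fs : facet V j (facet_param V j s) by exact: ref_facet.
have on_facet x i : facet V j x -> v x ord0 i = dot (a i) x + b i.
  move=> fx; rewrite vE; last exact: (facet_sub_hull hV fx).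
  by rewrite bubble_fieldE prod_bary_facet// mulr0 addr0.
have -> : v (facet_param V j s) = \sum_m bary_ref s ord0 m *: v (row (lift j m) V).
  apply/rowP => i; rewrite on_facet// summxE.
  transitivity (\sum_m (bary_ref s ord0 m * dot (a i) (row (lift j m) V) +
      bary_ref s ord0 m * b i)); last first.
    apply: eq_bigr => m _; rewrite [RHS]mxE on_facet ?mulrDr//.
    exact: facet_vertex.
  rewrite big_split/= -mulr_suml sum_bary_ref mul1r; congr (_ + _).
  by rewrite facet_param_comb dot_sumr; apply: eq_bigr => m _; rewrite dotZr.
rewrite dotC dot_sumr; apply: eq_bigr => m _.
by rewrite dotZr mulrC dotC.
Qed.

Lemma facet_test_param (z : 'rV[R]_n.+1) s :
  facet_test V j z (facet_param V j s) =
  (\prod_m bary_ref s ord0 m) * \sum_m z ord0 m * bary_ref s ord0 m.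
Proof.
rewrite /facet_test mulr_sumr; apply: eq_bigr => m _.
rewrite prod_lift bary_facet_param// mulrCA; congr (_ * (_ * _)).
by apply: eq_bigr => i _; rewrite bary_facet_param.
Qed.

Lemma facet_test_eq0 (z : 'rV[R]_n.+1) i x : i != j -> facet V i x -> facet_test V j z x = 0.
Proof.
move=> ij /(facetP hV)[_ xi]; apply: big1 => m _.
by rewrite (bigD1 i)//= xi mul0r mul0r mulr0.
Qed.

Lemma div_test_eq0 y i x : facet V i x -> div_test V y x = 0.
Proof.
by move=> fx; apply: big1 => m _; rewrite (bigD1 i)//= ((facetP hV _ _).1 fx).2 !mul0r mulr0.
Qed.

End facet_reduction.

Section element_estimates.
Context {R : realType} {n : nat}.
Variables (D : set 'rV[R]_n.+1) (T : mesh R n).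
Hypotheses (oD : open D) (lipD : lipschitz_boundary D)
  (hT : conforming_triangulation D T) (bD : bounded_set D) (D0 : D !=set0).
Local Notation E := 'rV[R]_n.+1.
Local Notation lam := (@lebesgue_rV R n.+1).
Variables (v vr : E -> E) (r : (E -> R) -> E -> R) (ck ce c2 : R).
Hypotheses (Xv : in_Xh D T v)
  (Mh : forall q, in_Mh D T q -> integ D (fun x => dot (grad q x) (v x)) = 0)
  (cl : clement D T ck ce r) (corr : correction_velocity D T c2 r v vr).
Variables (k : 'I_(nelt T)) (L : R).
Hypothesis LE : vLp_norm 3%:E (elt_patch T k) vr = L%:E.
Local Notation V := (T k).
Local Notation vol := (fine (lam (hull V))).

Let hV : nondegenerate_simplex V.
Proof. by case: hT. Qed.

Let L0 : 0 <= L.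
Proof. by rewrite -lee_fin -LE; exact: Lnorm_ge0. Qed.

Lemma test_estimate (Q : E -> R) (M : R) : polyfun Q ->
  (forall j x, ~ facet V j `<=` boundary D -> facet V j x -> Q x = 0) ->
  0 <= M -> (forall x, hull V x -> enorm (grad Q x) <= M) ->
  `|integ (hull V) (fun x => Q x * divergence v x) -
    \sum_j facet_int V j (fun x => phi1 D v k j x * Q x)| <= M * vol `^ (2 / 3) * L.
Proof.
move=> pQ Q0 M0 gM.
have := test_bound oD hT corr pQ M0 gM.
by rewrite (test_identity oD lipD hT bD D0 Xv Mh cl corr pQ Q0) LE -EFinM lee_fin.
Qed.

(** The conclusion of [div_estimate] enters as a hypothesis so that [C0] is chosen before the mesh.
    The element bubble vanishes on all facets, so only the volume term is tested. *)
Lemma element_divergence (C0 : R) :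
  (forall (V : simplex R n) (y : 'rV[R]_n.+3) (L : R), nondegenerate_simplex V -> 0 <= L ->
  (forall M, 0 <= M -> (forall x, hull V x -> enorm (grad (div_test V y) x) <= M) ->
    integ (hull V) (fun x => div_test V y x * div_poly V y x) <=
    M * fine (lam (hull V)) `^ (2 / 3) * L) ->
  enorm y * simplex_jac V `^ (1 / 3) <= C0 * (grad_sum V * L)) ->
  exists2 y : 'rV[R]_n.+3, forall x, open_hull V x -> divergence v x = div_poly V y x &
    enorm y * simplex_jac V `^ (1 / 3) <= C0 * (grad_sum V * L).
Proof.
move=> HC0.
have [a [b [c vE]]] := in_Xh_bubble Xv.
have [y yE] := divergence_bubble_field (a k) (b k) (c k) hV.
have divE x : open_hull V x -> divergence v x = div_poly V y x.
  move=> ox; rewrite /div_poly -yE.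
  by apply: (divergence_open_hull hV) ox => z; exact: vE.
exists y => //; apply: HC0 => // M M0 gM.
have Q0 j x : facet V j x -> div_test V y x = 0 by exact: div_test_eq0.
have := test_estimate (polyfun_div_test V y) (fun j x _ => @Q0 j x) M0 gM.
rewrite [\sum_(j < _) _]big1 ?subr0 => [|j _]; last first.
  rewrite -[RHS](facet_int0 V j); apply: eq_facet_int => x fx.
  by rewrite (Q0 _ _ fx) mulr0.
have -> : integ (hull V) (fun x => div_test V y x * divergence v x) =
    integ (hull V) (fun x => div_test V y x * div_poly V y x).
  by apply: (integ_hull_eq oD lipD hT) => x ox; rewrite divE.
by move=> H; exact: (le_trans (ler_norm _) H).
Qed.

(** The facet bubble vanishes on the other facets, so a single boundary term remains. There the flux
    is affine, and [z] collects its values at the vertices. *)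
Lemma element_facet (C0 C1 : R) (y : 'rV[R]_n.+3) j :
  (forall (V : simplex R n) (y : 'rV[R]_n.+3) (z : 'rV[R]_n.+1) (L : R),
  nondegenerate_simplex V -> 0 <= L ->
  enorm y * simplex_jac V `^ (1 / 3) <= C0 * (grad_sum V * L) ->
  (forall M, 0 <= M -> (forall x, hull V x -> enorm (grad (facet_test V j z) x) <= M) ->
    facet_jac V j * (\int[@lebesgue_rV R n]_(s in @ref_simplex R n)
      ((\prod_m bary_ref s ord0 m) * (\sum_k z ord0 k * bary_ref s ord0 k) ^+ 2))%R <=
    `|integ (hull V) (fun x => facet_test V j z x * div_poly V y x)| +
    M * fine (lam (hull V)) `^ (2 / 3) * L) ->
  enorm z * enorm (bary_grad V j) * simplex_jac V `^ (1 / 3) <= C1 * (grad_sum V * L)) ->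
  (forall x, open_hull V x -> divergence v x = div_poly V y x) ->
  enorm y * simplex_jac V `^ (1 / 3) <= C0 * (grad_sum V * L) ->
  facet V j `<=` boundary D ->
  exists2 z : 'rV[R]_n.+1, forall s, ref_simplex s ->
      phi1 D v k j (facet_param V j s) = \sum_m z ord0 m * bary_ref s ord0 m &
    enorm z * enorm (bary_grad V j) * simplex_jac V `^ (1 / 3) <= C1 * (grad_sum V * L).
Proof.
move=> HC1 divE hy fb.
have [a [b [c vE]]] := in_Xh_bubble Xv.
pose z : 'rV[R]_n.+1 := \row_m dot (v (row (lift j m) V)) (outer_normal V j).
have zE s : ref_simplex s ->
    phi1 D v k j (facet_param V j s) = \sum_m z ord0 m * bary_ref s ord0 m.
  move=> hs; rewrite /phi1; case: asboolP => // _.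
  rewrite (bubble_field_facet hV j _ (vE k) hs).
  by apply: eq_bigr => m _; rewrite [z _ _]mxE.
exists z => //; apply: (HC1 V y z L) => // M M0 gM.
have Q0 i x : ~ facet V i `<=` boundary D -> facet V i x -> facet_test V j z x = 0.
  by move=> nb; apply: facet_test_eq0 => //; apply/eqP => ij; apply: nb; rewrite ij.
have := test_estimate (polyfun_facet_test V j z) Q0 M0 gM.
have -> : integ (hull V) (fun x => facet_test V j z x * divergence v x) =
    integ (hull V) (fun x => facet_test V j z x * div_poly V y x).
  by apply: (integ_hull_eq oD lipD hT) => x ox; rewrite divE.
rewrite (bigD1 j)//= [X in _ - (_ + X)]big1 ?addr0 => [|i ij]; last first.
  rewrite -[RHS](facet_int0 V i); apply: eq_facet_int => x fx.
  by rewrite (facet_test_eq0 hV _ ij fx) mulr0.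
have -> : facet_int V j (fun x => phi1 D v k j x * facet_test V j z x) =
    facet_jac V j * (\int[@lebesgue_rV R n]_(s in @ref_simplex R n)
      ((\prod_m bary_ref s ord0 m) * (\sum_k z ord0 k * bary_ref s ord0 k) ^+ 2))%R.
  rewrite /facet_int; congr (_ * _); apply: eq_Rintegral => s /set_mem hs.
  by rewrite zE// facet_test_param// mulrCA -expr2.
(* Reverse triangle inequality: the facet term is at most the volume term plus the bound on their
   difference. *)
set A := integ _ _; set F := _ * _ => H.
rewrite -lerBlDl; apply: le_trans H; rewrite distrC.
by apply: le_trans (lerB_dist _ _); rewrite lerD2r; exact: ler_norm.
Qed.

End element_estimates.

(** The order of quantifiers is the point: [C] precedes the domain, the mesh and the interpolation
    constants. *)
Lemma eta_D3_le (R : realType) n (sigma : R) : (0 < n)%N -> exists2 C : R, 0 < C &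
  forall (D : set 'rV[R]_n.+1) (T : mesh R n), open D -> lipschitz_boundary D ->
  conforming_triangulation D T -> bounded_set D -> D !=set0 -> shape_regular T sigma ->
  forall (v vr : 'rV[R]_n.+1 -> 'rV[R]_n.+1) r (ck ce c2 : R), in_Xh D T v ->
  (forall q, in_Mh D T q -> integ D (fun x => dot (grad q x) (v x)) = 0) ->
  clement D T ck ce r -> correction_velocity D T c2 r v vr ->
  forall k, (eta_D3 D T v k <= C%:E * vLp_norm 3%:E (elt_patch T k) vr)%E.
Proof.
move=> n0; set s := `|sigma|.
have [C0 C00 HC0] := @div_estimate R n n0.
have /choice[C1 HC1] : forall j : 'I_n.+2, exists C1, 0 <= C1 /\ _ :=
  fun j => let: ex_intro2 C h1 h2 := @facet_estimate R n C0 j C00 in ex_intro _ C (conj h1 h2).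
have [C2 C20 HC2] := @poly_family_bound R n n.+3 _ (@polyfun_div_basis R n).
pose rv := @ref_vol R n.+1 `^ (1 / 3); pose rf := @ref_vol R n `^ (1 / 3).
(* [C2 * rv] converts coefficients into an L^3 norm, [C0] is the divergence estimate, and
   [n.+2%:R * s] bounds the diameter times [grad_sum]. *)
pose A := C2 * rv * (C0 * (n.+2%:R * s)).
(* [n.+1%:R * rf] bounds the facet norm by nodal values; the power of [s] absorbs the facet diameter
   times the gradient factor of the surface Jacobian; the rest is the facet estimate. *)
pose B j := n.+1%:R * rf * s `^ (1 / 3) * (C1 j * (n.+2%:R * s)).
have A0 : 0 <= A by rewrite !mulr_ge0 ?powR_ge0 ?normr_ge0.
have B0 j : 0 <= B j by rewrite !mulr_ge0 ?powR_ge0 ?normr_ge0//; case: (HC1 j).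
have SB0 : 0 <= \sum_j B j by exact: sumr_ge0.
(* The 1 gives strict positivity, which also makes the bound trivial when the norm of [vr] on the
   patch is infinite. *)
exists (A + \sum_j B j + 1); first by rewrite ltr_wpDl// addr_ge0.
move=> D T oD lipD hT bD D0 hs v vr r ck ce c2 Xv Mh cl corr k.
have C_gt0 : 0 < A + \sum_j B j + 1 by rewrite ltr_wpDl// addr_ge0.
have [LE|LN] := eqVneq (vLp_norm 3%:E (elt_patch T k) vr) +oo%E.
  by rewrite LE gt0_muley ?leey// lte_fin.
have N0 : (0 <= vLp_norm 3%:E (elt_patch T k) vr)%E by exact: Lnorm_ge0.
have [L LE] : exists L : R, vLp_norm 3%:E (elt_patch T k) vr = L%:E.
  exists (fine (vLp_norm 3%:E (elt_patch T k) vr)); rewrite fineK// ge0_fin_numE//.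
  by rewrite ltey.
have L0 : 0 <= L by rewrite -lee_fin -LE.
have hV : nondegenerate_simplex (T k) by case: hT.
have [y divE hy] := element_divergence oD lipD hT bD D0 Xv Mh cl corr LE HC0.
have shape : diam (hull (T k)) / indiam (hull (T k)) <= s.
  by apply: (le_trans (hs k)); exact: ler_norm.
have d0 := diam_gt0 hV; have G0 := grad_sum_ge0 (T k).
have dG := diam_grad_sum hV shape.
have jac0 := simplex_jac_gt0 hV.
have [t3 _] := cube_root (ltW jac0); set t := simplex_jac (T k) `^ (1 / 3) in t3 hy.
have t0 : 0 < t by exact: powR_gt0.
have tE : simplex_jac (T k) `^ 3^-1 = t by rewrite /t div1r.
have first : ((diam (hull (T k)))%:E * Lp_norm 3%:E (hull (T k)) (divergence v) <=
    (A * L)%:E)%E.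
  have -> : Lp_norm 3%:E (hull (T k)) (divergence v) =
      Lp_norm 3%:E (hull (T k)) (div_poly (T k) y).
    apply: (eq_Lp_norm_null _ (measurable_mesh_null hT) (lebesgue_mesh_null hT)) => x nx.
    have [hx|hx] := pselect (hull (T k) x); last by rewrite !patch_out.
    by rewrite !patch_in// divE//; case: (mesh_null_hull oD lipD hT nx hx).
  have mh := measurable_hull hV.
  have hoo : (@lebesgue_rV R n.+1 (hull (T k)) < +oo)%E by rewrite lebesgue_hull// ltry.
  have N := Lp_norm_le (f := div_poly (T k) y) (M := C2 * enorm y) (p := 3) mh hoo.
  apply: (@le_trans _ _ ((diam (hull (T k)))%:E *
      (C2 * enorm y * fine (@lebesgue_rV R n.+1 (hull (T k))) `^ 3^-1)%:E)%E).
    apply: lee_wpmul2l; first by rewrite lee_fin ltW.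
    apply: N => //; first by rewrite mulr_ge0 ?enorm_ge0.
    by move=> x hx; exact: (HC2 (T k) y x hV hx).1.
  rewrite -EFinM lee_fin lebesgue_hull//= powRM ?(ltW jac0) ?(ltW (ref_vol_gt0 _))//.
  rewrite tE (_ : ref_vol n.+1 `^ 3^-1 = rv); last by rewrite /rv div1r.
  rewrite [leLHS](_ : _ = C2 * rv * (diam (hull (T k)) * (enorm y * t))); last by ring.
  rewrite /A -!mulrA; apply: ler_wpM2l => //; apply: ler_wpM2l; first exact: powR_ge0.
  apply: (@le_trans _ _ (diam (hull (T k)) * (C0 * (grad_sum (T k) * L)))).
    by apply: ler_wpM2l => //; exact: ltW.
  rewrite [leLHS](_ : _ = C0 * ((diam (hull (T k)) * grad_sum (T k)) * L)); last by ring.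
  by apply: ler_wpM2l => //; rewrite mulrA ler_wpM2r.
have second j : (((diam (facet (T k) j)) `^ (1 / 3))%:E *
    facet_norm 3 (T k) j (phi1 D v k j) <= (B j * L)%:E)%E.
  have [fb|nb] := pselect (facet (T k) j `<=` boundary D); last first.
    rewrite (@facet_norm0 _ _ _ _ 3) => [||q hq]; last 2 first.
    - by [].
    - by apply: (phi1_interior oD hT) => //; [case: Xv|exact: ref_facet].
    by rewrite mule0 lee_fin; exact: (mulr_ge0 (B0 j) L0).
  have [z zE hz] := element_facet oD lipD hT bD D0 Xv Mh cl corr LE (HC1 j).2 divE hy fb.
  rewrite -/t in hz.
  have M0 : 0 <= n.+1%:R * enorm z by rewrite mulr_ge0 ?enorm_ge0.
  have g0 := enorm_bary_grad_gt0 hV j; set g := enorm _ in g0 hz.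
  apply: (@le_trans _ _ (((diam (facet (T k) j)) `^ (1 / 3))%:E *
      (n.+1%:R * enorm z * (facet_jac (T k) j * @ref_vol R n) `^ 3^-1)%:E)%E).
    apply: lee_wpmul2l; first by rewrite lee_fin powR_ge0.
    apply: facet_norm_le => // q hq; rewrite zE//.
    apply: (le_trans (ler_norm_sum _ _ _)).
    apply: (@le_trans _ _ (\sum_(m < n.+1) enorm z)); last first.
      by rewrite sumr_const card_ord -[_ *+ _]mulr_natl.
    apply: ler_sum => m _; rewrite normrM -[leRHS]mulr1; apply: ler_pM => //.
      exact: coord_le_enorm.
    have q0 := (ref_simplexP q).1 hq; rewrite ger0_norm//.
    rewrite -(sum_bary_ref q) (bigD1 m)//= lerDl sumr_ge0// => i _; exact: q0.
  rewrite -EFinM lee_fin facet_jacE// -/g.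
  rewrite powRM ?mulr_ge0 ?(ltW jac0) ?(ltW g0) ?(ltW (ref_vol_gt0 _))//.
  rewrite powRM ?(ltW jac0) ?(ltW g0)// tE.
  rewrite (_ : ref_vol n `^ 3^-1 = rf); last by rewrite /rf div1r.
  rewrite (_ : g `^ 3^-1 = g `^ (1 / 3)); last by rewrite div1r.
  rewrite [leLHS](_ : _ = n.+1%:R * rf *
    (diam (facet (T k) j) `^ (1 / 3) * g `^ (1 / 3)) * (enorm z * t)); last by ring.
  rewrite /B -!mulrA; apply: ler_wpM2l => //; apply: ler_wpM2l; first exact: powR_ge0.
  rewrite mulrA; apply: ler_pM.
  - by rewrite mulr_ge0 ?powR_ge0.
  - by rewrite mulr_ge0 ?enorm_ge0// ltW.
  - have f0 := diam_facet_ge0 hV j.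
    rewrite -powRM ?(ltW g0)//; apply: ge0_ler_powR; first by [].
    - by rewrite nnegrE mulr_ge0// ltW.
    - by rewrite nnegrE; exact: normr_ge0.
    apply: le_trans (diam_bary_grad hV j shape).
    by rewrite ler_wpM2r ?(ltW g0)//; exact: diam_facet_le.
  - have [C10 _] := HC1 j.
    rewrite -(ler_pM2r g0) mulrAC; apply: (le_trans hz).
    (* The facet estimate carries the factor [g]. Since [g] times the diameter is at least 1, it is
       cancelled at the cost of one diameter, which combines with [grad_sum] into a constant. *)
    have dg := bary_grad_diam hV j; rewrite -/g in dg.
    rewrite -!mulrA; apply: ler_wpM2l => //.
    apply: (@le_trans _ _ ((diam (hull (T k)) * grad_sum (T k)) * L * g)).
      rewrite [leRHS](_ : _ = (g * diam (hull (T k))) * (grad_sum (T k) * L)); last by ring.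
      by rewrite ler_peMl// mulr_ge0.
    rewrite !mulrA; apply: ler_wpM2r; first exact: ltW.
    by apply: ler_wpM2r.
rewrite LE -EFinM /eta_D3.
apply: (@le_trans _ _ ((A * L)%:E + \sum_(j < n.+2) (B j * L)%:E)%E).
  by apply: leeD => //; apply: lee_sum => j _; exact: second.
rewrite sumEFin -EFinD lee_fin -mulr_suml -mulrDl; apply: ler_wpM2r => //.
by rewrite lerDl.
Qed.

Theorem theorem4p11 (R : realType) (n : nat)
    (dim23 : n.+1 = 2%N \/ n.+1 = 3%N)
    (Omega : set 'rV[R]_n.+1) (Omega_dom : polyhedral_domain Omega)
    (mu rho beta alpha r0 gamma : R)
    (mu_gt0 : 0 < mu) (rho_gt0 : 0 < rho) (beta_gt0 : 0 < beta)
    (alpha_gt0 : 0 < alpha) (r0_gt0 : 0 < r0) (gamma_gt0 : 0 < gamma)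
    (K : 'rV[R]_n.+1 -> 'M[R]_n.+1) (Km KM : R)
    (K_perm : permeability Omega K Km KM)
    (f0 : 'rV[R]_n.+1 -> 'rV[R]_n.+1) (f0_L : in_vLp (3 / 2)%:E Omega f0)
    (f1 : R -> 'rV[R]_n.+1) (cf1 : R) (cf1_gt0 : 0 < cf1)
    (f1_lip : forall a b, enorm (f1 a - f1 b) <= cf1 * `|a - b|)
    (f1_0 : f1 0 = 0)
    (g : 'rV[R]_n.+1 -> R) (g_L2 : in_Lp 2%:E Omega g)
    (H : Type) (T : H -> mesh R n)
    (T_conf : forall h, conforming_triangulation Omega (T h))
    (sigma : R) (T_reg : forall h, shape_regular (T h) sigma)
    (beta0 : R) (beta0_gt0 : 0 < beta0)
    (T_unif : forall h, uniformly_regular (T h) beta0)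
    (rh : H -> ('rV[R]_n.+1 -> R) -> 'rV[R]_n.+1 -> R) (ck ce : R)
    (rh_clement : forall h, clement Omega (T h) ck ce (rh h))
    (c2 : R) :
  exists2 c : R, 0 < c &
    forall (u : 'rV[R]_n.+1 -> 'rV[R]_n.+1) (p C : 'rV[R]_n.+1 -> R),
      Va Omega mu rho beta alpha r0 K f0 f1 g u p C ->
    forall (h : H)
      (ui : 'rV[R]_n.+1 -> 'rV[R]_n.+1) (Ci : 'rV[R]_n.+1 -> R)
      (u1 : 'rV[R]_n.+1 -> 'rV[R]_n.+1) (p1 C1 : 'rV[R]_n.+1 -> R),
      in_Xh Omega (T h) ui -> in_Yh Omega (T h) Ci ->
      Vahi Omega mu rho beta alpha r0 gamma K f0 f1 g (T h) ui Ci u1 p1 C1 ->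
    forall vr : 'rV[R]_n.+1 -> 'rV[R]_n.+1,
      correction_velocity Omega (T h) c2 (rh h) u1 vr ->
    forall k : 'I_(nelt (T h)),
      (eta_L1 (T h) ui u1 k <=
         vLp_norm 2%:E (hull (T h k)) (fun x => (u x - ui x)%R) +
         vLp_norm 2%:E (hull (T h k)) (fun x => (u x - u1 x)%R))%E /\
      (eta_D3 Omega (T h) u1 k <=
         c%:E * vLp_norm 3%:E (elt_patch (T h) k) vr)%E.
Proof.
have n0 : (0 < n)%N by case: dim23 => -[->].
have [bD oD [D0 _ _] _ lipD] := Omega_dom.
have [c c0 hc] := eta_D3_le sigma n0; exists c => //.
move=> u p C [Gp [GC [[[mu_u _] _ _] _ _ _]]] h ui Ci u1 p1 C1 Xi _.
move=> [[X1 _ _] _ M1 _] vr corr k; split.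
  exact: (eta_L1_le oD lipD (T_conf h) k mu_u Xi X1).
exact: (hc _ _ oD lipD (T_conf h) bD D0 (T_reg h) _ _ _ _ _ _ X1 M1 (rh_clement h) corr k).
Qed.
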